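(* Let $k$ be an algebraically closed field of characteristic $p>0$ with $p\neq 2,3$. Let $C$ be the smooth projective curve of genus $2$ over $k$ with hyperelliptic equation $Z^2=X^6+Y^6$, and let $\omega_C$ be its canonical bundle. Then: (i) $e_{HK}(C,\omega_C^{\otimes 3})=\frac{15}{4}$ if $p\equiv\pm 1\pmod 8$; (ii) $e_{HK}(C,\omega_C^{\otimes 3})=\frac{15}{4}+\frac{1}{4p^2}$ if $p\equiv\pm 3\pmod 8$.
   Context: The equation $Z^2=X^6+Y^6$ means that $C$ is the double cover of $\mathbb{P}^1$ (homogeneous coordinates $X,Y$) defined by this equation with $Z$ of degree $3$; its canonical ring is $\bigoplus_{i\ge 0}H^0(C,\omega_C^{\otimes i})\simeq k[X,Y,Z]/\langle Z^2-X^6-Y^6\rangle$ with $\deg X=\deg Y=1$, $\deg Z=3$. Hilbert-Kunz multiplicity: if $A$ is a noetherian $n$-dimensional ring of characteristic $p$ and $\mathfrak{m}$ a maximal ideal of $A$, let $\mathfrak{m}^{[e]}$ be the ideal of $A$ generated by the $p^e$-th powers of elements of $\mathfrak{m}$, and set $$e_{HK}(A,\mathfrak{m}):=\lim_{e\to\infty}\frac{\mathrm{length}(A/\mathfrak{m}^{[e]})}{p^{ne}}$$ (the limit exists and is finite). If $C$ is a smooth projective curve endowed with a line bundle $\mathcal{L}$ whose sections embed $C$ as a projectively normal curve, let $A:=\bigoplus_{l\geq 0}H^0(C,\mathcal{L}^{\otimes l})$ and $\mathfrak{m}:=\bigoplus_{l>0}H^0(C,\mathcal{L}^{\otimes l})$,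 and set $e_{HK}(C,\mathcal{L}):=e_{HK}(A,\mathfrak{m})$. *)

(* Defs.v *)
From HB Require Import structures.
From mathcomp Require Import all_boot all_order all_algebra.
From mathcomp Require Import all_classical all_reals topology normedtype sequences.

Set Implicit Arguments.
Unset Strict Implicit.
Unset Printing Implicit Defensive.

Import Order.TTheory GRing.Theory Num.Theory.
Import numFieldNormedType.Exports.

Local Open Scope classical_set_scope.
Local Open Scope ring_scope.

Section HilbertKunz.
Variable A : comNzRingType.

Definition is_ideal (I : set A) : Prop :=
  [/\ I 0, forall a b, I a -> I b -> I (a + b) & forall r a, I a -> I (r * a)].

Definition is_prime_ideal (P : set A) : Prop :=
  [/\ is_ideal P, ~ P 1 & forall a b, P (a * b) -> P a \/ P b].

Definition strict_chain (J : nat -> set A) (n : nat) : Prop :=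
  forall i, (i < n)%N -> J i `<` J i.+1.

(* Only the values [J 0], ..., [J n] matter. *)
Definition prime_chain (n : nat) : Prop :=
  exists J : nat -> set A,
    (forall i, (i <= n)%N -> is_prime_ideal (J i)) /\ strict_chain J n.

Definition has_krull_dim (n : nat) : Prop :=
  prime_chain n /\ forall m, prime_chain m -> (m <= n)%N.

(* A chain of submodules 0 = M_0 < ... < M_n = A/I, each M_i being given by
   its preimage in A, an ideal containing I. *)
Definition quotient_chain (I : set A) (n : nat) : Prop :=
  exists J : nat -> set A,
    [/\ forall i, (i <= n)%N -> is_ideal (J i), J 0%N = I, J n = [set: A]
      & strict_chain J n].

(* length (A/I) = n *)
Definition has_colength (I : set A) (n : nat) : Prop :=
  quotient_chain I n /\ forall m, quotient_chain I m -> (m <= n)%N.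

Definition frobenius_power (p : nat) (m : set A) (e : nat) : set A :=
  smallest is_ideal [set a ^+ (p ^ e) | a in m].

(* e_HK(A, m) = v, for A of characteristic p and m a maximal ideal of A *)
Definition has_eHK (R : realType) (p : nat) (m : set A) (v : R) : Prop :=
  exists n : nat, has_krull_dim n /\
  exists len : nat -> nat,
    (forall e, has_colength (frobenius_power p m e) (len e)) /\
    ((fun e : nat => (len e)%:R / (p ^ (n * e))%:R : R) @ \oo --> v).

End HilbertKunz.

(* An integral curve over k with function field K (a field extension of k via
   iota) is presented by a covering by affine opens indexed by T: the i-th one
   is Spec (chart i), where chart i is the k-subalgebra of K generated by G i.
   A line bundle L embedded in its constant generic stalk (identified with K)
   is given by its modules of sections L i, a (chart i)-submodule of K,
   over these opens. *)
Section SectionRing.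
Variables (k K : fieldType) (iota : {rmorphism k -> K}).
Variables (T : Type) (G : T -> set K).

Definition is_subalgebra (B : set K) : Prop :=
  [/\ forall c, B (iota c), forall a b, B a -> B b -> B (a + b)
    & forall a b, B a -> B b -> B (a * b)].

Definition chart (i : T) : set K := smallest is_subalgebra (G i).

Definition is_additive_subgroup (M : set K) : Prop :=
  M 0 /\ forall a b, M a -> M b -> M (a - b).

Definition product_module (M N : set K) : set K :=
  smallest is_additive_subgroup [set a * b | a in M & b in N].

(* M^{(x) n}: the power M^n in K, with M^0 = chart i *)
Definition tensor_power (L : T -> set K) (n : nat) : T -> set K :=
  fun i => iter n (product_module (L i)) (chart i).

Definition global_sections (L : T -> set K) : set K :=
  [set f | forall i, L i f].

(* The canonical bundle, D being the derivation of K/k with D x = 1 for some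
   separating element x. As Omega_{K/k} = K dx, a rational differential f dx is
   encoded by f, so that db is encoded by D b; the regular differentials on
   the i-th chart are generated over it by the db, b in chart i. *)
Definition canonical_bundle (D : K -> K) : T -> set K :=
  fun i => product_module (chart i) (D @` chart i).

(* The ring \bigoplus_l H^0(L^{(x) l}), inside K[t], with H^0(L^{(x) l})
   placed in degree l. *)
Definition section_ring_pred (L : T -> set K) : {pred {poly K}} :=
  fun f => `[< forall l, global_sections (tensor_power L l) f`_l >].

Lemma smallest_closed U (C : set U -> Prop) (S : set U) :
  (forall F : set (set U), F `<=` C -> C (\bigcap_(M in F) M)) ->
  C (smallest C S).
Proof. by move=> CF; apply: CF => M []. Qed.

Lemma chart_subalgebra i : is_subalgebra (chart i).
Proof.
apply: smallest_closed => F FC; split.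
- by move=> c M /FC[].
- by move=> a b Fa Fb M FM; case: (FC _ FM) => _ + _; apply; [exact: Fa|exact: Fb].
- by move=> a b Fa Fb M FM; case: (FC _ FM) => _ _; apply; [exact: Fa|exact: Fb].
Qed.

Lemma product_module_subgroup M N : is_additive_subgroup (product_module M N).
Proof.
apply: smallest_closed => F FC; split.
- by move=> P /FC[].
- by move=> a b Fa Fb P FP; case: (FC _ FP) => _; apply; [exact: Fa|exact: Fb].
Qed.

Lemma product_module_mem (M N : set K) a b :
  M a -> N b -> product_module M N (a * b).
Proof. by move=> Ma Nb P [_]; apply; exists a => //; exists b. Qed.

Lemma product_module_ind (M N P : set K) : is_additive_subgroup P ->
  (forall a b, M a -> N b -> P (a * b)) -> product_module M N `<=` P.
Proof.
by move=> Psub PM c; apply; split=> // _ [a Ma [b Nb <-]]; exact: PM.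
Qed.

Lemma tensor_power_subgroup L n i : is_additive_subgroup (tensor_power L n i).
Proof.
case: n => [|n]; last exact: product_module_subgroup.
have [Bc BD BM] := chart_subalgebra i.
split=> [|a b Ba Bb]; first by rewrite -(rmorph0 iota); exact: Bc.
apply: (BD) => //; rewrite -mulN1r -(rmorphN1 iota).
by apply: BM => //; exact: Bc.
Qed.

Lemma tensor_powerD L m n i a b :
  tensor_power L m i a -> tensor_power L n i b ->
  tensor_power L (m + n) i (a * b).
Proof.
have subM (P : set K) (c : K) : is_additive_subgroup P ->
    is_additive_subgroup [set u | P (u * c)].
  by case=> P0 PB; split=> [|u v Pu Pv] /=; rewrite ?mul0r // mulrBl; exact: PB.
elim: m a => [|m IHm] a /= Ma Nb; last first.
  have Psub := subM _ b (tensor_power_subgroup L (m.+1 + n) i).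
  apply: (product_module_ind Psub _ Ma) => u v Lu Mv /=; rewrite -mulrA.
  by apply: product_module_mem => //; exact: IHm.
elim: n b Nb => [|n IHn] b /= Nb.
  by have [_ _] := chart_subalgebra i; apply.
have Psub := subM _ a (tensor_power_subgroup L n.+1 i).
rewrite mulrC; apply: (product_module_ind Psub _ Nb) => u v Lu Nv /=.
by rewrite -mulrA; apply: product_module_mem => //; rewrite mulrC; exact: IHn.
Qed.

Lemma section_ring_subring L : subring_closed (section_ring_pred L).
Proof.
split.
- apply/asboolP => l i; rewrite coef1; case: l => [|l] /=.
    by rewrite -(rmorph1 iota); have [Bc _ _] := chart_subalgebra i; exact: Bc.
  by have [] := product_module_subgroup (L i) (tensor_power L l i).
- move=> f g /asboolP Hf /asboolP Hg; apply/asboolP => l i; rewrite coefB.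
  by have [_] := tensor_power_subgroup L l i; apply; [exact: Hf|exact: Hg].
- move=> f g /asboolP Hf /asboolP Hg; apply/asboolP => l i; rewrite coefM.
  have [M0 MB] := tensor_power_subgroup L l i.
  apply: big_ind => // [u v Mu Mv|j _].
    by rewrite -[v]opprK; apply: (MB) => //; rewrite -sub0r; exact: MB.
  by rewrite -{1}(subnKC (leq_ord j)); apply: tensor_powerD; [exact: Hf|exact: Hg].
Qed.

HB.instance Definition _ L := GRing.isSubringClosed.Build {poly K}
  (section_ring_pred L) (section_ring_subring L).

Definition section_ring (L : T -> set K) := {f : {poly K} | section_ring_pred L f}.

HB.instance Definition _ L := SubType.on (section_ring L).
HB.instance Definition _ L := [Choice of section_ring L by <:].
HB.instance Definition _ L := [SubChoice_isSubComNzRing of section_ring L by <:].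

(* \bigoplus_{l > 0} H^0(L^{(x) l}) *)
Definition irrelevant_ideal (L : T -> set K) : set (section_ring L) :=
  [set f | (val f : {poly K})`_0 = 0].

(* e_HK(C, L) = v *)
Definition curve_has_eHK (R : realType) (p : nat) (L : T -> set K) (v : R) : Prop :=
  has_eHK p (@irrelevant_ideal L) v.

End SectionRing.

Section Sextic.
Variables (k K : fieldType) (iota : {rmorphism k -> K}).

(* K is the function field of Z^2 = X^6 + Y^6, with x = X/Y and z = Z/Y^3. *)
Definition is_sextic_function_field (x z : K) : Prop :=
  [/\ forall q : {poly k}, q != 0 -> (map_poly iota q).[x] != 0,
      z ^+ 2 = x ^+ 6 + 1
    & forall f : K, exists a b : K,
        [/\ smallest (is_subalgebra iota) [set x; z] a,
            smallest (is_subalgebra iota) [set x; z] b, b != 0 & f = a / b]].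

(* Generators of the coordinate rings of the opens Y != 0 and X != 0; in the
   latter, Y/X = x^-1 and Z/X^3 = z/x^3. They cover the curve, since X = Y = 0
   would force Z = 0. *)
Definition sextic_charts (x z : K) : bool -> set K :=
  fun b => if b then [set x; z] else [set x^-1; z / x ^+ 3].

(* D = d/dx *)
Definition is_derivation_wrt (x : K) (D : K -> K) : Prop :=
  [/\ forall a b, D (a + b) = D a + D b,
      forall a b, D (a * b) = a * D b + b * D a,
      forall c, D (iota c) = 0
    & D x = 1].

End Sextic.

(* Main.v *)
(* With F = X^6 + Y^6, an element of degree l of A is a + b Z with forms a, b of
   degrees 3 l and 3 l - 3 in X and Y, and m is generated by X^3, X^2 Y, X Y^2,
   Y^3 and Z. For q = p^e we have Z^q = F^((q-1)/2) Z, so that A / m^[q] is the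
   direct sum of the spaces of forms of degrees 3 l, resp. 3 l - 3, modulo
   (X^q, Y^q)^3 and F^n with n = (q+1)/2, resp. (q-1)/2. The dimension of such
   a quotient is known as soon as one knows which forms of (X^q, Y^q)^3, that is,
   whose exponents of X lie in four intervals of length L spaced by q, are
   divisible by F^n.
   If Q is a power of p then F^Q = X^(6Q) + Y^(6Q); as a polynomial with c terms
   of degrees < p cannot vanish to order c at -1, the absence of multiples of F^n
   supported on intervals reduces, when going from Q to p Q, to the same
   question for the residues modulo 6 Q covered once more than the others.
   If p = 1, 7 mod 8, the recursion yields that there are none up to L ~ 3q/4 and
   that their dimension then grows like 4 (L - 3q/4). If p = 3, 5 mod 8, the
   four intervals cover the residues modulo 6q/p unevenly and the threshold
   splits: three thresholds are shifted by q/(4p) one way and one by 3q/(4p)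
   the other way. Summing over l, the shifts contribute q^2/(4 p^2). *)

From HB Require Import structures.
Require Import Defs.
From mathcomp Require Import all_boot all_order all_algebra.
From mathcomp Require Import all_classical all_reals topology normedtype sequences.
From mathcomp Require Import qpoly zify ring lra.

Set Implicit Arguments.
Unset Strict Implicit.
Unset Printing Implicit Defensive.

Import GRing.Theory.
Local Open Scope classical_set_scope.
Local Open Scope ring_scope.

(** * Sparse multiples of powers of the sextic *)

Section Lacunary.
Variables (k : fieldType) (p : nat).
Hypothesis hp : p \in [pchar k].

(** Put L = m - 3q <= q for forms of degree m - 1. Those in (X^q, Y^q)^3 have dimension 4L and the
    multiples of F^n about L, so the quotient has dimension about m - 5L + E(L), where E(L) is the
    dimension of the intersection. The quotient vanishes at L = q, hence E(q) = q: if E(L) is a sum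
    of four terms max(0, L - a_i), the a_i add up to 3q. The length is then (11 q^2 + sum of (q -
    a_i)^2) / 3 up to O(q), smallest when the a_i agree. Vanishing of sparse multiples bounds E from
    above. From below, E >= 0 and nonnegativity of the quotient give E(L) >= max(0, 4L - 3q), which
    is enough for four equal thresholds. For p = 3, 5 mod 8 multiples must also be produced between
    the two thresholds; they come from a dimension count on forms whose exponents avoid the poorly
    covered residues. In these classes the recursion ends after one step: with Q = q/p and (q-1)/2 =
    Q (p-1)/2 + c0, the residues covered too often lie in one window of length 6 c0, the degree of
    F^c0. *)

Definition sextic : {poly k} := 'X^6 + 1.

Definition supported (S : pred nat) (f : {poly k}) := forall i, f`_i != 0 -> S i.

Definition only_zero (S : pred nat) (n : nat) :=
  forall f, supported S f -> sextic ^+ n %| f -> f = 0.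

Lemma eq_natr_lt i j : (i < p)%N -> (j < p)%N -> i%:R = j%:R :> k -> i = j.
Proof.
wlog ij : i j / (i <= j)%N => [wl ip jp e|ip jp /eqP].
  by case/orP: (leq_total i j) => ?; [|apply/esym]; apply: wl.
rewrite eq_sym -subr_eq0 -natrB // -(dvdn_pcharf hp) => /dvdn_leq.
rewrite subn_gt0.
by case: (ltnP i j) => [lij /(_ _)|]; lia.
Qed.

(* The operator f |-> X f' - a f removes the term of degree a and lowers the
   order of vanishing at -1 by at most one. *)
Lemma few_terms (s : seq nat) (f : {poly k}) :
  (forall i, i \in s -> (i < p)%N) -> supported (mem s) f ->
  ('X + 1) ^+ size s %| f -> f = 0.
Proof.
elim: s f => [|a s IHs] f sp Sf /= dvd.
  by apply/polyP => i; rewrite coef0; apply/eqP/negPn/negP => /Sf.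
have ap : (a < p)%N by apply: sp; rewrite mem_head.
pose g := 'X * f^`() - a%:R *: f.
have gE i : g`_i = (i%:R - a%:R) * f`_i.
  rewrite coefB coefZ coefXM coef_deriv mulrBl.
  by case: i => [|i] /=; rewrite ?mul0r ?mulr_natl.
have g0 : g = 0.
  apply: IHs.
  - by move=> i si; apply: sp; rewrite inE si orbT.
  - move=> i; rewrite gE mulf_eq0 negb_or subr_eq0 => /andP[ia /Sf].
    by rewrite !inE => /orP[/eqP ia'|//]; rewrite ia' eqxx in ia.
  - case/dvdpP: dvd => h fE; rewrite /g fE; apply/dvdpP.
    exists ('X * h^`() * ('X + 1) + 'X * h * (size s).+1%:R - a%:R%:P * h * ('X + 1)).
    rewrite derivM deriv_exp derivD derivX -polyC1 derivC addr0 polyC1 mul1r /=.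
    by rewrite exprS -mul_polyC -mulr_natr; ring.
have f_a i : i != a -> f`_i = 0.
  move=> ia; apply/eqP/negPn/negP => fi.
  have : g`_i = 0 by rewrite g0 coef0.
  rewrite gE => /eqP; rewrite mulf_eq0 (negPf fi) orbF subr_eq0 => /eqP ii.
  move: (sp _ (Sf _ fi)) => ip; move/eq_natr_lt: ii => /(_ ip ap) iaE.
  by rewrite iaE eqxx in ia.
have fE : f = f`_a *: 'X^a.
  apply/polyP => i; rewrite coefZ coefXn.
  by case: (eqVneq i a) => [->|/f_a ->]; rewrite ?mulr1 ?mulr0.
have : root f (-1).
  have : ('X - (-1)%:P) %| f.
    by rewrite polyCN polyC1 opprK; apply: dvdp_trans dvd; rewrite exprS dvdp_mulr.
  by rewrite dvdp_XsubCl.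
rewrite /root fE hornerZ hornerXn mulf_eq0 signr_eq0 orbF => /eqP fa0.
by rewrite fa0 scale0r.
Qed.

(** Splitting by residues modulo M yields M polynomials, on each of which X^M + 1 acts as X + 1, so
    that [few_terms] applies to each. The length [size f] is merely a safe upper bound. *)
Definition slice (M r : nat) (f : {poly k}) : {poly k} :=
  \poly_(j < size f) f`_(M * j + r).

Lemma coef_slice M r f j : (0 < M)%N -> (slice M r f)`_j = f`_(M * j + r).
Proof.
move=> M0; rewrite coef_poly; case: ltnP => // sj.
by rewrite nth_default //; apply: leq_trans sj _; nia.
Qed.

Lemma slice_mul M r n f : (r < M)%N ->
  slice M r (('X^M + 1) ^+ n * f) = ('X + 1) ^+ n * slice M r f.
Proof.
move=> rM; have M0 : (0 < M)%N by apply: leq_ltn_trans rM.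
elim: n f => [|n IHn] f; first by rewrite !expr0 !mul1r.
rewrite !exprSr -!mulrA IHn; congr (_ * _).
apply/polyP => j; rewrite coef_slice // !mulrDl !mul1r !coefD coefXnM coefXM.
rewrite !coef_slice //; case: j => [|j] /=; first by rewrite muln0 add0n rM.
by rewrite ltnNge mulnS -addnA leq_addr /= addKn.
Qed.

Lemma slice_sum M f : (0 < M)%N ->
  f = \sum_(r < M) 'X^r * (slice M r f \Po 'X^M).
Proof.
move=> M0; have co (r d c : nat) (g : {poly k}) : (r < M)%N -> (c < M)%N ->
    ('X^r * (g \Po 'X^M))`_(M * d + c) = if (r == c)%N then g`_d else 0.
  move=> rM cM; rewrite coefXnM coef_comp_poly_Xn //.
  case: eqVneq => [->|ne].
    by rewrite addnK ltnNge leq_addl /= dvdn_mulr // mulKn.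
  case: ltnP => // rd; rewrite ifN //.
  apply/negP => /dvdnP[t e]; have {}e : (M * d + c = M * t + r)%N by lia.
  have [td|td|td] := ltngtP t d.
  - by have := leq_mul (leqnn M) td; rewrite mulnS; lia.
  - by have := leq_mul (leqnn M) td; rewrite mulnS; lia.
  - by rewrite td in e; lia.
apply/polyP => i; rewrite coef_sum.
have iM : (i %% M < M)%N by rewrite ltn_mod.
rewrite {2}(divn_eq i M) (mulnC _ M) (bigD1 (Ordinal iM)) //= big1 => [|r ne].
  by rewrite co // eqxx coef_slice // addr0 (mulnC M) -divn_eq.
by rewrite co // ifN.
Qed.

Lemma dvd_comp_sub_eval M (h : {poly k}) :
  'X^M + 1 %| (h \Po 'X^M) - (h.[-1])%:P.
Proof.
have : root (h - (h.[-1])%:P) (-1) by rewrite /root !hornerE subrr.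
case/factor_theorem => g /eqP; rewrite subr_eq => /eqP {1}->.
rewrite comp_polyD comp_polyM comp_polyB comp_polyX !comp_polyC addrK.
by rewrite polyCN polyC1 opprK dvdp_mull.
Qed.

(** The sum is the residue of f modulo X^M + 1, because X^M = -1 there. *)
Lemma dvd_slice_eval M f (g : {poly k}) : (0 < M)%N -> g %| 'X^M + 1 ->
  g %| f -> g %| \sum_(r < M) (slice M r f).[-1] *: 'X^r.
Proof.
move=> M0 dg; rewrite {1}(slice_sum f M0) => df.
rewrite -(dvdp_subr _ df) -sumrB; apply: (big_ind (fun u => g %| u)) => [|u v|r _].
- exact: dvdp0.
- by move=> *; apply: dvdp_add.
- by rewrite -mul_polyC mulrC -mulrBl dvdp_mulr // (dvdp_trans dg) ?dvd_comp_sub_eval.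
Qed.

Definition residue_count (M : nat) (S : pred nat) (r : nat) : nat :=
  count (fun j => S (M * j + r)%N) (iota 0 p).

Lemma sextic_Frobenius Q : p.-nat Q -> sextic ^+ Q = 'X^(6 * Q) + 1.
Proof.
move=> pQ; rewrite exprDn_pchar ?expr1n -?exprM //.
apply: sub_in_pnat pQ => i _ /eqnP ->; by rewrite pchar_poly.
Qed.

(** Since F^(Q c1 + c0) = (X^(6Q) + 1)^c1 F^c0, every slice of f vanishes to order c1 at -1, so
    slices with at most c1 terms are zero. A slice with c1 + 1 terms needs one more zero. It comes
    from level Q: the residue of f / (X^(6Q) + 1)^c1 modulo X^(6Q) + 1 is a multiple of F^c0
    supported on the residues covered more than c1 times. The bound [6 * Q * p] keeps the exponents
    of the slices below p. *)
Lemma only_zero_step (Q c1 c0 : nat) (S : pred nat) :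
  p.-nat Q -> (c0 <= Q)%N -> (forall i, S i -> (i < 6 * Q * p)%N) ->
  (forall r, (r < 6 * Q)%N -> (residue_count (6 * Q) S r <= c1.+1)%N) ->
  only_zero (fun r => (r < 6 * Q) && (c1 < residue_count (6 * Q) S r))%N c0 ->
  only_zero S (Q * c1 + c0).
Proof.
move=> pQ c0Q SM; set M := (6 * Q)%N => cS Z f Sf.
have M0 : (0 < M)%N by case/andP: pQ; lia.
have few (r c : nat) : (r < M)%N -> (residue_count M S r <= c)%N ->
    ('X + 1) ^+ c %| slice M r f -> slice M r f = 0.
  move=> rM cr dvd; pose s := [seq j <- iota 0 p | S (M * j + r)%N].
  apply: (@few_terms s).
  - by move=> i; rewrite mem_filter mem_iota => /andP[_].
  - move=> j; rewrite coef_slice // => /Sf Sj.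
    suff: j \in s by [].
    rewrite mem_filter mem_iota Sj /=; move/SM: Sj; rewrite -/M; nia.
  - by apply: dvdp_trans dvd; rewrite dvdp_exp2l // size_filter.
rewrite exprD exprM sextic_Frobenius // -/M => /dvdpP[h fE].
pose g := sextic ^+ c0 * h.
have {}fE : f = ('X^M + 1) ^+ c1 * g by rewrite fE /g; ring.
have fg r : (r < M)%N -> slice M r f = ('X + 1) ^+ c1 * slice M r g.
  by move=> rM; rewrite {1}fE slice_mul.
have X1 : 'X + 1 = 'X - (-1)%:P :> {poly k} by rewrite polyCN polyC1 opprK.
have X1n0 n : ('X + 1 : {poly k}) ^+ n != 0 by rewrite X1 expf_neq0 ?polyXsubC_eq0.
have g0 r : (r < M)%N -> (residue_count M S r <= c1)%N -> slice M r g = 0.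
  move=> rM /few - /(_ rM); rewrite fg // dvdp_mulr // => /(_ isT) /eqP.
  by rewrite mulf_eq0 (negPf (X1n0 _)) => /eqP.
pose w := \sum_(r < M) (slice M r g).[-1] *: 'X^r.
have wE i : w`_i = if (i < M)%N then (slice M i g).[-1] else 0.
  rewrite coef_sum; case: ltnP => iM.
    rewrite (bigD1 (Ordinal iM)) //= big1 => [|r ne].
      by rewrite coefZ coefXn eqxx mulr1 addr0.
    by rewrite -val_eqE /= in ne; rewrite coefZ coefXn eq_sym (negPf ne) mulr0.
  by rewrite big1 // => r _; rewrite coefZ coefXn gtn_eqF ?mulr0 // (leq_trans _ iM).
have w0 : w = 0.
  apply: Z.
  - move=> r; rewrite wE; case: ltnP => [rM|]; last by rewrite eqxx.
    by rewrite -/M ltnNge; apply: contraNN => /(g0 _ rM) ->; rewrite horner0.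
  (* F^c0 divides the modulus X^(6Q) + 1 = F^Q because c0 <= Q. *)
  - apply: dvd_slice_eval; rewrite ?dvdp_mulr //.
    by rewrite -sextic_Frobenius // dvdp_exp2l.
rewrite (slice_sum f M0) big1 // => r _; rewrite (few r c1.+1) ?cS ?comp_poly0 ?mulr0 //.
rewrite fg // exprSr dvdp_mul2l ?X1n0 // X1 dvdp_XsubCl /root.
by move: (wE r); rewrite w0 coef0 ltn_ord => <-.
Qed.
End Lacunary.

(** * Exponent sets that are unions of intervals, and their residues *)

Section Blocks.
Variables (k : fieldType) (p : nat).
Local Notation only_zero := (@only_zero k).
Local Notation residue_count := (residue_count p).

Lemma only_zero_mono (S S' : pred nat) n n' :
  (forall i, S' i -> S i) -> (n <= n')%N -> only_zero S n -> only_zero S' n'.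
Proof.
move=> SS nn Z f Sf df; apply: Z => [i /Sf /SS //|].
by apply: dvdp_trans df; rewrite dvdp_exp2l.
Qed.

Lemma only_zero_shift d (S : pred nat) n :
  only_zero (fun i => (d <= i) && S (i - d))%N n -> only_zero S n.
Proof.
move=> Z f Sf df; suff /eqP : 'X^d * f = 0.
  by rewrite mulf_eq0 expf_eq0 polyX_eq0 andbF => /eqP.
apply: Z; last exact: dvdp_mull.
by move=> i; rewrite coefXnM; case: ltnP => [_|di /Sf ->]; rewrite ?eqxx.
Qed.

Definition intervals (s : seq (nat * nat)) : pred nat :=
  fun i => has (fun ab => ab.1 <= i < ab.2)%N s.

Lemma intervals_shift d s i : (d <= i)%N && intervals s (i - d)%N ->
  intervals [seq (ab.1 + d, ab.2 + d)%N | ab <- s] i.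
Proof.
case/andP=> di /hasP[ab abs abi]; apply/hasP; exists (ab.1 + d, ab.2 + d)%N.
  by apply/mapP; exists ab.
by move: abi => /=; lia.
Qed.

Lemma count_residue_lt M r t b : (r < M)%N -> (b <= M)%N -> (t < p)%N ->
  count (fun j => M * j + r < M * t + b)%N (iota 0 p) = (t + (r < b))%N.
Proof.
move=> rM bM tp; rewrite -[p in iota 0 p](subnKC tp) iotaD count_cat add0n.
rewrite [X in (_ + X)%N](_ : _ = 0%N); last first.
  apply/eqP; rewrite -leqn0 leqNgt -has_count; apply/hasPn => j.
  by rewrite mem_iota => /andP[tj _]; have := leq_mul (leqnn M) tj; rewrite mulnS; lia.
rewrite addn0 -addn1 iotaD count_cat /= add0n addn0 ltn_add2l; congr (_ + _)%N.
rewrite -[RHS](size_iota 0 t); apply/eqP; rewrite -all_count; apply/allP => j.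
by rewrite mem_iota add0n /= => jt; have := leq_mul (leqnn M) jt; rewrite mulnS; lia.
Qed.

Lemma count_residue_interval M r t b t' b' : (r < M)%N ->
  (b <= M)%N -> (t < p)%N -> (b' <= M)%N -> (t' < p)%N ->
  (count (fun j => M * t + b <= M * j + r < M * t' + b') (iota 0 p) =
     (t' + (r < b')) - (t + (r < b)))%N.
Proof.
move=> rM bM tp bM' tp'; rewrite -(count_residue_lt rM bM tp) -(count_residue_lt rM bM' tp').
have [le|/ltnW le] := leqP (M * t + b) (M * t' + b').
  apply/eqP; rewrite -(eqn_add2r (count (fun j => M * j + r < M * t + b)%N (iota 0 p))).
  rewrite subnK; last by apply: sub_count => j /=; lia.
  rewrite -count_predUI [X in (_ + X)%N](_ : _ = 0%N) ?addn0.
    by apply/eqP/eq_count => j /=; lia.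
  by apply/eqP; rewrite -leqn0 leqNgt -has_count; apply/hasPn => j _ /=; lia.
rewrite (_ : (_ - _ = 0)%N); last first.
  by apply/eqP; rewrite subn_eq0; apply: sub_count => j /=; lia.
by apply/eqP; rewrite -leqn0 leqNgt -has_count; apply/hasPn => j _ /=; lia.
Qed.

(* An interval is encoded by the quotients and remainders of its end points. *)
Definition split_interval (M : nat) (x : (nat * nat) * (nat * nat)) :=
  (M * x.1.1 + x.1.2, M * x.2.1 + x.2.2)%N.

Definition reduced (M : nat) (x : (nat * nat) * (nat * nat)) :=
  [&& x.1.1 < p, x.1.2 <= M, x.2.1 < p & x.2.2 <= M]%N.

Lemma residue_count_intervals M s r : (r < M)%N -> all (reduced M) s ->
  (residue_count M (intervals (map (split_interval M) s)) r <=
   \sum_(x <- s) ((x.2.1 + (r < x.2.2)) - (x.1.1 + (r < x.1.2))))%N.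
Proof.
move=> rM; elim: s => [|x s IHs] /=.
  by rewrite big_nil /residue_count /intervals /= count_pred0.
case/andP=> /and4P[? ? ? ?] /IHs {}IHs; rewrite big_cons.
rewrite -(@count_residue_interval M) //; apply: leq_trans (leq_add (leqnn _) IHs).
by rewrite -count_predUI leq_addr.
Qed.

Lemma intervals_reduced_lt M s i : all (reduced M) s ->
  intervals (map (split_interval M) s) i -> (i < M * p)%N.
Proof.
move=> /allP red /hasP[_ /mapP[x /red /and4P[_ _ xp xM] ->]] /andP[_ /=] ix.
by have := leq_mul (leqnn M) xp; rewrite mulnS; lia.
Qed.

Hypothesis hp : p \in [pchar k].

(** B may be any set containing the residues covered c1 + 1 times: a single inequality both bounds
    the coverage and locates these residues. *)
Lemma only_zero_intervals_step (Q c1 c0 : nat) s (B : pred nat) :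
  p.-nat Q -> (c0 <= Q)%N -> all (reduced (6 * Q)) s ->
  (forall r, (r < 6 * Q)%N ->
     let c := (\sum_(x <- s) ((x.2.1 + (r < x.2.2)) - (x.1.1 + (r < x.1.2))))%N in
     (c <= c1 + B r)%N) ->
  only_zero B c0 -> only_zero (intervals (map (split_interval (6 * Q)) s)) (Q * c1 + c0).
Proof.
move=> pQ c0Q red cB ZB; apply: (only_zero_step hp) => //.
- by move=> i; exact: intervals_reduced_lt.
- move=> r rQ; apply: leq_trans (residue_count_intervals rQ red) _.
  by apply: leq_trans (cB r rQ) _; rewrite -addn1 leq_add2l leq_b1.
- apply: only_zero_mono ZB => // r /andP[rQ]; apply: contraTT => nB.
  rewrite -leqNgt; apply: leq_trans (residue_count_intervals rQ red) _.
  by have := cB r rQ; rewrite (negPf nB) addn0.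
Qed.

(** Equal lengths give the exponents occurring in (X^q, Y^q)^3. Unequal ones are needed for the
    split thresholds and for the intermediate configuration when p = 7 mod 8. *)
Definition blocks q L0 L1 L2 L3 : pred nat :=
  intervals [:: (0, L0); (q, q + L1); (2 * q, 2 * q + L2); (3 * q, 3 * q + L3)]%N.

(** Modulo 6Q the blocks with q = p Q start at j Q if p = 6b + 1 and at - j Q if p = 6b + 5. In the
    second case a shift by 3Q yields (3 - j) Q, the same four starting points in reverse order; this
    is why each vanishing result below is proved twice. *)
Lemma char_mod6 : p <> 2%N -> p <> 3%N ->
  (exists b, p = 6 * b + 1)%N \/ (exists b, p = 6 * b + 5)%N.
Proof.
move=> p2 p3; have pp : prime p by case/andP: hp.
have ndiv d : prime d -> p <> d -> (p %% d != 0)%N.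
  by move=> pd pnd; rewrite -/(dvdn d p) dvdn_prime2 // eq_sym; apply/eqP.
have := ndiv 2%N isT p2; have := ndiv 3%N isT p3 => m3 m2.
have [m|m] : (p %% 6 = 1 \/ p %% 6 = 5)%N by lia.
  by left; exists (p %/ 6)%N; lia.
by right; exists (p %/ 6)%N; lia.
Qed.

End Blocks.

(* [regions r s]: case analysis on the position of [r] among the increasing
   thresholds [s], all comparisons with [r] being then decided by [lia]. *)
Ltac decide_leq :=
  repeat match goal with |- context [leq ?x ?y] =>
    first [ rewrite (_ : leq x y = true); [|by lia]
          | rewrite (_ : leq x y = false); [|by lia] ] end; done.

Ltac eval_lt r :=
  repeat match goal with |- context [nat_of_bool (leq (S r) ?x)] =>
    first [ rewrite (_ : leq (S r) x = true); [|by lia]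
          | rewrite (_ : leq (S r) x = false); [|by lia] ] end.

Ltac region r :=
  eval_lt r;
  first [ by apply: leq_trans (leq_addr _ _); lia
        | match goal with |- context [nat_of_bool ?B] =>
            rewrite (_ : B = true);
              [by lia | rewrite /blocks /intervals /=; decide_leq] end ].

Ltac regions r s :=
  match s with
  | nil => region r
  | ?x :: ?s' => case: (ltnP r x) => ?; [region r | regions r s']
  end.

(** * The recursion from Q to p Q for equal blocks *)

Section Vanishing.
Variables (k : fieldType) (p : nat).
Hypothesis hp : p \in [pchar k].
Hypotheses (p2 : p <> 2%N) (p3 : p <> 3%N).
Local Notation only_zero := (@only_zero k).
Local Open Scope nat_scope.

Lemma only_zero_intervals d Q c1 c0 s t (B : pred nat) :
  p.-nat Q -> c0 <= Q -> all (reduced p (6 * Q)) t ->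
  [seq (ab.1 + d, ab.2 + d) | ab <- s] = map (split_interval (6 * Q)) t ->
  (forall r, r < 6 * Q ->
     let c := \sum_(x <- t) ((x.2.1 + (r < x.2.2)) - (x.1.1 + (r < x.1.2))) in
     c <= c1 + B r) ->
  only_zero B c0 -> only_zero (intervals s) (Q * c1 + c0).
Proof.
move=> pQ c0Q red st cB ZB; apply: (@only_zero_shift _ d).
apply: only_zero_mono (only_zero_intervals_step hp pQ c0Q red cB ZB) => // i.
by rewrite -st; exact: intervals_shift.
Qed.

(** A block of length 6QN + l covers every residue N times and l consecutive ones, from its starting
    point on, once more. As l <= Q, the four extra stretches are disjoint and reproduce the
    configuration at level Q. Here 4N = (p - 1)/2. *)
Lemma blocks_step1 Q N l c0 :
  p.-nat Q -> p = 8 * N + 1 -> l <= Q -> c0 <= Q ->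
  only_zero (blocks Q l l l l) c0 ->
  let L := 6 * (Q * N) + l in
  only_zero (blocks (p * Q) L L L L) (Q * (4 * N) + c0).
Proof.
move=> pQ pN lQ c0Q Z L; have Q0 : 0 < Q by case/andP: pQ.
have [[b pb]|[b pb]] := char_mod6 hp p2 p3.
  have bN : 6 * b = 8 * N by lia.
  apply: (@only_zero_intervals (0) Q (4 * N) c0 _
    [:: ((0, 0), (N, l)); ((b, Q), (b + N, Q + l));
             ((2 * b, 2 * Q), (2 * b + N, 2 * Q + l));
             ((3 * b, 3 * Q), (3 * b + N, 3 * Q + l))] _ pQ c0Q _ _ _ Z).
  - by rewrite /reduced /=; lia.
  - rewrite /split_interval /= /L !pb; congr [:: (_, _); (_, _); (_, _); (_, _)]; lia.
  - move=> r rQ; rewrite !big_cons big_nil /=.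
    regions r [:: l; Q; Q + l; 2 * Q; 2 * Q + l; 3 * Q; 3 * Q + l].
have bN : 6 * b + 4 = 8 * N by lia.
apply: (@only_zero_intervals (3 * Q) Q (4 * N) c0 _
    [:: ((0, 3 * Q), (N, 3 * Q + l)); ((b.+1, 2 * Q), (b.+1 + N, 2 * Q + l));
           ((2 * b.+1, Q), (2 * b.+1 + N, Q + l));
           ((3 * b.+1, 0), (3 * b.+1 + N, l))] _ pQ c0Q _ _ _ Z).
- by rewrite /reduced /=; lia.
- rewrite /split_interval /= /L !pb; congr [:: (_, _); (_, _); (_, _); (_, _)]; lia.
- move=> r rQ; rewrite !big_cons big_nil /=.
    regions r [:: l; Q; Q + l; 2 * Q; 2 * Q + l; 3 * Q; 3 * Q + l].
Qed.

End Vanishing.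

Section Vanishing.
Variables (k : fieldType) (p : nat).
Hypothesis hp : p \in [pchar k].
Hypotheses (p2 : p <> 2%N) (p3 : p <> 3%N).
Local Notation only_zero := (@only_zero k).
Local Open Scope nat_scope.

(* The residues common to four cyclic intervals of length 6 Q - U starting at
   0, Q, 2 Q and 3 Q are the complement of four gaps of length U. *)
Lemma blocks_step7a Q N U c0 :
  p.-nat Q -> p = 8 * N + 7 -> U <= Q -> c0 <= Q ->
  only_zero (blocks Q (Q - U) (Q - U) (Q - U) (3 * Q - U)) c0 ->
  let L := 6 * (Q * N) + (6 * Q - U) in
  only_zero (blocks (p * Q) L L L L) (Q * (4 * N + 3) + c0).
Proof.
move=> pQ pN UQ c0Q Z L; have Q0 : 0 < Q by case/andP: pQ.
have [[b pb]|[b pb]] := char_mod6 hp p2 p3.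
  have bN : 6 * b = 8 * N + 6 by lia.
  apply: (@only_zero_intervals _ _ hp 0 Q (4 * N + 3) c0 _
    [:: ((0, 0), (N, 6 * Q - U)); ((b, Q), (b + N.+1, Q - U));
             ((2 * b, 2 * Q), (2 * b + N.+1, 2 * Q - U));
             ((3 * b, 3 * Q), (3 * b + N.+1, 3 * Q - U))] _ pQ c0Q _ _ _ Z).
  - by rewrite /reduced /=; lia.
  - rewrite /split_interval /= /L !pb.
    congr [:: (_, _); (_, _); (_, _); (_, _)]; lia.
  - move=> r rQ; rewrite !big_cons big_nil /=.
    regions r [:: Q - U; Q; 2 * Q - U; 2 * Q; 3 * Q - U; 3 * Q; 6 * Q - U].
have bN : 6 * b = 8 * N + 2 by lia.
apply: (@only_zero_intervals _ _ hp (3 * Q) Q (4 * N + 3) c0 _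
    [:: ((0, 3 * Q), (N.+1, 3 * Q - U)); ((b.+1, 2 * Q), (b.+1 + N.+1, 2 * Q - U));
           ((2 * b.+1, Q), (2 * b.+1 + N.+1, Q - U));
           ((3 * b.+1, 0), (3 * b.+1 + N, 6 * Q - U))] _ pQ c0Q _ _ _ Z).
- by rewrite /reduced /=; lia.
- rewrite /split_interval /= /L !pb.
    congr [:: (_, _); (_, _); (_, _); (_, _)]; lia.
- move=> r rQ; rewrite !big_cons big_nil /=.
    regions r [:: Q - U; Q; 2 * Q - U; 2 * Q; 3 * Q - U; 3 * Q; 6 * Q - U].
Qed.

(** A gap of length U = 6Q (N + 1) - V covers every residue N + 1 times, except for V consecutive
    ones covered N times. The complement of the four gaps thus covers every residue p - 4 (N + 1) =
    4N + 3 times, and four stretches of length V once more: after two steps the blocks are equal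
    again. *)
Lemma blocks_step7b Q N V c0 :
  p.-nat Q -> p = 8 * N + 7 -> V <= Q -> c0 <= Q ->
  only_zero (blocks Q V V V V) c0 ->
  let U := 6 * (Q * N.+1) - V in
  only_zero (blocks (p * Q) (p * Q - U) (p * Q - U) (p * Q - U) (3 * (p * Q) - U))
    (Q * (4 * N + 3) + c0).
Proof.
move=> pQ pN VQ c0Q Z U; have Q0 : 0 < Q by case/andP: pQ.
have VQN : V <= Q * N.+1 by rewrite mulnS; lia.
have [[b pb]|[b pb]] := char_mod6 hp p2 p3.
  have bN : 6 * b = 8 * N + 6 by lia.
  apply: (@only_zero_intervals _ _ hp 0 Q (4 * N + 3) c0 _
    [:: ((0, 0), (b - N.+1, Q + V)); ((b, Q), (2 * b - N.+1, 2 * Q + V));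
             ((2 * b, 2 * Q), (3 * b - N.+1, 3 * Q + V));
             ((3 * b, 3 * Q), (p - N.+1, V))] _ pQ c0Q _ _ _ Z).
  - by rewrite /reduced /=; lia.
  - have QbN : 6 * (Q * b) = 8 * (Q * N) + 6 * Q by rewrite mulnCA bN; lia.
    rewrite /split_interval /= /U !mulnBr !pb.
    congr [:: (_, _); (_, _); (_, _); (_, _)]; lia.
  - clear VQN U; move=> r rQ; rewrite !big_cons big_nil /=.
    regions r [:: V; Q; Q + V; 2 * Q; 2 * Q + V; 3 * Q; 3 * Q + V].
have bN : 6 * b = 8 * N + 2 by lia.
apply: (@only_zero_intervals _ _ hp (3 * Q) Q (4 * N + 3) c0 _
    [:: ((0, 3 * Q), (b - N, 2 * Q + V)); ((b.+1, 2 * Q), (2 * b.+1 - N.+1, Q + V));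
           ((2 * b.+1, Q), (3 * b.+1 - N.+1, V));
           ((3 * b.+1, 0), (p - N.+1, 3 * Q + V))] _ pQ c0Q _ _ _ Z).
- by rewrite /reduced /=; lia.
- have QbN : 6 * (Q * b) = 8 * (Q * N) + 2 * Q by rewrite mulnCA bN; lia.
  rewrite /split_interval /= /U !mulnBr !pb.
  congr [:: (_, _); (_, _); (_, _); (_, _)]; lia.
- clear VQN U; move=> r rQ; rewrite !big_cons big_nil /=.
    regions r [:: V; Q; Q + V; 2 * Q; 2 * Q + V; 3 * Q; 3 * Q + V].
Qed.

End Vanishing.

(** * Multiples supported in a short window *)

Section Short.
Variable k : fieldType.
Local Notation sextic := (sextic k).

Lemma size_sextic : size sextic = 7%N.
Proof. by rewrite size_polyDl ?size_polyXn // size_poly1. Qed.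

Lemma sextic_neq0 : sextic != 0.
Proof. by rewrite -size_poly_gt0 size_sextic. Qed.

Lemma size_sextic_exp n : size (sextic ^+ n) = (6 * n).+1.
Proof.
by rewrite -[LHS]prednK ?size_poly_gt0 ?expf_neq0 ?sextic_neq0 // size_exp size_sextic.
Qed.

(** F is prime to X, so a power of X can be removed, and what remains has degree below that of
    F^n. *)
Lemma only_zero_short (a b n : nat) (S : pred nat) :
  (forall i, S i -> a <= i < b)%N -> (b - a <= 6 * n)%N -> @only_zero k S n.
Proof.
move=> Sab ba f Sf df; apply/eqP; apply: contraTT df => fn0.
pose g := \poly_(i < b - a) f`_(i + a).
have fE : f = g * 'X^a.
  apply/polyP => i; rewrite coefMXn coef_poly; case: ltnP => ia.
    by apply/eqP; apply: contraTT ia => /Sf/Sab /andP[]; rewrite -leqNgt.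
  rewrite subnK //; case: ltnP => // bi.
  apply/eqP; apply: contraTT bi => /Sf/Sab /andP[_]; lia.
have gn0 : g != 0 by apply: contraNneq fn0 => g0; rewrite fE g0 mul0r.
have co : coprimep (sextic ^+ n) 'X^a.
  rewrite coprimep_expl // coprimep_expr // -['X]subr0 -polyC0 coprimep_XsubC.
  by rewrite /root !hornerE expr0n /= add0r oner_eq0.
rewrite fE Gauss_dvdpl //; apply: contraL gn0 => /dvdp_leq dg; apply/negP => gn0.
have := leq_trans (dg gn0) (size_poly _ _); rewrite size_sextic_exp; lia.
Qed.

End Short.

(** * Thresholds for the classes of p modulo 8 *)

Section Vanishing.
Variables (k : fieldType) (p : nat).
Hypothesis hp : p \in [pchar k].
Hypotheses (p2 : p <> 2%N) (p3 : p <> 3%N).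
Local Notation only_zero := (@only_zero k).
Local Open Scope nat_scope.

(** What the dimension 4L loses when blocks of length L are cut down to lengths free of multiples of
    F^n; an upper bound for the dimension of the intersection. *)
Definition excess L0 L1 L2 L3 L := (L - L0) + (L - L1) + (L - L2) + (L - L3).

Lemma vanishing3 Q N c0 : p.-nat Q -> p = 8 * N + 3 -> 2 < Q -> Q = 2 * c0 + 1 ->
  let a := 6 * (Q * N) + (2 * Q - 3) in
  let b := 6 * (Q * N) + 3 * Q in
  exists L0 L1 L2 L3,
    only_zero (blocks (p * Q) L0 L1 L2 L3) (Q * (4 * N + 1) + c0) /\
    forall L, excess L0 L1 L2 L3 L = 3 * (L - a) + (L - b).
Proof.
move=> pQ pN Q2 Qc a b; have c0Q : c0 <= Q by lia.
pose B i := Q <= i < 4 * Q - 3.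
have Z : only_zero B c0 by apply: (@only_zero_short _ Q (4 * Q - 3)) => //; lia.
have [[t pt]|[t pt]] := char_mod6 hp p2 p3.
  have tN : 6 * t = 8 * N + 2 by lia.
  exists a, a, a, b; split; last by move=> L; rewrite /excess; lia.
  apply: (@only_zero_intervals _ _ hp 0 Q (4 * N + 1) c0 _
    [:: ((0, 0), (N, 2 * Q - 3)); ((t, Q), (t + N, 3 * Q - 3));
        ((2 * t, 2 * Q), (2 * t + N, 4 * Q - 3));
        ((3 * t, 3 * Q), (3 * t + N, 6 * Q))] _ pQ c0Q _ _ _ Z).
  - by rewrite /reduced /=; lia.
  - rewrite /split_interval /= /a /b !pt.
    congr [:: (_, _); (_, _); (_, _); (_, _)]; lia.
  - move=> r rQ; rewrite !big_cons big_nil /= /B.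
    regions r [:: Q; 2 * Q - 3; 2 * Q; 3 * Q - 3; 3 * Q; 4 * Q - 3].
have tN : 6 * t + 2 = 8 * N by lia.
exists b, a, a, a; split; last by move=> L; rewrite /excess; lia.
apply: (@only_zero_intervals _ _ hp (3 * Q) Q (4 * N + 1) c0 _
    [:: ((0, 3 * Q), (N, 6 * Q)); ((t.+1, 2 * Q), (t.+1 + N, 4 * Q - 3));
        ((2 * t.+1, Q), (2 * t.+1 + N, 3 * Q - 3));
        ((3 * t.+1, 0), (3 * t.+1 + N, 2 * Q - 3))] _ pQ c0Q _ _ _ Z).
- by rewrite /reduced /=; lia.
- rewrite /split_interval /= /a /b !pt.
  congr [:: (_, _); (_, _); (_, _); (_, _)]; lia.
- move=> r rQ; rewrite !big_cons big_nil /= /B.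
  regions r [:: Q; 2 * Q - 3; 2 * Q; 3 * Q - 3; 3 * Q; 4 * Q - 3].
Qed.

(** Here the stretches are [0, 3Q), [Q, 5Q-3), [2Q, 6Q-3) and, wrapping around, [3Q, 6Q) with [0,
    Q-3). A third covering occurs only inside [2Q, 5Q-3), again of length 6 c0. *)
Lemma vanishing5 Q N c0 : p.-nat Q -> p = 8 * N + 5 -> 2 < Q -> Q = 2 * c0 + 1 ->
  let a := 6 * (Q * N) + 3 * Q in
  let b := 6 * (Q * N) + (4 * Q - 3) in
  exists L0 L1 L2 L3,
    only_zero (blocks (p * Q) L0 L1 L2 L3) (Q * (4 * N + 2) + c0) /\
    forall L, excess L0 L1 L2 L3 L = (L - a) + 3 * (L - b).
Proof.
move=> pQ pN Q2 Qc a b; have c0Q : c0 <= Q by lia.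
pose B i := 2 * Q <= i < 5 * Q - 3.
have Z : only_zero B c0 by apply: (@only_zero_short _ (2 * Q) (5 * Q - 3)) => //; lia.
have [[t pt]|[t pt]] := char_mod6 hp p2 p3.
  have tN : 6 * t = 8 * N + 4 by lia.
  exists a, b, b, b; split; last by move=> L; rewrite /excess; lia.
  apply: (@only_zero_intervals _ _ hp 0 Q (4 * N + 2) c0 _
    [:: ((0, 0), (N, 3 * Q)); ((t, Q), (t + N, 5 * Q - 3));
        ((2 * t, 2 * Q), (2 * t + N, 6 * Q - 3));
        ((3 * t, 3 * Q), (3 * t + N.+1, Q - 3))] _ pQ c0Q _ _ _ Z).
  - by rewrite /reduced /=; lia.
  - rewrite /split_interval /= /a /b !pt.
    congr [:: (_, _); (_, _); (_, _); (_, _)]; lia.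
  - move=> r rQ; rewrite !big_cons big_nil /= /B.
    regions r [:: Q - 3; Q; 2 * Q; 3 * Q; 5 * Q - 3; 6 * Q - 3].
have tN : 6 * t = 8 * N by lia.
exists b, b, b, a; split; last by move=> L; rewrite /excess; lia.
apply: (@only_zero_intervals _ _ hp (3 * Q) Q (4 * N + 2) c0 _
    [:: ((0, 3 * Q), (N.+1, Q - 3)); ((t.+1, 2 * Q), (t.+1 + N, 6 * Q - 3));
        ((2 * t.+1, Q), (2 * t.+1 + N, 5 * Q - 3));
        ((3 * t.+1, 0), (3 * t.+1 + N, 3 * Q))] _ pQ c0Q _ _ _ Z).
- by rewrite /reduced /=; lia.
- rewrite /split_interval /= /a /b !pt.
  congr [:: (_, _); (_, _); (_, _); (_, _)]; lia.
- move=> r rQ; rewrite !big_cons big_nil /= /B.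
  regions r [:: Q - 3; Q; 2 * Q; 3 * Q; 5 * Q - 3; 6 * Q - 3].
Qed.

Lemma pnat_char_exp e : p.-nat (p ^ e).
Proof. by rewrite pnatX pnat_id ?orbT //; case/andP: hp. Qed.

Lemma odd_char_exp e : odd (p ^ e).
Proof.
have pp : prime p by case/andP: hp.
by rewrite oddX; case: (even_prime pp) => [/p2|->]; rewrite ?orbT.
Qed.

(** All base p digits of (p^e - 1)/2 equal (p - 1)/2, so each step of the recursion removes the
    leading digit of the exponent of F. *)
Lemma half_char_exp c e : p = 2 * c + 1 -> (p ^ e.+1)./2 = p ^ e * c + (p ^ e)./2.
Proof.
move=> pc; have := odd_double_half (p ^ e); rewrite odd_char_exp.
by rewrite expnS {1}pc; lia.
Qed.

Lemma vanishing1 e : p = 1 %[mod 8] ->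
  exists2 l, only_zero (blocks (p ^ e) l l l l) (p ^ e)./2 & 4 * l + 3 = 3 * p ^ e.
Proof.
move=> p8; have [N pN] : exists N, p = 8 * N + 1 by exists (p %/ 8); lia.
elim: e => [|e [l Z le]].
  exists 0; last by rewrite expn0.
  by move=> f Sf _; apply/polyP => i; rewrite coef0; apply/eqP/negPn/negP => /Sf;
     rewrite /blocks /intervals /=; lia.
exists (6 * (p ^ e * N) + l); last by rewrite expnS {2}pN; lia.
rewrite (@half_char_exp (4 * N)) ?expnS; last by lia.
apply: (blocks_step1 hp) => //; first exact: pnat_char_exp.
- by lia.
- by have := odd_double_half (p ^ e); lia.
Qed.

(** One passes from e to e + 2 through the configuration of gaps, so the induction carries two
    consecutive levels. The double step preserves 4l - 3 p^e, which is -3 for e even and -21 for e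
    odd; this explains the constants 21 and 18. *)
Lemma vanishing7 e : p = 7 %[mod 8] ->
  exists2 l, only_zero (blocks (p ^ e) l l l l) (p ^ e)./2 &
    3 * p ^ e <= 4 * l + 21 <= 3 * p ^ e + 18.
Proof.
move=> p8; have [N pN] : exists N, p = 8 * N + 7 by exists (p %/ 8); lia.
have hf e' : (p ^ e')./2 <= p ^ e' by have := odd_double_half (p ^ e'); lia.
(* At Q = 1 a block of length 6N covers every residue modulo 6 exactly N times, so no residue is
   covered more than 4N + 3 times. *)
have base : only_zero (blocks p (6 * N) (6 * N) (6 * N) (6 * N)) (1 * (4 * N + 3) + 1./2).
  have Z : only_zero pred0 0.
    by move=> f Sf _; apply/polyP => i; rewrite coef0; apply/eqP/negPn/negP => /Sf.
  have [[b pb]|[b pb]] := char_mod6 hp p2 p3.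
    apply: (@only_zero_intervals _ _ hp 0 1 (4 * N + 3) 0 _
      [:: ((0, 0), (N, 0)); ((b, 1), (b + N, 1)); ((2 * b, 2), (2 * b + N, 2));
          ((3 * b, 3), (3 * b + N, 3))] pred0 _ _ _ _ _ Z) => //.
    - by rewrite /reduced /=; lia.
    - by rewrite /split_interval /= !pb; congr [:: (_, _); (_, _); (_, _); (_, _)]; lia.
    - by move=> r _; rewrite !big_cons big_nil /=; lia.
  apply: (@only_zero_intervals _ _ hp 3 1 (4 * N + 3) 0 _
      [:: ((0, 3), (N, 3)); ((b.+1, 2), (b.+1 + N, 2)); ((2 * b.+1, 1), (2 * b.+1 + N, 1));
          ((3 * b.+1, 0), (3 * b.+1 + N, 0))] pred0 _ _ _ _ _ Z) => //.
  - by rewrite /reduced /=; lia.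
  - by rewrite /split_interval /= !pb; congr [:: (_, _); (_, _); (_, _); (_, _)]; lia.
  - by move=> r _; rewrite !big_cons big_nil /=; lia.
suff [[l Z le] _] : (exists2 l, only_zero (blocks (p ^ e) l l l l) (p ^ e)./2
      & 3 * p ^ e <= 4 * l + 21 <= 3 * p ^ e + 18) /\
    (exists2 l, only_zero (blocks (p ^ e.+1) l l l l) (p ^ e.+1)./2
      & 3 * p ^ e.+1 <= 4 * l + 21 <= 3 * p ^ e.+1 + 18).
  by exists l.
elim: e => [|e [[V Z le] He1]]; split => //.
- exists 0; last by rewrite expn0.
  by move=> f Sf _; apply/polyP => i; rewrite coef0; apply/eqP/negPn/negP => /Sf;
     rewrite /blocks /intervals /=; lia.
- exists (6 * N); last by rewrite expn1; lia.
  by rewrite (@half_char_exp (4 * N + 3)) ?expn0 ?expn1; [exact: base | lia].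
- have Vp : V <= p ^ e by lia.
  exists (6 * (p ^ e.+1 * N) + (6 * p ^ e.+1 - (6 * (p ^ e * N.+1) - V))).
    rewrite (@half_char_exp (4 * N + 3)) ?[p ^ e.+2]expnS; last by lia.
    apply: (blocks_step7a hp) => //; [exact: pnat_char_exp| |].
    + by rewrite expnS {2}pN; lia.
    + rewrite (@half_char_exp (4 * N + 3)) ?[p ^ e.+1]expnS; last by lia.
      apply: (blocks_step7b hp) => //; exact: pnat_char_exp.
  have pe1 : p ^ e.+1 = 8 * (p ^ e * N) + 7 * p ^ e by rewrite expnS {1}pN; lia.
  have pe2 : p ^ e.+2 = 8 * (p ^ e.+1 * N) + 7 * p ^ e.+1 by rewrite expnS {1}pN; lia.
  lia.
Qed.

End Vanishing.

(** * Dimension counts in spaces of forms *)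

Section Spaces.
Variables (k : fieldType) (m : nat).
Local Notation V := {poly_m k}.
Local Notation only_zero := (@only_zero k).

Definition truncate_to (S : pred nat) (f : V) : V :=
  npolyp m (\poly_(i < m) (if S i then f`_i else 0)).

Lemma coef_truncate_to S f i : (truncate_to S f)`_i = if S i then f`_i else 0.
Proof.
rewrite coef_npolyp coef_poly; case: ltnP => // mi.
by rewrite big_coef_npoly // if_same.
Qed.

Lemma truncate_to_linear S : linear (truncate_to S).
Proof.
move=> a u v; apply/npolyP => i; rewrite coef_truncate_to /= !coefD !coefZ.
by rewrite -/(truncate_to S) !coef_truncate_to; case: ifP; rewrite ?mulr0 ?addr0.
Qed.
HB.instance Definition _ S :=
  GRing.isLinear.Build k V V _ (truncate_to S) (truncate_to_linear S).

Definition coordspace (S : pred nat) : {vspace V} :=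
  lker (linfun (truncate_to (predC S))).

Lemma coordspaceP S (f : V) : reflect (supported S f) (f \in coordspace S).
Proof.
rewrite memv_ker lfunE; apply: (iffP eqP) => [f0 i|Sf].
  apply: contraR => nSi; have := coef_truncate_to (predC S) f i.
  by rewrite f0 coef0 /= nSi => <-.
apply/npolyP => i; rewrite coef_truncate_to coef0 /=; case: ifP => // nSi.
by apply/eqP; apply: contraNT nSi => /Sf.
Qed.

(** Monomials bound the dimension from above, for S and for its complement. The two spaces together
    span everything, so both bounds are attained. *)
Lemma dim_coordspace S : \dim (coordspace S) = count S (iota 0 m).
Proof.
have le T : (\dim (coordspace T) <= count T (iota 0 m))%N.
  pose X : seq V := [seq npolyp m 'X^i | i <- iota 0 m & T i].
  suff sub : (coordspace T <= <<X>>)%VS.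
    by apply: leq_trans (dimvS sub) (leq_trans (dim_span _) _);
       rewrite size_map size_filter.
  apply/subvP => f /coordspaceP Tf.
  have -> : f = \sum_(i <- iota 0 m | T i) f`_i *: npolyp m 'X^i.
    apply/npolyP => j; rewrite (@big_morph _ _ _ 0%R +%R) // coef_sum.
    case: (ltnP j m) => jm; last first.
      rewrite big_coef_npoly // big1_seq // => i /andP[_].
      by rewrite mem_iota => im; rewrite coefZ coef_npolyp ltnNge jm mulr0.
    have [Tj|nTj] := boolP (T j); last first.
      rewrite big1 => [|i Ti].
        by apply/eqP; apply: contraR nTj => /Tf.
      rewrite coefZ coef_npolyp jm coefXn (_ : (j == i) = false) ?mulr0 //.
      by apply: contraNF nTj => /eqP ->.
    rewrite -big_filter (bigD1_seq j) ?filter_uniq ?iota_uniq ?mem_filter ?Tj ?mem_iota //= big1 => [|i ij].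
      by rewrite coefZ coef_npolyp jm coefXn eqxx mulr1 addr0.
    by rewrite coefZ coef_npolyp jm coefXn eq_sym (negPf ij) mulr0.
  rewrite big_seq_cond; apply: memv_suml => i /andP[im Ti]; apply: memvZ.
  by apply: memv_span; apply/mapP; exists i; rewrite // mem_filter Ti.
have full : (coordspace S + coordspace (predC S) = fullv)%VS.
  apply/eqP; rewrite eqEsubv subvf; apply/subvP => f _.
  have -> : f = truncate_to S f + truncate_to (predC S) f.
    apply/npolyP => i; rewrite coefD !coef_truncate_to /=.
    by case: (S i); rewrite ?addr0 ?add0r.
  by apply: memv_add; apply/coordspaceP => i; rewrite coef_truncate_to; case: ifP; rewrite ?eqxx.
have := dimv_sum_cap (coordspace S) (coordspace (predC S)).
rewrite full dimvf /dim /=; have := count_predC S (iota 0 m); rewrite size_iota.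
have := le S; have := le (predC S); lia.
Qed.

(** The truncation only serves to make this a map between fixed spaces: in [mulspace] the factor g
    has size at most m - deg P and nothing is cut off. *)
Definition multiply (P : {poly k}) n (g : {poly_n k}) : V := npolyp m (P * g).

Lemma multiply_linear P n : linear (@multiply P n).
Proof.
move=> a u v; apply/npolyP => i; rewrite /= coefD coefZ !coef_npolyp /=.
by case: ltnP => _; rewrite ?mulr0 ?addr0 // mulrDr -scalerAr coefD coefZ.
Qed.
HB.instance Definition _ P n :=
  GRing.isLinear.Build k {poly_n k} V _ (@multiply P n) (@multiply_linear P n).

Definition mulspace (P : {poly k}) : {vspace V} :=
  (linfun (@multiply P (m - (size P).-1)) @: fullv)%VS.

Lemma size_multiply (P g : {poly k}) :
  (size g <= m - (size P).-1)%N -> (size (P * g)%R <= m)%N.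
Proof.
move=> sg; have [->|P0] := eqVneq P 0; first by rewrite mul0r size_poly0.
have [g0|g0] := eqVneq g 0; first by rewrite g0 mulr0 size_poly0.
rewrite size_mul //; move: sg P0 g0; rewrite -!size_poly_gt0.
by move: (size P) (size g) => a b; lia.
Qed.

Lemma mulspaceP (P : {poly k}) (f : V) : reflect (P %| f) (f \in mulspace P).
Proof.
apply: (iffP memv_imgP) => [[g _ ->]|].
  by rewrite lfunE /= npolypK ?size_multiply // dvdp_mulr.
case/dvdpP => h fE; have [f0|fn0] := eqVneq (polyn f) 0.
  by exists 0; rewrite ?memvf // linear0; apply/npolyP => i; rewrite f0 coef0.
have [hn0 Pn0] : h != 0 /\ P != 0.
  by apply/andP; rewrite -negb_or -mulf_eq0 -fE.
have sh : (size h <= m - (size P).-1)%N.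
  have := size_npoly f; rewrite fE size_mul //.
  by move: hn0 Pn0; rewrite -!size_poly_gt0; move: (size P) (size h) => a b; lia.
exists (npolyp _ h); rewrite ?memvf // lfunE; apply/npolyP => i.
by rewrite /= npolypK ?npolypK // mulrC -fE.
Qed.

Lemma lker_multiply P : P != 0 ->
  lker (linfun (@multiply P (m - (size P).-1))) = 0%VS.
Proof.
move=> P0; apply/eqP; rewrite -subv0; apply/subvP => g; rewrite memv_ker lfunE.
move=> /eqP/npolyP e; rewrite memv0; apply/eqP/npolyP => i.
have : P * g = 0.
  apply/polyP => j; have := e j.
  by rewrite /= npolypK ?size_multiply // coef0.
by move/eqP; rewrite mulf_eq0 (negPf P0) => /eqP ->; rewrite coef0.
Qed.

Lemma dim_mulspace P : P != 0 -> \dim (mulspace P) = (m - (size P).-1)%N.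
Proof. by move=> P0; rewrite limg_dim_eq ?lker_multiply ?capv0 // dimvf /dim. Qed.

Lemma dim_capv_ge (U W T : {vspace V}) : (U <= T)%VS -> (W <= T)%VS ->
  (\dim U + \dim W <= \dim (U :&: W) + \dim T)%N.
Proof.
move=> UT WT; rewrite -dimv_sum_cap addnC leq_add2l.
by apply: dimvS; rewrite subv_add UT WT.
Qed.

Lemma capv_coord_mul_eq0 S n : only_zero S n ->
  (coordspace S :&: mulspace (sextic k ^+ n) = 0)%VS.
Proof.
move=> Z; apply/eqP; rewrite -subv0; apply/subvP => f.
case/memv_capP => /coordspaceP Sf /mulspaceP df; rewrite memv0.
by apply/eqP/npolyP => i; rewrite (Z _ Sf df) coef0.
Qed.

Lemma dim_mul_sextic n : \dim (mulspace (sextic k ^+ n)) = (m - 6 * n)%N.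
Proof. by rewrite dim_mulspace ?expf_neq0 ?sextic_neq0 // size_sextic_exp. Qed.

(** An element of [{poly_m k}] stands for a form of degree m - 1 in X and Y, dehomogenized at Y =
    1. *)
Definition codimension (S : pred nat) n :=
  (m - \dim (coordspace S + mulspace (sextic k ^+ n))%VS)%N.

(** Removing exponents from S until the sum becomes direct can only shrink it, and the dimension of
    a direct sum is known. *)
Lemma codimension_le (S S' : pred nat) n :
  (forall i, S' i -> S i) -> only_zero S' n ->
  (codimension S n + count S' (iota 0 m) + (m - 6 * n) <= m)%N.
Proof.
move=> SS' /capv_coord_mul_eq0 Z.
have := dimv_sum_cap (coordspace S') (mulspace (sextic k ^+ n)).
rewrite Z dimv0 addn0 dim_coordspace dim_mul_sextic -addnA => <-.
have le : (coordspace S' + mulspace (sextic k ^+ n) <=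
           coordspace S + mulspace (sextic k ^+ n))%VS.
  apply: addvS => //; apply/subvP => f /coordspaceP Sf.
  by apply/coordspaceP => i /Sf /SS'.
have := dimvS le; have := dimvS (subvf (coordspace S + mulspace (sextic k ^+ n))).
by rewrite /codimension dimvf /dim /=; lia.
Qed.

Lemma codimension_ge (S : pred nat) n d :
  (d <= \dim (coordspace S :&: mulspace (sextic k ^+ n)))%N ->
  (m + d <= codimension S n + count S (iota 0 m) + (m - 6 * n))%N.
Proof.
have := dimv_sum_cap (coordspace S) (mulspace (sextic k ^+ n)).
rewrite dim_coordspace dim_mul_sextic /codimension; lia.
Qed.

End Spaces.

(** * Existence of sparse multiples *)

Section Lower.
Variables (k : fieldType) (p m : nat).
Hypothesis hp : p \in [pchar k].

Lemma count_periodic (R : pred nat) M a :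
  (forall i, R (i + M)%N = R i) -> count R (iota a M) = count R (iota 0 M).
Proof.
move=> RM; elim: a => // a <-; case: M RM => // M RM.
rewrite [RHS]/= -(RM a) addnC -addSnnS -[M.+1 in LHS]addn1 iotaD count_cat /= addn0.
by rewrite addSnnS.
Qed.

Lemma count_periodicM (R : pred nat) M c a :
  (forall i, R (i + M)%N = R i) ->
  count R (iota a (M * c)) = (c * count R (iota 0 M))%N.
Proof.
move=> RM; elim: c a => [|c IHc] a; first by rewrite muln0.
by rewrite mulnS iotaD count_cat IHc count_periodic.
Qed.

(* The forms supported in S whose exponents have residues in R satisfy only
   c1 conditions per residue class and 6 c0 more. *)
Lemma dim_capv_periodic (Q c1 c0 n : nat) (S R : pred nat) :
  p.-nat Q -> (n <= Q * c1 + c0)%N -> (forall i, R (i + 6 * Q)%N = R i) ->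
  (count (predI S R) (iota 0 m) <=
   \dim (coordspace k m S :&: mulspace m (sextic k ^+ n)) +
     c1 * count R (iota 0 (6 * Q)) + 6 * c0)%N.
Proof.
move=> pQ nQ; set M := (6 * Q)%N => RM.
have M0 : (0 < M)%N by case/andP: pQ; lia.
pose P1 : {poly k} := ('X^M + 1) ^+ c1.
have XM : size ('X^M + 1 : {poly k}) = M.+1.
  by rewrite size_polyDl ?size_polyXn // size_poly1.
have P1E : P1 = sextic k ^+ (Q * c1) by rewrite /P1 /M -(sextic_Frobenius hp) ?exprM.
have sP1 : (size P1).-1 = (M * c1)%N by rewrite P1E size_sextic_exp /M; lia.
have P1n0 : P1 != 0 by rewrite P1E expf_neq0 ?sextic_neq0.
pose A : {vspace {poly_m k}} :=
  (linfun (@multiply k m P1 (m - (size P1).-1)) @: coordspace k _ R)%VS.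
have dA : \dim A = count R (iota 0 (m - M * c1)).
  by rewrite limg_dim_eq ?lker_multiply ?capv0 // dim_coordspace sP1.
have mulR (g : {poly k}) c : supported R g -> supported R (('X^M + 1) ^+ c * g).
  move=> Rg; elim: c => [|c IHc] i; first by rewrite mul1r; apply: Rg.
  rewrite exprS -mulrA mulrDl mul1r coefD coefXnM.
  case: ltnP => iM; first by rewrite add0r; apply: IHc.
  have [-> |n0 _] := eqVneq (('X^M + 1) ^+ c * g)`_(i - M) 0.
    by rewrite add0r; apply: IHc.
  by rewrite -(subnK iM) RM; apply: IHc.
have AR : (A <= coordspace k m R)%VS.
  apply/subvP => _ /memv_imgP[g /coordspaceP Rg ->]; apply/coordspaceP.
  by rewrite lfunE /= npolypK ?size_multiply //; apply: mulR.
have AP : (A <= mulspace m P1)%VS by apply: limgS; apply: subvf.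
have SR : (coordspace k m (predI S R) <= coordspace k m R)%VS.
  by apply/subvP => f /coordspaceP Sf; apply/coordspaceP => i /Sf /andP[].
pose B := mulspace m (sextic k ^+ (Q * c1 + c0)).
have BP : (B <= mulspace m P1)%VS.
  apply/subvP => f /mulspaceP df; apply/mulspaceP; apply: dvdp_trans df.
  by rewrite P1E dvdp_exp2l ?leq_addr.
(* Among the forms supported on R, the space A has codimension at most [c1 * count R (iota 0 M)];
   among the multiples of [P1], the space B has codimension at most [6 * c0]. Intersecting twice
   adds the two costs. *)
have h1 := dim_capv_ge AR SR.
have h2 := dim_capv_ge (subv_trans (capvSl _ (coordspace k m (predI S R))) AP) BP.
have sub : (A :&: coordspace k m (predI S R) :&: B <=
            coordspace k m S :&: mulspace m (sextic k ^+ n))%VS.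
  apply/subvP => f; rewrite !memv_cap => /andP[/andP[_ /coordspaceP Sf] /mulspaceP df].
  apply/andP; split; first by apply/coordspaceP => i /Sf /andP[].
  by apply/mulspaceP; apply: dvdp_trans df; rewrite dvdp_exp2l.
have := dimvS sub; move: h1 h2.
rewrite dA !dim_coordspace dim_mulspace // sP1 /B dim_mul_sextic.
have : (count R (iota 0 m) <= count R (iota 0 (m - M * c1)) + c1 * count R (iota 0 M))%N.
  rewrite -(@count_periodicM R M c1 (m - M * c1) RM).
  have [mM|Mm] := leqP m (M * c1).
    have e : (M * c1 = m + (M * c1 - m))%N by rewrite subnKC.
    by rewrite (eqP mM) e iotaD count_cat /=; lia.
  by rewrite -[in X in (X <= _)%N](subnK (ltnW Mm)) iotaD count_cat.
rewrite /M; lia.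
Qed.

End Lower.

(** * Counting residues in intervals *)

Section Counting.
Local Open Scope nat_scope.

Fixpoint ordered_from x (s : seq (nat * nat)) :=
  if s is ab :: s' then [&& x <= ab.1, ab.1 <= ab.2 & ordered_from ab.2 s'] else true.

Lemma count_intervals_ge (P : pred nat) m s x :
  ordered_from x s -> all (fun ab => ab.2 <= m) s ->
  \sum_(ab <- s) count P (iota ab.1 (ab.2 - ab.1)) <=
    count (predI (intervals s) P) (iota x (m - x)).
Proof.
elim: s x => [|[a b] s IHs] x /=; first by rewrite big_nil.
case/and3P=> xa ab os /andP[bm sm]; rewrite big_cons /=.
rewrite (_ : m - x = (a - x) + ((b - a) + (m - b))); last by lia.
rewrite !iotaD !count_cat subnKC // subnKC //.
apply: leq_trans (leq_addl _ _); apply: leq_add.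
  rewrite (eq_in_count (a2 := predI (intervals ((a, b) :: s)) P)) // => i.
  by rewrite mem_iota subnKC // /intervals /= => ->.
apply: leq_trans (IHs b os sm) _; apply: sub_count => i /=.
by rewrite /intervals /= => /andP[-> ->]; rewrite orbT.
Qed.

Lemma count_interval_le a b m : count (fun i => a <= i < b) (iota 0 m) <= b - a.
Proof.
rewrite -size_filter -(size_iota a (b - a)); apply: uniq_leq_size.
  by rewrite filter_uniq ?iota_uniq.
by move=> i; rewrite mem_filter !mem_iota; lia.
Qed.

Lemma count_intervals_le m s :
  count (intervals s) (iota 0 m) <= \sum_(ab <- s) (ab.2 - ab.1).
Proof.
elim: s => [|ab s IHs]; first by rewrite big_nil /intervals /= count_pred0.
rewrite big_cons; apply: leq_trans (leq_add (count_interval_le ab.1 ab.2 m) IHs).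
by rewrite -count_predUI leq_addr.
Qed.

Definition residues M d R0 R1 : pred nat := fun i => R0 <= (i + d) %% M < R1.

Lemma residues_periodic M d R0 R1 i : residues M d R0 R1 (i + M) = residues M d R0 R1 i.
Proof. by rewrite /residues addnAC modnDr. Qed.

Lemma count_residues M d R0 R1 : R0 <= R1 <= M ->
  count (residues M d R0 R1) (iota 0 M) = R1 - R0.
Proof.
move=> /andP[R01 R1M].
rewrite (_ : count _ _ = count (residues M 0 R0 R1) (iota d M)); last first.
  rewrite -[in RHS](addn0 d) iotaDl count_map; apply: eq_count => i.
  by rewrite /residues /= addn0 addnC.
rewrite count_periodic; last exact: residues_periodic.
apply/eqP; rewrite eqn_leq; apply/andP; split.
  apply: leq_trans (count_interval_le R0 R1 M); rewrite leq_eqVlt; apply/orP; left.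
  apply/eqP/eq_in_count => i; rewrite mem_iota /residues addn0 => iM.
  by rewrite modn_small.
have := @count_intervals_ge (residues M 0 R0 R1) M [:: (R0, R1)] 0.
rewrite subn0 /= R01 R1M big_cons big_nil addn0 => /(_ isT isT).
rewrite (eq_in_count (a2 := predT)) ?count_predT ?size_iota => [le|i].
  by apply: leq_trans le _; apply: sub_count => i /= /andP[].
rewrite mem_iota subnKC // /residues addn0 => /andP[Ri iR].
by rewrite modn_small ?Ri ?iR // (leq_trans iR).
Qed.

(** The interval contains N full periods, each meeting the residues R1 - R0 times, followed by a
    stretch whose residues run through [c, c + l) without wrapping around. *)
Lemma count_residues_interval M d R0 R1 a L t c N l :
  R0 <= R1 <= M -> a + d = M * t + c -> M * N + l <= L -> c + l <= M ->
  N * (R1 - R0) + (minn R1 (c + l) - maxn R0 c) <=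
    count (residues M d R0 R1) (iota a L).
Proof.
move=> R01 ad lL clM.
rewrite -(subnKC lL) iotaD count_cat; apply: leq_trans (leq_addr _ _).
rewrite iotaD count_cat.
rewrite count_periodicM; last exact: residues_periodic.
rewrite count_residues // leq_add2l.
set x := maxn R0 c; set y := minn R1 (c + l).
(* In the last stretch the residue i is attained at the exponent a + M N + (i - c). *)
rewrite -(size_iota x (y - x)) -(size_map (fun i => a + M * N + (i - c))) -size_filter.
apply: uniq_leq_size.
  rewrite map_inj_in_uniq ?iota_uniq // => i j; rewrite !mem_iota; lia.
move=> _ /mapP[i ix ->]; rewrite mem_filter mem_iota; rewrite mem_iota in ix.
rewrite /residues (_ : _ + d = (t + N) * M + i); last by lia.
by rewrite modnMDl modn_small; lia.
Qed.

End Counting.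

(** * Two-sided bounds for the codimension *)

Section Estimates.
Variables (k : fieldType) (p : nat).
Local Notation only_zero := (@only_zero k).
Local Open Scope nat_scope.

(* The exponents i < m such that X^i Y^(m-1-i) lies in (X^q, Y^q)^3. *)
Definition cube_exponents q m : pred nat :=
  blocks q (m - 3 * q) (m - 3 * q) (m - 3 * q) (m - 3 * q).

Lemma sub_blocks q L0 L1 L2 L3 L0' L1' L2' L3' i :
  L0 <= L0' -> L1 <= L1' -> L2 <= L2' -> L3 <= L3' ->
  blocks q L0 L1 L2 L3 i -> blocks q L0' L1' L2' L3' i.
Proof.
move=> l0 l1 l2 l3; rewrite /blocks /intervals /= !orbF.
case/or4P => [h|/andP[h h']|/andP[h h']|/andP[h h']]; apply/or4P.
- by apply: Or41; apply: leq_trans h l0.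
- by apply: Or42; rewrite h (leq_trans h') ?leq_add2l.
- by apply: Or43; rewrite h (leq_trans h') ?leq_add2l.
- by apply: Or44; rewrite h (leq_trans h') ?leq_add2l.
Qed.

(** Cutting each interval of length L to [minn L L_i] makes the sum direct. The error 3 is due to
    6n, which lies between 3q - 3 and 3q + 3. *)
Lemma codimension_upper q n0 n m L0 L1 L2 L3 :
  q = 2 * n0 + 1 -> n0 <= n <= n0.+1 -> m <= 4 * q ->
  only_zero (blocks q L0 L1 L2 L3) n0 ->
  codimension k m (cube_exponents q m) n + 5 * (m - 3 * q) <=
    m + excess L0 L1 L2 L3 (m - 3 * q) + 3.
Proof.
move=> qE /andP[n0n nn0] m4 Z; set L := m - 3 * q.
have Lq : L <= q by rewrite /L; lia.
pose S' := blocks q (minn L L0) (minn L L1) (minn L L2) (minn L L3).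
have Z' : only_zero S' n.
  by apply: only_zero_mono Z => // i; apply: sub_blocks; apply: geq_minr.
have SS i : S' i -> cube_exponents q m i.
  by apply: sub_blocks; apply: geq_minl.
have mS : L = 0 \/ m = 3 * q + L by rewrite /L; lia.
have := codimension_le m SS Z'; rewrite /excess.
case: mS => mL; first by rewrite mL muln0; lia.
have := @count_intervals_ge predT m
  [:: (0, minn L L0); (q, q + minn L L1); (2 * q, 2 * q + minn L L2);
      (3 * q, 3 * q + minn L L3)] 0.
rewrite (eq_count (a2 := S')); last by move=> i; rewrite /= andbT.
rewrite !big_cons big_nil /= !count_predT !size_iota !subn0 !addKn !minnE.
have := leq_subr L0 L; have := leq_subr L1 L; have := leq_subr L2 L; have := leq_subr L3 L.
move: (L - L0) (L - L1) (L - L2) (L - L3) (count S' _) => e0 e1 e2 e3 c l3 l2 l1 l0.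
move=> h; have {h} := h ltac:(clear - l0 l1 l2 l3 Lq; lia)
  ltac:(clear - l0 l1 l2 l3 Lq mL; lia).
move: (codimension _ _ _ _) => h; clear - l0 l1 l2 l3 n0n nn0 qE mL; lia.
Qed.

Lemma codimension_lower q n0 n m d :
  q = 2 * n0 + 1 -> n0 <= n <= n0.+1 ->
  d <= \dim (coordspace k m (cube_exponents q m) :&: mulspace m (sextic k ^+ n)) ->
  m + d <= codimension k m (cube_exponents q m) n + 5 * (m - 3 * q) + 3.
Proof.
move=> qE nn /codimension_ge.
have : count (cube_exponents q m) (iota 0 m) <= 4 * (m - 3 * q).
  apply: leq_trans (count_intervals_le _ _) _.
  by rewrite !big_cons big_nil /= !addKn; lia.
lia.
Qed.

(** Intervals of length at least q spaced by q leave no hole: all monomials of degree at least 4q -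
    1 lie in (X^q, Y^q)^3. *)
Lemma codimension_large q n m : 4 * q <= m -> 0 < q ->
  codimension k m (cube_exponents q m) n = 0.
Proof.
move=> qm q0; apply/eqP; rewrite -leqn0 /codimension leqn0 subn_eq0.
rewrite -{1}(_ : \dim (coordspace k m (cube_exponents q m)) = m).
  by apply: dimvS; apply: addvSl.
rewrite dim_coordspace (eq_in_count (a2 := predT)) ?count_predT ?size_iota // => i.
by rewrite mem_iota /cube_exponents /blocks /intervals /=; lia.
Qed.

Hypothesis hp : p \in [pchar k].
Hypotheses (p2 : p <> 2%N) (p3 : p <> 3%N).

(* The size of [R0, R1) /\ [c Q, min(c Q + l, 6 Q)). *)
Definition overlap Q l R0 R1 c :=
  minn R1 (c * Q + minn l (6 * Q - c * Q)) - maxn R0 (c * Q).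

(** Every block consists of N full periods and a stretch of length l, so a set of residues that the
    stretches cover well contributes more exponents than the conditions imposed by
    [dim_capv_periodic]. *)
Lemma dim_capv_residues Q N l c1 c0 n m R0 R1 :
  p.-nat Q -> R0 <= R1 <= 6 * Q -> 3 * (p * Q) <= m <= 4 * (p * Q) ->
  m - 3 * (p * Q) = 6 * Q * N + l -> n <= Q * c1 + c0 ->
  4 * (N * (R1 - R0)) + (overlap Q l R0 R1 0 + overlap Q l R0 R1 1 +
    overlap Q l R0 R1 2 + overlap Q l R0 R1 3) <=
    \dim (coordspace k m (cube_exponents (p * Q) m) :&: mulspace m (sextic k ^+ n)) +
      c1 * (R1 - R0) + 6 * c0.
Proof.
move=> pQ R01; set q := p * Q; set L := m - 3 * q => qm LE nQ; set f := overlap Q l R0 R1.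
have Q0 : 0 < Q by case/andP: pQ.
have Lq : L <= q by rewrite /L; lia.
(* The offset d is 0 or 3Q according to p modulo 6; block j then starts at the residue j Q or (3 -
   j) Q. *)
have main d : (forall j, j < 4 -> exists t, exists2 c, j * q + d = 6 * Q * t + c * Q &
      c = (if d == 0 then j else 3 - j)) ->
    4 * (N * (R1 - R0)) + (f 0 + f 1 + f 2 + f 3) <=
    count (predI (cube_exponents q m) (residues (6 * Q) d R0 R1)) (iota 0 m).
  move=> jd; have := @count_intervals_ge (residues (6 * Q) d R0 R1) m
    [:: (0, L); (q, q + L); (2 * q, 2 * q + L); (3 * q, 3 * q + L)] 0.
  rewrite !big_cons big_nil /= !subn0 !addKn => h.
  have {}h := h ltac:(lia) ltac:(rewrite /L; lia).
  have cj j : j < 4 -> N * (R1 - R0) + f (if d == 0 then j else 3 - j) <=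
      count (residues (6 * Q) d R0 R1) (iota (j * q) L).
    move=> j4; have [t [c e cE]] := jd j j4; rewrite -cE /f /overlap.
    have c4 : c * Q <= 6 * Q by rewrite leq_mul2r cE; apply/orP; right; case: (d == 0); lia.
    by apply: (count_residues_interval R01 e); rewrite ?LE ?leq_add2l ?geq_minl //; lia.
  apply: leq_trans h.
  have := cj 0 isT; have := cj 1 isT; have := cj 2 isT; have := cj 3 isT.
  rewrite mul0n mul1n; case: (d == 0); first lia.
  by rewrite subn0 subnn -[3 - 1]/2 -[3 - 2]/1; lia.
have per d := dim_capv_periodic m hp (cube_exponents q m) pQ nQ
  (residues_periodic (6 * Q) d R0 R1).
have [[b pb]|[b pb]] := char_mod6 hp p2 p3.
  have := per 0; rewrite count_residues // => h; apply: leq_trans h; apply: main => j _.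
  by exists (j * b), j => //; rewrite /q pb; lia.
have := per (3 * Q); rewrite count_residues // => h; apply: leq_trans h; apply: main => j j4.
exists (j * b.+1), (3 - j); last by rewrite muln_eq0 /= gtn_eqF.
by rewrite /q pb; move: j j4 => [|[|[|[|]]]] //; lia.
Qed.

End Estimates.

Section Estimates.
Variables (k : fieldType) (p : nat).
Hypothesis hp : p \in [pchar k].
Hypotheses (p2 : p <> 2%N) (p3 : p <> 3%N).
Local Open Scope nat_scope.
Local Notation only_zero := (@only_zero k).

(** As 4L + (m - 6n) equals 5L up to a constant when m >= 3q, this says that the intersection has
    dimension E(L) up to a bounded error. *)
Definition codimension_estimate q (E : nat -> nat) C := forall n m,
  q./2 <= n <= q./2.+1 -> m <= 4 * q ->
  let h := codimension k m (cube_exponents q m) n in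
  let L := m - 3 * q in
  h + 5 * L <= m + E L + C /\ m + E L <= h + 5 * L + C.

(** Sparse multiples need not be constructed. Up to the threshold the lower bound is the trivial
    dimension count; beyond it, m + 4 (L - l) - 5L = 3q - 4l is at most 21, and h >= 0 suffices. *)
Lemma estimate17 e : p = 1 %[mod 8] \/ p = 7 %[mod 8] ->
  exists l, 3 * p ^ e <= 4 * l + 21 <= 3 * p ^ e + 18 /\
    codimension_estimate (p ^ e) (fun L => 4 * (L - l)) 24.
Proof.
move=> p8; set q := p ^ e.
have [l Z le] : exists2 l, only_zero (blocks q l l l l) q./2 &
    3 * q <= 4 * l + 21 <= 3 * q + 18.
  case: p8 => p8; last exact: vanishing7.
  by have [l Z le] := vanishing1 hp p2 p3 e p8; exists l; rewrite // -/q in le *; lia.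
exists l; split=> // n m nq mq h L.
have qE : q = 2 * q./2 + 1.
  by have := odd_double_half q; rewrite (odd_char_exp hp p2); lia.
have up := codimension_upper qE nq mq Z.
have lo := codimension_lower qE nq (leq0n (\dim (coordspace k m (cube_exponents q m) :&:
  mulspace m (sextic k ^+ n)))).
by move: up lo; rewrite /excess -/h -/L; move: h; rewrite /L; clear -mq le; lia.
Qed.

Lemma estimate3 e : p = 3 %[mod 8] -> 0 < e ->
  let Q := p ^ e in
  codimension_estimate (p * Q)
    (fun L => 3 * (L - (6 * (Q * (p %/ 8)) + (2 * Q - 3))) +
              (L - (6 * (Q * (p %/ 8)) + 3 * Q))) 24.
Proof.
move=> p8 e0 Q; set N := p %/ 8; have pN : p = 8 * N + 3 by rewrite /N; lia.
have Q2 : 2 < Q by have := @leq_pexp2l p 1 e ltac:(lia) e0; rewrite expn1 -/Q; lia.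
have pQ : p.-nat Q by exact: (pnat_char_exp hp).
have QE : Q = 2 * Q./2 + 1.
  by have := odd_double_half Q; rewrite (odd_char_exp hp p2); lia.
have [L0 [L1 [L2 [L3 [Z ex]]]]] := vanishing3 hp p2 p3 pQ pN Q2 QE.
have qh : (p * Q)./2 = Q * (4 * N + 1) + Q./2.
  by rewrite -[p * Q]expnS (@half_char_exp k p hp p2 p3 (4 * N + 1)) //; lia.
have qE : p * Q = 2 * (p * Q)./2 + 1 by rewrite qh {1}pN; lia.
move=> n m nq mq h L.
have Z' : only_zero (blocks (p * Q) L0 L1 L2 L3) (p * Q)./2 by rewrite qh.
have up := codimension_upper qE nq mq Z'.
split; first by rewrite ex in up; move: up; rewrite -/h -/L; clear; lia.
have lo d := @codimension_lower k (p * Q) (p * Q)./2 n m d qE nq.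
have pQE : p * Q = 8 * (Q * N) + 3 * Q by rewrite {1}pN; lia.
(* Near and below the first threshold the trivial count is enough, and above the second one h >= 0
   is; only the range in between requires multiples. *)
have [La|La] := leqP L (6 * (Q * N) + 2 * Q).
  by have := lo 0 (leq0n _); rewrite -/h -/L; move: La; clear; lia.
have [Lb|Lb] := leqP (6 * (Q * N) + 3 * Q) L.
  by move: Lb; rewrite /L pQE; clear -Q2; lia.
have [l lE] : exists l, L = 6 * Q * N + l by exists (L - 6 * Q * N); move: La; lia.
have QN : 6 * Q * N = 6 * (Q * N) by rewrite mulnA.
(* Now 2Q < l < 3Q, and [Q, 2Q + l) consists of the residues covered at least 4N + 2 times, more
   often than the c1 = 4N + 1 conditions per class. The net gain is 3 (l - 2Q) - 3. *)
have := @dim_capv_residues k p hp p2 p3 Q N l (4 * N + 1) Q./2.+1 n m Q (2 * Q + l) pQ.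
rewrite lE QN in La Lb.
have -> : 2 * Q + l - Q = Q + l by lia.
have h1 : Q <= 2 * Q + l <= 6 * Q by move: Lb; clear; lia.
have h2 : 3 * (p * Q) <= m <= 4 * (p * Q) by move: lE La; rewrite /L; move: mq; clear; lia.
have h3 : n <= Q * (4 * N + 1) + Q./2.+1 by move: nq; rewrite qh; clear; lia.
have o c r : c * Q + r = minn (2 * Q + l) (c * Q + minn l (6 * Q - c * Q)) ->
    overlap Q l Q (2 * Q + l) c = c * Q + r - maxn Q (c * Q) by rewrite /overlap => <-.
have o0 := o 0 l ltac:(move: La Lb; clear; lia).
have o1 := o 1 l ltac:(move: La Lb; clear; lia).
have o2 := o 2 l ltac:(move: La Lb; clear; lia).
have o3 := o 3 (l - Q) ltac:(move: La Lb; clear; lia).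
move=> /(_ h1 h2 lE h3); rewrite mulnDl mul1n -mulnA o0 o1 o2 o3.
have := lo _ (leqnn _); rewrite -/h -/L lE QN.
have -> : 0 * Q + l - maxn Q (0 * Q) = l - Q by clear; lia.
have -> : 1 * Q + l - maxn Q (1 * Q) = l by clear; lia.
have -> : 2 * Q + l - maxn Q (2 * Q) = l by clear; lia.
have -> : 3 * Q + (l - Q) - maxn Q (3 * Q) = l - Q by clear; lia.
move: (\dim _) (N * (Q + l)) (Q * N) La Lb Q2 QE => d x y; clear; lia.
Qed.

Lemma estimate5 e : p = 5 %[mod 8] -> 0 < e ->
  let Q := p ^ e in
  codimension_estimate (p * Q)
    (fun L => (L - (6 * (Q * (p %/ 8)) + 3 * Q)) +
              3 * (L - (6 * (Q * (p %/ 8)) + (4 * Q - 3)))) 24.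
Proof.
move=> p8 e0 Q; set N := p %/ 8; have pN : p = 8 * N + 5 by rewrite /N; lia.
have Q2 : 2 < Q by have := @leq_pexp2l p 1 e ltac:(lia) e0; rewrite expn1 -/Q; lia.
have pQ : p.-nat Q by exact: (pnat_char_exp hp).
have QE : Q = 2 * Q./2 + 1.
  by have := odd_double_half Q; rewrite (odd_char_exp hp p2); lia.
have [L0 [L1 [L2 [L3 [Z ex]]]]] := vanishing5 hp p2 p3 pQ pN Q2 QE.
have qh : (p * Q)./2 = Q * (4 * N + 2) + Q./2.
  by rewrite -[p * Q]expnS (@half_char_exp k p hp p2 p3 (4 * N + 2)) //; lia.
have qE : p * Q = 2 * (p * Q)./2 + 1 by rewrite qh {1}pN; lia.
move=> n m nq mq h L.
have Z' : only_zero (blocks (p * Q) L0 L1 L2 L3) (p * Q)./2 by rewrite qh.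
have up := codimension_upper qE nq mq Z'.
split; first by rewrite ex in up; move: up; rewrite -/h -/L; clear; lia.
have lo d := @codimension_lower k (p * Q) (p * Q)./2 n m d qE nq.
have pQE : p * Q = 8 * (Q * N) + 5 * Q by rewrite {1}pN; lia.
have [La|La] := leqP L (6 * (Q * N) + 3 * Q).
  by have := lo 0 (leq0n _); rewrite -/h -/L; move: La; clear -Q2; lia.
have [Lb|Lb] := leqP (6 * (Q * N) + 4 * Q) L.
  by move: Lb; rewrite /L pQE; clear -Q2; lia.
have [l lE] : exists l, L = 6 * Q * N + l by exists (L - 6 * Q * N); move: La; lia.
have QN : 6 * Q * N = 6 * (Q * N) by rewrite mulnA.
(* Now 3Q < l < 4Q, and [3Q, l) lies in all four stretches: its residues are covered 4N + 4 times,
   once more than the 4N + 3 conditions. As n <= Q (4N + 3), c0 = 0 will do. *)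
have := @dim_capv_residues k p hp p2 p3 Q N l (4 * N + 3) 0 n m (3 * Q) l pQ.
rewrite lE QN in La Lb.
have h1 : 3 * Q <= l <= 6 * Q by move: La Lb; clear; lia.
have h2 : 3 * (p * Q) <= m <= 4 * (p * Q) by move: lE La; rewrite /L; move: mq; clear; lia.
have h3 : n <= Q * (4 * N + 3) + 0 by move: nq; rewrite qh; move: QE; clear; lia.
have o c : c < 4 -> overlap Q l (3 * Q) l c = l - 3 * Q.
  rewrite /overlap; move: c La Lb; clear => -[|[|[|[|]]]] //; lia.
move=> /(_ h1 h2 lE h3); rewrite mulnDl -mulnA !o //.
have := lo _ (leqnn _); rewrite -/h -/L lE QN.
move: (\dim _) (N * (l - 3 * Q)) (Q * N) La Lb Q2 => d x y; clear; lia.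
Qed.

End Estimates.

(** * The canonical bundle of the sextic curve *)

Section Principal.
Variables (k K : fieldType) (iota : {rmorphism k -> K}).
Local Notation is_subalgebra := (is_subalgebra iota).

Lemma subalgebra_smallest (S : set K) : is_subalgebra (smallest is_subalgebra S).
Proof.
exact: (chart_subalgebra iota (fun _ : unit => S) tt).
Qed.

Lemma subalgebra1 B : is_subalgebra B -> B 1.
Proof. by case=> Bc _ _; rewrite -(rmorph1 iota). Qed.

Lemma subalgebra0 B : is_subalgebra B -> B 0.
Proof. by case=> Bc _ _; rewrite -(rmorph0 iota). Qed.

Lemma subalgebraN B c : is_subalgebra B -> B c -> B (- c).
Proof.
by case=> Bc _ BM Bx; rewrite -mulN1r -(rmorphN1 iota); apply: BM.
Qed.

Lemma subalgebraX B c n : is_subalgebra B -> B c -> B (c ^+ n).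
Proof.
move=> sB Bc; elim: n => [|n IHn]; first by rewrite expr0; apply: subalgebra1.
by rewrite exprS; case: sB => _ _; apply.
Qed.

Lemma subalgebra_sum B n (F : 'I_n -> K) : is_subalgebra B ->
  (forall i, B (F i)) -> B (\sum_(i < n) F i).
Proof.
move=> sB BF; apply: (big_ind B) => //; first exact: subalgebra0.
by case: sB.
Qed.

(** The factors are the free modules u^-1 B and v^-1 B, so only the generators have to be
    multiplied. *)
Lemma product_module_principal B u v : is_subalgebra B -> u != 0 -> v != 0 ->
  product_module [set c | B (c * u)] [set c | B (c * v)] = [set c | B (c * (u * v))].
Proof.
move=> sB u0 v0; have [Bc BD BM] := sB; rewrite eqEsubset; split.
  apply: product_module_ind => /=.
    split=> [|a b] /=; first by rewrite mul0r; apply: subalgebra0.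
    by move=> Ba Bb; rewrite mulrBl; apply: (BD) => //; apply: subalgebraN.
  by move=> a b Ba Bb; rewrite mulrACA; apply: BM.
move=> c /= Bcuv; rewrite -[c](mulKf u0).
apply: product_module_mem => /=; first by rewrite mulVf //; apply: subalgebra1.
by rewrite [u * c]mulrC -mulrA.
Qed.

Lemma tensor_power_principal T (G : T -> set K) (L : T -> set K) i u n :
  u != 0 -> L i = [set c | chart iota G i (c * u)] ->
  tensor_power iota G L n i = [set c | chart iota G i (c * u ^+ n)].
Proof.
move=> u0 Li; elim: n => [|n IHn].
  by rewrite expr0; apply/seteqP; split=> c /=; rewrite mulr1.
rewrite /tensor_power iterS -/(tensor_power iota G L n i) IHn Li exprS.
apply: product_module_principal; rewrite ?expf_neq0 //.
exact: subalgebra_smallest.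
Qed.

Definition ev (x : K) (a : {poly k}) : K := (map_poly iota a).[x].

Lemma evD x a b : ev x (a + b) = ev x a + ev x b.
Proof. by rewrite /ev rmorphD hornerD. Qed.
Lemma evM x a b : ev x (a * b) = ev x a * ev x b.
Proof. by rewrite /ev rmorphM hornerM. Qed.
Lemma evN x a : ev x (- a) = - ev x a.
Proof. by rewrite /ev rmorphN hornerN. Qed.
Lemma evC x c : ev x c%:P = iota c.
Proof. by rewrite /ev map_polyC hornerC. Qed.
Lemma evX x n : ev x 'X^n = x ^+ n.
Proof. by rewrite /ev map_polyXn hornerXn. Qed.
Lemma ev0 x : ev x 0 = 0.
Proof. by rewrite /ev rmorph0 horner0. Qed.
Lemma ev1 x : ev x 1 = 1.
Proof. by rewrite /ev rmorph1 hornerE. Qed.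
Lemma evX1 x : ev x 'X = x.
Proof. by rewrite -['X]expr1 evX expr1. Qed.

Lemma ev_sextic x : ev x (sextic k) = x ^+ 6 + 1.
Proof. by rewrite evD evX ev1. Qed.

Lemma ev_sum x (a : {poly k}) n : (size a <= n)%N -> ev x a = \sum_(i < n) iota a`_i * x ^+ i.
Proof.
move=> an; rewrite /ev (@horner_coef_wide _ n) ?size_map_poly //.
by apply: eq_bigr => i _; rewrite coef_map.
Qed.

Lemma subalgebra_ev B x a : is_subalgebra B -> B x -> B (ev x a).
Proof.
move=> sB Bx; rewrite (ev_sum x (leqnn _)); apply: subalgebra_sum => // i.
by case: (sB) => Bc _ BM; apply: (BM) => //; apply: subalgebraX.
Qed.

Lemma chart_sextic x z : z ^+ 2 = x ^+ 6 + 1 ->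
  smallest is_subalgebra [set x; z] =
  [set c | exists a b, c = ev x a + ev x b * z].
Proof.
move=> zx; rewrite eqEsubset; split.
  apply: smallest_sub => /=.
    split.
    - by move=> c; exists c%:P, 0; rewrite evC ev0 mul0r addr0.
    - move=> _ _ [a [b ->]] [a' [b' ->]]; exists (a + a'), (b + b').
      by rewrite !evD; ring.
    - move=> _ _ [a [b ->]] [a' [b' ->]].
      exists (a * a' + b * b' * sextic k), (a * b' + a' * b).
      rewrite !evD !evM ev_sextic -zx; ring.
  move=> c /= [->|->]; first by exists 'X, 0; rewrite evX1 ev0 mul0r addr0.
  by exists 0, 1; rewrite ev1 ev0 mul1r add0r.
move=> _ [a [b ->]]; have sB := subalgebra_smallest [set x; z].
have [Bc BD BM] := sB; have sub : [set x; z] `<=` smallest is_subalgebra [set x; z].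
  exact: sub_gen_smallest.
have Bx : smallest is_subalgebra [set x; z] x by apply: sub; left.
have Bz : smallest is_subalgebra [set x; z] z by apply: sub; right.
by apply: BD; [|apply: (BM) => //]; apply: (subalgebra_ev _ sB Bx).
Qed.

Lemma derivation_ev (D : K -> K) (x X : K) a : is_derivation_wrt iota x D ->
  D (ev X a) = ev X a^`() * D X.
Proof.
move=> [DD DM Dc _]; elim/poly_ind: a => [|a c IHa].
  by rewrite deriv0 ev0 mul0r -{1}(rmorph0 iota) Dc.
rewrite derivMXaddC !evD !evM evC evX1 DD Dc DM IHa; ring.
Qed.

(* On a chart with generators X and W with W^2 = X^6 + 1 the bundle is generated
   by dX / W, because 1 / W = W - X^6 / W. *)
Lemma canonical_chart (D : K -> K) (x X W : K) B :
  is_derivation_wrt iota x D -> W ^+ 2 = X ^+ 6 + 1 -> W != 0 -> D X != 0 ->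
  (2%:R : k) != 0 -> (3%:R : k) != 0 -> B = smallest is_subalgebra [set X; W] ->
  product_module B (D @` B) = [set c | B (c * (W / D X))].
Proof.
move=> hD WX W0 DX0 k2 k3 BE; have [DD DM Dc _] := hD.
have sB : is_subalgebra B by rewrite BE; exact: subalgebra_smallest.
have [Bc BD BM] := sB.
have BXW : B = [set c | exists a b, c = ev X a + ev X b * W].
  by rewrite BE chart_sextic.
have BX : B X by rewrite BXW; exists 'X, 0; rewrite evX1 ev0 mul0r addr0.
have BW : B W by rewrite BXW; exists 0, 1; rewrite ev1 ev0 mul1r add0r.
have K2 : (2%:R : K) != 0 by rewrite -(rmorph_nat iota) fmorph_eq0.
have K3 : (3%:R : K) != 0 by rewrite -(rmorph_nat iota) fmorph_eq0.
have DW : D W * W = 3%:R * X ^+ 5 * D X.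
  have : D (W ^+ 2) = D (ev X (sextic k)) by rewrite WX ev_sextic.
  rewrite (derivation_ev X _ hD) expr2 DM /sextic derivD derivXn -polyC1 derivC addr0.
  rewrite -scaler_nat -mul_polyC evM evC evX rmorph_nat => e.
  apply: (mulfI K2); transitivity (W * D W + W * D W); first by ring.
  by rewrite e /=; ring.
rewrite eqEsubset; split.
  apply: product_module_ind => /=.
    split=> [|a b] /=; first by rewrite mul0r; apply: subalgebra0.
    by move=> Ba Bb; rewrite mulrBl; apply: (BD) => //; apply: subalgebraN.
  move=> c _ Bcc [b Bb <-]; move: Bb; rewrite {1}BXW => -[b1 [b2 ->]].
  rewrite -mulrA; apply: (BM) => //.
  rewrite DD DM !(derivation_ev X _ hD).
  have -> : (ev X b1^`() * D X + (ev X b2 * D W + W * (ev X b2^`() * D X))) * (W / D X)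
     = ev X b1^`() * W + ev X b2 * (3%:R * X ^+ 5) + ev X b2^`() * W ^+ 2.
    have -> : 3%:R * X ^+ 5 = D W * W / D X by rewrite DW mulfK.
    by field.
  have Be a : B (ev X a) by apply: (subalgebra_ev _ sB BX).
  have B3 : B 3%:R by rewrite -(rmorph_nat iota); apply: Bc.
  apply: (BD); first apply: (BD); apply: (BM) => //; last exact: subalgebraX.
  by apply: (BM) => //; exact: subalgebraX.
move=> c /= Bcw; set g := c * (W / D X).
have -> : c = (g * W) * D X - (g * X * iota 3%:R^-1) * D W.
  rewrite fmorphV rmorph_nat.
  have -> : D W = 3%:R * X ^+ 5 * D X / W by rewrite -DW mulfK.
  rewrite /g; apply: (mulIf W0).
  have -> : c * W = c * W * (W ^+ 2 - X ^+ 6) by rewrite WX; ring.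
  by field; rewrite ?W0 ?DX0 ?K3.
have [_ sub] := product_module_subgroup B (D @` B).
apply: sub; apply: product_module_mem; try by [exists X|exists W].
  exact: BM.
by apply: (BM); [apply: (BM)|apply: Bc].
Qed.

End Principal.

(** * Sections of the powers of the cube of the canonical bundle *)

Section Sections.
Variables (k : closedFieldType) (p : nat).
Hypotheses (hp : p \in [pchar k]) (p2 : p <> 2%N) (p3 : p <> 3%N).
Variables (K : fieldType) (iota : {rmorphism k -> K}) (x z : K).
Hypothesis hC : is_sextic_function_field iota x z.
Variable D : K -> K.
Hypothesis hD : is_derivation_wrt iota x D.
Local Notation evi := (ev iota x^-1).
Local Notation ev := (ev iota x).
Local Notation sextic := (sextic k).

Let zx : z ^+ 2 = x ^+ 6 + 1. Proof. by case: hC. Qed.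

Lemma ev_eq0 a : ev a = 0 -> a = 0.
Proof.
case: hC => tr _ _ e; apply/eqP; apply: contra_eqT e; exact: tr.
Qed.

Lemma ev_inj : injective ev.
Proof.
move=> a b e; apply/eqP; rewrite -subr_eq0; apply/eqP/ev_eq0.
by rewrite evD evN e subrr.
Qed.

Lemma x_neq0 : x != 0.
Proof.
apply/eqP => x0; have /eqP : 'X = 0 :> {poly k} by apply: ev_eq0; rewrite evX1.
by rewrite polyX_eq0.
Qed.

Lemma z_neq0 : z != 0.
Proof.
apply/eqP => z0; have /eqP : sextic = 0.
  by apply: ev_eq0; rewrite ev_sextic -zx z0 expr0n.
by rewrite (negPf (sextic_neq0 _)).
Qed.

Lemma two_neq0 : (2%:R : k) != 0.
Proof.
have pp : prime p by case/andP: hp.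
by rewrite -(dvdn_pcharf hp) dvdn_prime2 //; apply/eqP.
Qed.

Lemma three_neq0 : (3%:R : k) != 0.
Proof.
have pp : prime p by case/andP: hp.
by rewrite -(dvdn_pcharf hp) dvdn_prime2 //; apply/eqP.
Qed.

(* X^6 + 1 has a simple root, hence is not a square in k(X). *)
Lemma ev_independent a b : ev a + ev b * z = 0 -> a = 0 /\ b = 0.
Proof.
move=> e; suff b0 : b = 0.
  by split=> //; apply: ev_eq0; rewrite -e b0 ev0 mul0r addr0.
apply/eqP/negPn/negP => b0.
have ab : a ^+ 2 = b ^+ 2 * sextic.
  apply: ev_inj; rewrite !(expr2, evM) ev_sextic -zx.
  have -> : ev a = - (ev b * z) by apply/eqP; rewrite -addr_eq0 e.
  by ring.
have a0 : a != 0.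
  by apply: contra_eqN ab => /eqP ->; rewrite expr0n /= eq_sym mulf_neq0 ?expf_neq0 ?sextic_neq0.
have /closed_rootP[r rr] : size sextic != 1%N by rewrite size_sextic.
have r6 : r ^+ 6 = - 1.
  by move: rr; rewrite /root !hornerE addr_eq0 => /eqP.
have mu1 : mup r sextic = 1%N.
  apply/eqP; rewrite eqn_leq mup_leq ?sextic_neq0 // mup_geq ?sextic_neq0 //.
  rewrite expr1 dvdp_XsubCl rr andbT; apply/negP => /dvdpP[h hE].
  have : sextic^`().[r] = 0.
    rewrite hE expr2 !derivM !(hornerD, hornerM, hornerN, hornerX, hornerC) subrr.
    by rewrite !(mulr0, mul0r, addr0).
  rewrite derivD derivXn -polyC1 derivC addr0 -scaler_nat hornerZ hornerXn.
  have r0 : r != 0 by apply: contra_eqN r6 => /eqP ->; rewrite expr0n eq_sym oppr_eq0 oner_eq0.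
  move=> e6; have /eqP : 2%:R * (3%:R * r ^+ 5) = 0 by rewrite -e6; ring.
  by rewrite !mulf_eq0 (negPf two_neq0) (negPf three_neq0) (negPf r0).
have := congr1 (mup r) ab; rewrite !expr2 !mupM ?mulf_neq0 ?sextic_neq0 // mu1; lia.
Qed.

Lemma chart_true : chart iota (sextic_charts x z) true =
  [set c | exists a b, c = ev a + ev b * z].
Proof. exact: chart_sextic. Qed.

Lemma D_inv : D x^-1 = - x ^- 2.
Proof.
have [DD DM Dc Dx] := hD; apply: (mulfI x_neq0).
have : D (iota 1) = x * D x^-1 + x^-1 * D x by rewrite -DM mulfV ?x_neq0 // rmorph1.
rewrite Dc Dx mulr1 => /esym/eqP; rewrite addr_eq0 => /eqP ->.
by field; rewrite ?x_neq0 ?z_neq0 ?oppr_eq0 ?oner_neq0.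
Qed.

Local Notation omega3 := (tensor_power iota (sextic_charts x z)
  (canonical_bundle iota (sextic_charts x z) D) 3).

Lemma omega3_true l : tensor_power iota (sextic_charts x z) omega3 l true =
  [set c | chart iota (sextic_charts x z) true (c * z ^+ (3 * l))].
Proof.
have [_ _ _ Dx] := hD.
rewrite exprM; apply: tensor_power_principal; first by rewrite expf_neq0 ?z_neq0.
apply: tensor_power_principal; first exact: z_neq0.
rewrite /canonical_bundle (@canonical_chart _ _ iota D x x z) ?Dx ?divr1 //.
- exact: z_neq0.
- exact: oner_neq0.
- exact: two_neq0.
- exact: three_neq0.
Qed.

(** On the chart at infinity the canonical bundle is generated by d(1/x) / (z/x^3) = - (x/z) dx. *)
Lemma omega3_false l : tensor_power iota (sextic_charts x z) omega3 l false =
  [set c | chart iota (sextic_charts x z) false (c * (- (z / x)) ^+ (3 * l))].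
Proof.
have zx0 : - (z / x) != 0 by rewrite oppr_eq0 mulf_neq0 ?invr_eq0 ?x_neq0 ?z_neq0.
rewrite exprM; apply: tensor_power_principal; first by rewrite expf_neq0.
apply: tensor_power_principal => //.
rewrite /canonical_bundle (@canonical_chart _ _ iota D x x^-1 (z / x ^+ 3)) ?D_inv //.
- apply/seteqP; suff -> : z / x ^+ 3 / - x ^- 2 = - (z / x) by split.
  by field; rewrite ?x_neq0 ?z_neq0 ?oppr_eq0 ?oner_neq0.
- by rewrite expr_div_n zx; field; rewrite ?x_neq0 ?z_neq0 ?oppr_eq0 ?oner_neq0.
- by rewrite mulf_neq0 ?invr_eq0 ?expf_neq0 ?x_neq0 ?z_neq0.
- by rewrite oppr_eq0 invr_eq0 expf_neq0 ?x_neq0.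
- exact: two_neq0.
- exact: three_neq0.
Qed.

Lemma chart_false : chart iota (sextic_charts x z) false =
  [set c | exists a b, c = evi a + evi b * (z / x ^+ 3)].
Proof.
by apply: chart_sextic; rewrite expr_div_n zx; field; rewrite ?x_neq0 ?z_neq0 ?oppr_eq0 ?oner_neq0.
Qed.

Lemma ev_inv (a : {poly k}) N : (size a <= N.+1)%N ->
  evi a * x ^+ N = ev (\poly_(i < N.+1) a`_(N - i)).
Proof.
move=> sa; rewrite (ev_sum _ _ sa) (ev_sum _ _ (size_poly _ _)) mulr_suml.
rewrite (reindex_inj rev_ord_inj) /=; apply: eq_bigr => i _.
rewrite coef_poly ltn_ord /= subSS -mulrA; congr (_ * _).
have iN : (i <= N)%N by rewrite -ltnS.
rewrite (_ : x ^+ N = x ^+ (N - i) * x ^+ i); last by rewrite -exprD subnK.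
by rewrite mulrA -exprMn mulVf ?x_neq0 // expr1n mul1r.
Qed.

(** The two charts give expressions in x, z and in 1/x, z/x^3. Independence of 1 and z over k[x]
    allows coefficients to be compared, and degrees to be bounded with z counting for 3. For l = 0
    the truncated bound [3 * l - 2] is 0 and forces b = 0. *)
Lemma global_sections_omega3 l c :
  global_sections (tensor_power iota (sextic_charts x z) omega3 l) c <->
  exists a b : {poly k}, [/\ (size a <= (3 * l).+1)%N, (size b <= 3 * l - 2)%N
    & c * z ^+ (3 * l) = ev a + ev b * z].
Proof.
have x0 := x_neq0; have z0 := z_neq0; split=> [cs|[a [b [sa sb cE]]] []].
- have := cs true; rewrite omega3_true chart_true => -[a [b /= cE]].
  have := cs false; rewrite omega3_false chart_false => -[a' [b' /=]].
  rewrite exprNn expr_div_n => cE'; exists a, b.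
  set N := maxn (size a') (size b').
  pose ra := \poly_(i < N.+1) a'`_(N - i); pose rb := \poly_(i < N.+1) b'`_(N - i).
  have aE : evi a' * x ^+ N = ev ra.
    by apply: ev_inv; rewrite ltnW // ltnS leq_maxl.
  have bE : evi b' * x ^+ N = ev rb.
    by apply: ev_inv; rewrite ltnW // ltnS leq_maxr.
  pose s : {poly k} := (-1) ^+ (3 * l).
  have sE : ev s = (-1) ^+ (3 * l).
    by rewrite /s; elim: (3 * l)%N => [|n IHn]; rewrite ?ev1 // !exprS evM IHn evN ev1.
  (* The two expressions of (-1)^(3l) c z^(3l), subtracted and cleared of denominators by x^(N +
     3). *)
  have ind : ev ('X^(3 * l + 3) * ra - 'X^(N + 3) * (s * a)) +
             ev ('X^(3 * l) * rb - 'X^(N + 3) * (s * b)) * z = 0.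
    rewrite !(evD, evN, evM, evX) -aE -bE sE (exprD x (3 * l) 3) (exprD x N 3).
    transitivity (x ^+ N * x ^+ 3 * (x ^+ (3 * l) * (evi a' +
      evi b' * (z / x ^+ 3)) - (-1) ^+ (3 * l) * (ev a + ev b * z))).
      by field.
    rewrite -cE' -cE; apply/eqP; rewrite mulf_eq0; apply/orP; right; rewrite subr_eq0.
    by apply/eqP; field; rewrite expf_neq0.
  have [ia ib] := ev_independent ind.
  have s1 (g : {poly k}) : size (s * g) = size g.
    rewrite /s -signr_odd; case: odd; rewrite ?expr1 ?expr0 ?mul1r //.
    by rewrite mulN1r size_polyN.
  have szX (g : {poly k}) n : g != 0 -> size ('X^n * g) = (n + size g)%N.
    by move=> g0; rewrite size_monicM ?monicXn // size_polyXn.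
  have le (g h : {poly k}) m n : 'X^m * h - 'X^n * (s * g) = 0 -> (size h <= N.+1)%N ->
      (n + size g <= m + N.+1)%N \/ size g = 0%N.
    move=> /eqP; rewrite subr_eq0 => /eqP e sh.
    have [->|g0] := eqVneq g 0; first by right; rewrite size_poly0.
    left; rewrite -(s1 g) -szX; last by rewrite -size_poly_gt0 s1 size_poly_gt0.
    rewrite -e; apply: leq_trans (size_polyMleq _ _) _; rewrite size_polyXn; lia.
  split=> //.
    by case: (le _ _ _ _ ia (size_poly _ _)); move: (size a) => n; lia.
  by case: (le _ _ _ _ ib (size_poly _ _)); move: (size b) => n; lia.
- by rewrite omega3_true chart_true; exists a, b.
- rewrite omega3_false /=.
  have sB := chart_subalgebra iota (sextic_charts x z) false.
  set B := chart _ _ _ in sB *; have [Bc BD BM] := sB.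
  have Bx : B x^-1 by apply: sub_gen_smallest; left.
  have Bz : B (z / x ^+ 3) by apply: sub_gen_smallest; right.
  rewrite exprNn expr_div_n.
  have -> : c * ((-1) ^+ (3 * l) * (z ^+ (3 * l) / x ^+ (3 * l))) =
     (-1) ^+ (3 * l) * (ev a / x ^+ (3 * l) + ev b / x ^+ (3 * l) * z).
    rewrite mulrCA [c * _]mulrA cE mulrDl; congr (_ * (_ + _)).
    by rewrite mulrAC.
  have B1 n : B ((-1) ^+ n).
    apply: (subalgebraX _ sB); rewrite -(rmorphN1 iota); exact: Bc.
  apply: (BM) => //; apply: (BD).
    rewrite (ev_sum _ _ sa) mulr_suml; apply: (subalgebra_sum sB) => i.
    rewrite -mulrA; apply: (BM) => //.
    have il : (i <= 3 * l)%N by rewrite -ltnS.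
    rewrite (_ : x ^+ i / x ^+ (3 * l) = x^-1 ^+ (3 * l - i)).
      exact: (subalgebraX _ sB).
    have {2}-> : (3 * l = (3 * l - i) + i)%N by rewrite subnK.
    by rewrite exprD invfM mulrCA mulfV ?expf_neq0 // mulr1 exprVn.
  rewrite (ev_sum _ _ sb) !mulr_suml; apply: (subalgebra_sum sB) => i.
  have il : (i + (3 * l - i - 3) + 3 = 3 * l)%N by have := ltn_ord i; lia.
  rewrite -!mulrA; apply: (BM) => //.
  rewrite (_ : _ * _ = x^-1 ^+ (3 * l - i - 3) * (z / x ^+ 3)).
    by apply: (BM) => //; apply: (subalgebraX _ sB).
  move: (3 * l - i - 3)%N il => j; move: (nat_of_ord i) => n; move: (3 * l)%N => m <-.
  rewrite (exprD x (n + j) 3) (exprD x n j) exprVn; field.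
  by rewrite ?expf_neq0 ?x0.
Qed.

End Sections.

(** * Flags of ideals *)

Section Flags.
Variable A : comNzRingType.
Implicit Types I J : set A.

(* J' / J is a simple A-module. *)
Definition simple_step J J' := [/\ J `<=` J', exists2 g, J' g & ~ J g &
  forall f y, J' f -> J' y -> ~ J y -> exists c, J (f - c * y)].

Definition has_flag I J n := exists H : nat -> set A,
  [/\ forall i, (i <= n)%N -> is_ideal (H i), H 0%N = I, H n = J &
      forall i, (i < n)%N -> simple_step (H i) (H i.+1)].

Lemma has_flag_refl I : is_ideal I -> has_flag I I 0.
Proof. by move=> iI; exists (fun=> I). Qed.

Lemma has_flag_rcons I J J' n : has_flag I J n -> is_ideal J' ->
  simple_step J J' -> has_flag I J' n.+1.
Proof.
move=> [H [iH H0 Hn sH]] iJ' sJ; exists (fun i => if (i <= n)%N then H i else J').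
split=> [i _|||i].
- by case: leqP => // /iH.
- by [].
- by rewrite ltnn.
- rewrite ltnS => le; have [il|nil|e] := ltngtP i n; last by rewrite e Hn.
    by apply: sH.
  by rewrite ltnNge le in nil.
Qed.

Lemma idealB I a b : is_ideal I -> I a -> I b -> I (a - b).
Proof. by case=> _ ID IM Ia Ib; apply: (ID) => //; rewrite -mulN1r; apply: IM. Qed.

(* Jordan-Hoelder: a strictly larger ideal acquires a new nonzero graded piece
   along the flag. *)
Lemma has_flag_colength I n : has_flag I [set: A] n -> has_colength I n.
Proof.
move=> [H [iH H0 Hn sH]]; split.
  exists H; split=> // i /sH[sub [g Jg nJg] _]; split=> // ssub.
  exact/nJg/ssub.
move=> m [J [iJ J0 Jm sJ]].
pose b i t := `[< exists x, [/\ J i x, H t.+1 x & ~ H t x] >].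
pose d i := (\sum_(t < n) b i t)%N.
have J0sub i : (i <= m)%N -> J 0%N `<=` J i.
  elim: i => [_|i IHi im]; first exact: subset_refl.
  apply: subset_trans (IHi (ltnW im)) _.
  by case: (sJ i im).
have b_mono i t : (i < m)%N -> (b i t <= b i.+1 t)%N.
  move=> im; suff : b i t -> b i.+1 t by case: (b i t) => [->|].
  move=> /asboolP[x [Jx Hx nHx]]; apply/asboolP; exists x; split=> //.
  by case: (sJ i im) => sub _; apply: sub.
have d_lt i : (i < m)%N -> (d i < d i.+1)%N.
  move=> im; rewrite ltn_neqAle; apply/andP; split; last by apply: leq_sum => t _; apply: b_mono.
  apply/negP => /eqP dd; have [_ nsub] := sJ i im; apply: nsub.
  have bb (t : 'I_n) : b i t = b i.+1 t.
    have := @leqif_sum 'I_n predT (fun t => b i t == b i.+1 t) (fun t => nat_of_bool (b i t)) (fun t => nat_of_bool (b i.+1 t)).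
    case=> [t' _|_].
      by split; [exact: b_mono|case: (b i t') (b i.+1 t') => [] []].
    by rewrite -/(d i) -/(d i.+1) dd eqxx => /esym /forallP /(_ t) /eqP.
  have iJi := iJ i (ltnW im); have iJi1 := iJ i.+1 im.
  (* If J_i and J_(i+1) have the same graded pieces, an element of J_(i+1) can be corrected by
     elements of J_i, one level of the flag at a time, until it falls into H_0 = J_0. *)
  have claim t : (t <= n)%N -> forall x, J i.+1 x -> H t x -> J i x.
    elim: t => [_ x _|t IHt tn x Jx Hx]; first by rewrite H0 -J0; apply: J0sub; exact: ltnW.
    have [Htx|nHtx] := pselect (H t x); first by apply: IHt => //; exact: ltnW.
    have : b i.+1 t by apply/asboolP; exists x.
    rewrite -(bb (Ordinal tn)) => /asboolP[y [Jy Hy nHy]].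
    have [_ _ /(_ _ _ Hx Hy nHy)[c Hc]] := sH t tn.
    rewrite -[x](subrK (c * y)).
    have Jcy : J i (c * y) by case: iJi => _ _; apply.
    case: (iJi) => _ ID _; apply: (ID) => //; apply: IHt (ltnW tn) _ _ Hc.
    apply: idealB => //; case: (sJ i im) => sub _; exact: sub.
  by move=> x Jx; apply: (claim n (leqnn n)) => //; rewrite Hn.
have : (m <= d m)%N.
  suff : forall i, (i <= m)%N -> (i <= d i)%N by apply.
  by elim=> [//|i IHi im]; apply: leq_ltn_trans (IHi (ltnW im)) (d_lt i im).
move=> le; apply: leq_trans le _; rewrite /d -[X in (_ <= X)%N]card_ord -sum1_card.
by apply: leq_sum => t _; exact: leq_b1.
Qed.

End Flags.

(** * Frobenius powers in coordinates *)

(* The component of degree l of an element is written a_l + b_l Z with forms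
   a_l, b_l of degree 3 l and 3 l - 3 in X and Y, dehomogenized at Y = 1; for
   l = 0 the truncated subtraction makes b_0 = 0. *)
Definition bounded (k : fieldType) l (a b : {poly k}) :=
  (size a <= (3 * l).+1)%N && (size b <= 3 * l - 2)%N.

(** An axiomatic form of the subring of k[X, Y, Z]/(Z^2 - F) made of the degrees divisible by 3.
    Besides these axioms, the colengths and the dimension only use the characteristic of A and the
    absence of zero divisors, never the function field. *)
Record sextic_coordinates (k : fieldType) (A : comNzRingType)
    (ca cb : A -> nat -> {poly k}) : Prop := SexticCoordinates {
  coord_bounded : forall f l, bounded l (ca f l) (cb f l);
  coord_aD : forall f g l, ca (f + g) l = ca f l + ca g l;
  coord_bD : forall f g l, cb (f + g) l = cb f l + cb g l;
  coord_aM : forall f g l, ca (f * g) l =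
    \sum_(i < l.+1) (ca f i * ca g (l - i)%N + cb f i * cb g (l - i)%N * sextic k);
  coord_bM : forall f g l, cb (f * g) l =
    \sum_(i < l.+1) (ca f i * cb g (l - i)%N + cb f i * ca g (l - i)%N);
  coord_ex : forall l a b, bounded l a b -> exists f, forall i,
    ca f i = (if i == l then a else 0) /\ cb f i = (if i == l then b else 0);
  coord_inj : forall f g, (forall l, ca f l = ca g l /\ cb f l = cb g l) -> f = g;
  coord_fin : forall f, exists N, forall l, (N <= l)%N -> ca f l = 0 /\ cb f l = 0 }.

Section Coordinates.
Variables (k : fieldType) (A : comNzRingType) (ca cb : A -> nat -> {poly k}).
Hypothesis cd : sextic_coordinates ca cb.
Local Notation F := (sextic k).

Lemma ca_size f l : (size (ca f l) <= (3 * l).+1)%N.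
Proof. by case/andP: (coord_bounded cd f l). Qed.

Lemma cb_size f l : (size (cb f l) <= 3 * l - 2)%N.
Proof. by case/andP: (coord_bounded cd f l). Qed.

Lemma cb_at0 f : cb f 0 = 0.
Proof. by apply/eqP; rewrite -size_poly_leq0; exact: cb_size. Qed.

Lemma ca0 l : ca 0 l = 0.
Proof. by apply: (addrI (ca 0 l)); rewrite -(coord_aD cd) !addr0. Qed.

Lemma cb0 l : cb 0 l = 0.
Proof. by apply: (addrI (cb 0 l)); rewrite -(coord_bD cd) !addr0. Qed.

Lemma caN f l : ca (- f) l = - ca f l.
Proof. by apply: (addrI (ca f l)); rewrite -(coord_aD cd) !subrr ca0. Qed.

Lemma cbN f l : cb (- f) l = - cb f l.
Proof. by apply: (addrI (cb f l)); rewrite -(coord_bD cd) !subrr cb0. Qed.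

Lemma ca_sum I (r : seq I) (P : pred I) (G : I -> A) l :
  ca (\sum_(i <- r | P i) G i) l = \sum_(i <- r | P i) ca (G i) l.
Proof.
by apply: (big_morph (fun f => ca f l)); [move=> f g; exact: (coord_aD cd)|exact: ca0].
Qed.

Lemma cb_sum I (r : seq I) (P : pred I) (G : I -> A) l :
  cb (\sum_(i <- r | P i) G i) l = \sum_(i <- r | P i) cb (G i) l.
Proof.
by apply: (big_morph (fun f => cb f l)); [move=> f g; exact: (coord_bD cd)|exact: cb0].
Qed.

Definition homog l (a b : {poly k}) : A := xget 0 [set f | forall i,
  ca f i = (if i == l then a else 0) /\ cb f i = (if i == l then b else 0)].

Lemma homogE l a b i : bounded l a b ->
  ca (homog l a b) i = (if i == l then a else 0) /\
  cb (homog l a b) i = (if i == l then b else 0).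
Proof.
by move=> lab; have [f fE] := coord_ex cd lab; rewrite /homog; case: xgetP => // /(_ f) [].
Qed.

Lemma ca_homog l a b i : bounded l a b -> ca (homog l a b) i = if i == l then a else 0.
Proof. by move=> /homogE - /(_ i)[]. Qed.

Lemma cb_homog l a b i : bounded l a b -> cb (homog l a b) i = if i == l then b else 0.
Proof. by move=> /homogE - /(_ i)[]. Qed.

Lemma homog_eq l f a b : bounded l a b ->
  (forall i, ca f i = if i == l then a else 0) ->
  (forall i, cb f i = if i == l then b else 0) -> f = homog l a b.
Proof.
by move=> lab fa fb; apply: (coord_inj cd) => i; rewrite fa fb ca_homog ?cb_homog.
Qed.

Lemma bounded0 l : bounded l (0 : {poly k}) 0.
Proof. by rewrite /bounded !size_poly0. Qed.

Lemma homog0 l : homog l 0 0 = 0.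
Proof. by apply/esym/homog_eq; rewrite ?bounded0 // => i; rewrite ?ca0 ?cb0 if_same. Qed.

Lemma boundedD l (a b a' b' : {poly k}) :
  bounded l a b -> bounded l a' b' -> bounded l (a + a') (b + b').
Proof.
move=> /andP[sa sb] /andP[sa' sb'].
by apply/andP; split; apply: leq_trans (size_polyD _ _) _; rewrite geq_max; apply/andP.
Qed.

Lemma homogD l a b a' b' : bounded l a b -> bounded l a' b' ->
  homog l (a + a') (b + b') = homog l a b + homog l a' b'.
Proof.
move=> v v'; apply/esym/homog_eq; first exact: boundedD.
  by move=> i; rewrite (coord_aD cd) !ca_homog //; case: eqP; rewrite ?addr0.
by move=> i; rewrite (coord_bD cd) !cb_homog //; case: eqP; rewrite ?addr0.
Qed.

Lemma convolution_delta l l' m (u v : {poly k}) :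
  \sum_(i < m.+1) (if val i == l then u else 0) * (if (m - i)%N == l' then v else 0) =
  if m == (l + l')%N then u * v else 0.
Proof.
case: eqP => [->|ne].
  have ll : (l < (l + l').+1)%N by rewrite ltnS leq_addr.
  rewrite (bigD1 (Ordinal ll)) //= big1 => [|i ne]; last first.
    by rewrite -val_eqE /= in ne; rewrite (negPf ne) mul0r.
  by rewrite eqxx addKn eqxx addr0.
rewrite big1 // => i _; case: eqP => [il|_]; last by rewrite mul0r.
case: eqP => [mi|_]; last by rewrite mulr0.
by case: ne; rewrite -mi -il subnKC // -ltnS ltn_ord.
Qed.

Lemma homog_caM l a b l' a' b' i : bounded l a b -> bounded l' a' b' ->
  ca (homog l a b * homog l' a' b') i =
    (if i == (l + l')%N then a * a' + b * b' * F else 0).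
Proof.
move=> v v'; rewrite (coord_aM cd).
under eq_bigr => j _ do rewrite !ca_homog // !cb_homog //.
rewrite big_split /= -mulr_suml !convolution_delta.
by case: eqP; rewrite ?mul0r ?addr0.
Qed.

Lemma homog_cbM l a b l' a' b' i : bounded l a b -> bounded l' a' b' ->
  cb (homog l a b * homog l' a' b') i =
    (if i == (l + l')%N then a * b' + b * a' else 0).
Proof.
move=> v v'; rewrite (coord_bM cd).
under eq_bigr => j _ do rewrite !ca_homog // !cb_homog //.
rewrite big_split /= !convolution_delta.
by case: eqP; rewrite ?addr0.
Qed.

(** No degree is computed: the bound is read off from the coordinates of the product. *)
Lemma boundedM l a b l' a' b' : bounded l a b -> bounded l' a' b' ->
  bounded (l + l')%N (a * a' + b * b' * F) (a * b' + b * a').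
Proof.
move=> v v'; have := coord_bounded cd (homog l a b * homog l' a' b') (l + l')%N.
by rewrite homog_caM // homog_cbM // eqxx.
Qed.

Lemma homogM l a b l' a' b' : bounded l a b -> bounded l' a' b' ->
  homog l a b * homog l' a' b' = homog (l + l')%N (a * a' + b * b' * F) (a * b' + b * a').
Proof.
move=> v v'; apply: homog_eq; first exact: boundedM.
  by move=> i; rewrite homog_caM.
by move=> i; rewrite homog_cbM.
Qed.

Lemma bounded_l l (a b : {poly k}) : bounded l a b -> bounded l a 0.
Proof. by move=> /andP[sa _]; rewrite /bounded sa size_poly0. Qed.

Lemma bounded_r l (a b : {poly k}) : bounded l a b -> bounded l 0 b.
Proof. by move=> /andP[_ sb]; rewrite /bounded sb size_poly0. Qed.

Lemma homogX_l l a j : bounded l a 0 -> bounded (l * j.+1)%N (a ^+ j.+1) 0 /\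
  homog l a 0 ^+ j.+1 = homog (l * j.+1)%N (a ^+ j.+1) 0.
Proof.
move=> v; elim: j => [|j [v' IHj]]; first by rewrite muln1 !expr1.
have := boundedM v v'; rewrite [homog l a 0 ^+ _]exprS IHj (homogM v v').
by rewrite -mulnS !(mul0r, mulr0, addr0) -exprS.
Qed.

Lemma homogX_r l b n : bounded l 0 b ->
  bounded (l * (2 * n).+1)%N 0 (b ^+ (2 * n).+1 * F ^+ n) /\
  homog l 0 b ^+ (2 * n).+1 = homog (l * (2 * n).+1)%N 0 (b ^+ (2 * n).+1 * F ^+ n).
Proof.
move=> v; elim: n => [|n [v' IHn]]; first by rewrite muln1 expr1 mulr1 expr1.
have v2 := boundedM v v; have v3 := boundedM v2 v'.
rewrite (_ : (2 * n.+1).+1 = 2 + (2 * n).+1)%N; last by lia.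
rewrite [homog l 0 b ^+ _]exprD IHn [homog l 0 b ^+ 2]expr2 (homogM v v) (homogM v2 v').
move: v3; rewrite !(mul0r, mulr0, addr0, add0r).
rewrite (_ : l + l + l * (2 * n).+1 = l * (2 + (2 * n).+1))%N; last by lia.
by rewrite (_ : b * b * F * _ = b ^+ (2 + (2 * n).+1) * F ^+ n.+1) // [b ^+ (2 + _)]exprD [F ^+ n.+1]exprS; ring.
Qed.

Lemma coord_decomposition f : exists N,
  f = \sum_(l < N) homog l (ca f l) (cb f l).
Proof.
have [N fN] := coord_fin cd f; exists N; apply: (coord_inj cd) => l.
rewrite ca_sum cb_sum.
under eq_bigr => i _ do rewrite ca_homog ?(coord_bounded cd) //.
under [in X in _ /\ X]eq_bigr => i _ do rewrite cb_homog ?(coord_bounded cd) //.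
have [lN|Nl] := ltnP l N; last first.
  have [-> ->] := fN l Nl; rewrite !big1 // => i _;
    by rewrite gtn_eqF // (leq_trans (ltn_ord i)).
by split; rewrite (bigD1 (Ordinal lN)) //= big1 ?eqxx ?addr0 // => i;
  rewrite -val_eqE eq_sym => /negPf /= ->.
Qed.

End Coordinates.

(** * Forms in the ideal generated by (X^q, Y^q)^3 and a power of F *)

Section Truncated.
Variables (k : fieldType) (q : nat).
Local Notation F := (sextic k).

(** The size condition keeps the second summand in degree m - 1; for f this follows from its
    support. *)
Definition in_cube_sextic m n (a : {poly k}) := exists f g,
  [/\ a = f + F ^+ n * g, supported (cube_exponents q m) f & (size (F ^+ n * g)%R <= m)%N].

(** The inequalities say that X^(jq) Y^((3-j)q) divides X^i Y^(m-1-i). *)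
Lemma cube_exponentsP m i : reflect
  (exists2 j, (j < 4)%N & (j * q <= i)%N && (i + 3 * q < j * q + m)%N) (cube_exponents q m i).
Proof.
rewrite /cube_exponents /blocks /intervals /= !orbF; apply: (iffP idP).
  case/or4P => h; [exists 0%N|exists 1%N|exists 2%N|exists 3%N] => //; lia.
by move=> [[|[|[|[|//]]]] _ h]; apply/or4P;
  [apply: Or41|apply: Or42|apply: Or43|apply: Or44]; lia.
Qed.

Lemma cube_exponents_lt m i : cube_exponents q m i -> (i < m)%N.
Proof. by case/cube_exponentsP => -[|[|[|[|//]]]] _; lia. Qed.

Lemma cube_exponentsD m d i j : (j <= d)%N ->
  cube_exponents q m i -> cube_exponents q (m + d) (j + i).
Proof.
move=> jd /cube_exponentsP[t t4 h]; apply/cube_exponentsP; exists t => //; lia.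
Qed.

Lemma supported0 (S : pred nat) : supported S (0 : {poly k}).
Proof. by move=> i; rewrite coef0 eqxx. Qed.

Lemma supportedD (S : pred nat) (f g : {poly k}) :
  supported S f -> supported S g -> supported S (f + g).
Proof.
move=> Sf Sg i; rewrite coefD; have [/Sf //|] := boolP (f`_i != 0).
by rewrite negbK => /eqP ->; rewrite add0r; exact: Sg.
Qed.

Lemma supportedM m d (c f : {poly k}) : (size c <= d.+1)%N ->
  supported (cube_exponents q m) f -> supported (cube_exponents q (m + d)) (c * f).
Proof.
move=> sc Sf i; rewrite coefM => ne.
have /existsP[j] : [exists j : 'I_i.+1, c`_j * f`_(i - j) != 0].
  apply: contraR ne; rewrite negb_exists => /forallP z; rewrite big1 // => j _.
  by apply/eqP; have := z j; rewrite negbK.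
rewrite mulf_eq0 negb_or => /andP[cj /Sf fj].
have jd : (j <= d)%N.
  by rewrite leqNgt; apply: contra cj => dj; rewrite nth_default // (leq_trans sc).
have ji : (j <= i)%N by rewrite -ltnS.
by rewrite -(subnKC ji); exact: cube_exponentsD.
Qed.

Lemma in_cube_sextic0 m n : in_cube_sextic m n 0.
Proof. by exists 0, 0; rewrite mulr0 addr0 size_poly0; split=> //; exact: supported0. Qed.

Lemma in_cube_sexticD m n a b :
  in_cube_sextic m n a -> in_cube_sextic m n b -> in_cube_sextic m n (a + b).
Proof.
move=> [f [g [-> Sf sg]]] [f' [g' [-> Sf' sg']]]; exists (f + f'), (g + g').
split; [by ring|exact: supportedD|].
by rewrite mulrDr (leq_trans (size_polyD _ _)) // geq_max sg.
Qed.

Lemma size_mul_le (c f : {poly k}) d m : (size c <= d.+1)%N -> (size f <= m)%N ->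
  (size (c * f)%R <= m + d)%N.
Proof.
by move=> sc sf; apply: leq_trans (size_polyMleq _ _) _; move: sc sf;
   move: (size c) (size f) => u v; lia.
Qed.

Lemma in_cube_sexticM m n d (c a : {poly k}) : (size c <= d.+1)%N ->
  in_cube_sextic m n a -> in_cube_sextic (m + d) n (c * a).
Proof.
move=> sc [f [g [-> Sf sg]]]; exists (c * f), (c * g); split.
- by ring.
- exact: supportedM.
- by rewrite mulrCA; exact: size_mul_le.
Qed.

Lemma in_cube_sextic_up m n a : in_cube_sextic m n a -> in_cube_sextic (m + 6) n.+1 (F * a).
Proof.
move=> [f [g [-> Sf sg]]]; have sF : (size F <= 7)%N by rewrite size_sextic.
exists (F * f), g; split; first by rewrite exprS; ring.
- exact: supportedM.
- by rewrite exprS -mulrA; exact: size_mul_le.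
Qed.

Lemma in_cube_sextic_down m n a : in_cube_sextic m n.+1 a -> in_cube_sextic m n a.
Proof.
move=> [f [g [-> Sf sg]]]; exists f, (F * g); split=> //; first by rewrite exprS; ring.
by rewrite mulrA -exprSr.
Qed.

Lemma in_cube_sexticP m n (a : {poly_m k}) : reflect (in_cube_sextic m n a)
  (a \in coordspace k m (cube_exponents q m) + mulspace m (F ^+ n))%VS.
Proof.
apply: (iffP memv_addP) => [[u /coordspaceP Su [v /mulspaceP dv ->]]|[f [g [aE Sf sg]]]].
  by exists (polyn u), (polyn v %/ F ^+ n); rewrite mulrC divpK //; split.
have sf : (size f <= m)%N.
  apply/leq_sizeP => i mi; apply/eqP; apply: contraTT mi => /Sf /cube_exponents_lt.
  by rewrite ltnNge.
exists (npolyp m f); first by apply/coordspaceP; rewrite npolypK.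
exists (npolyp m (F ^+ n * g)); first by apply/mulspaceP; rewrite npolypK ?dvdp_mulr.
by apply/npolyP => i; rewrite /= coefD !npolypK // -coefD -aE.
Qed.

End Truncated.

(** * The Frobenius power as a graded ideal *)

Section FrobeniusPower.
Variables (k : fieldType) (A : comNzRingType) (ca cb : A -> nat -> {poly k}).
Hypothesis cd : sextic_coordinates ca cb.
Variables (p e : nat).
Local Notation F := (sextic k).
Local Notation q := (p ^ e)%N.
Local Notation homog := (homog ca cb).

Definition maximal_ideal : set A := [set f | ca f 0 = 0].

Definition graded_ideal_below (n N : nat) : set A := [set f | forall l, (l < N)%N ->
  in_cube_sextic q (3 * l).+1 n.+1 (ca f l) /\ in_cube_sextic q (3 * l - 2) n (cb f l)].

Definition graded_ideal (n : nat) : set A := [set f | forall l,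
  in_cube_sextic q (3 * l).+1 n.+1 (ca f l) /\ in_cube_sextic q (3 * l - 2) n (cb f l)].

(** Multiplication by Z sends b Z to b F, which turns F^n into F^(n+1), and a to a Z, where F^(n+1)
    may be weakened to F^n. Components of a product in degrees below N involve only components of
    the factors below N. *)
Lemma graded_ideal_below_ideal n N : is_ideal (graded_ideal_below n N).
Proof.
split.
- by move=> l _; rewrite (ca0 cd) (cb0 cd); split; exact: in_cube_sextic0.
- move=> f g Jf Jg l lN; have [fa fb] := Jf l lN; have [ga gb] := Jg l lN.
  by rewrite (coord_aD cd) (coord_bD cd); split; exact: in_cube_sexticD.
move=> r f Jf l lN; rewrite (coord_aM cd) (coord_bM cd).
split; (apply: (big_ind (in_cube_sextic _ _ _)); first exact: in_cube_sextic0;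
        first by move=> u v; exact: in_cube_sexticD);
  move=> i _; have il := leq_ord i;
  have [fa fb] := Jf (l - i)%N (leq_ltn_trans (leq_subr i l) lN); apply: in_cube_sexticD.
- rewrite (_ : (3 * l).+1 = (3 * (l - i)).+1 + 3 * i)%N; last by lia.
  by apply: in_cube_sexticM => //; exact: (ca_size cd).
(* In degree 0 the b coordinate vanishes; these cases are set apart because truncated subtraction
   would falsify the degree identity below. *)
- case: (posnP i) => [->|i0]; first by rewrite (cb_at0 cd) !mul0r; exact: in_cube_sextic0.
  have [li|li] := posnP (l - i).
    by rewrite li (cb_at0 cd) mulr0 mul0r; exact: in_cube_sextic0.
  rewrite -mulrA [_ * F]mulrC.
  rewrite (_ : (3 * l).+1 = (3 * (l - i) - 2 + 6) + (3 * i - 3))%N; last by lia.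
  apply: in_cube_sexticM; last exact: in_cube_sextic_up.
  by apply: leq_trans (cb_size cd _ _) _; lia.
- have [li|li] := posnP (l - i).
    by rewrite li (cb_at0 cd) mulr0; exact: in_cube_sextic0.
  rewrite (_ : (3 * l - 2) = (3 * (l - i) - 2) + 3 * i)%N; last by lia.
  by apply: in_cube_sexticM => //; exact: (ca_size cd).
- case: (posnP i) => [->|i0]; first by rewrite (cb_at0 cd) !mul0r; exact: in_cube_sextic0.
  rewrite (_ : (3 * l - 2) = (3 * (l - i)).+1 + (3 * i - 3))%N; last by lia.
  apply: in_cube_sexticM; last exact: in_cube_sextic_down.
  by apply: leq_trans (cb_size cd _ _) _; lia.
Qed.

Lemma graded_ideal_ideal n : is_ideal (graded_ideal n).
Proof.
have J0 N := graded_ideal_below_ideal n N; split.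
- by move=> l; have [z _ _] := J0 l.+1; exact: z.
- move=> f g Jf Jg l; have [_ z _] := J0 l.+1.
  by apply: (z f g).
- move=> r f Jf l; have [_ _ z] := J0 l.+1.
  by apply: (z r f).
Qed.

Hypotheses (hp : p \in [pchar k]) (hA : p \in [pchar A]).

Lemma sumr_Frobenius (B : comNzRingType) I (r : seq I) (P : pred I) (G : I -> B) :
  p \in [pchar B] -> (\sum_(i <- r | P i) G i) ^+ q = \sum_(i <- r | P i) G i ^+ q.
Proof.
move=> hB; have pp : prime p by case/andP: hB.
apply: (big_morph (fun x => x ^+ q)) => [x y|].
  by rewrite exprDn_pchar // pnatX pnatE // hB.
have q0 : (q == 0%N) = false by rewrite eqn0Ngt expn_gt0 prime_gt0.
by rewrite expr0n q0.
Qed.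

Lemma homog_in_graded_ideal n l a b : bounded l a b ->
  in_cube_sextic q (3 * l).+1 n.+1 a -> in_cube_sextic q (3 * l - 2) n b ->
  graded_ideal n (homog l a b).
Proof.
move=> v Ua Ub i; rewrite (ca_homog cd) // (cb_homog cd) //.
by case: eqP => [->//|_]; split; exact: in_cube_sextic0.
Qed.

(** In a^q only q-th powers of monomials occur. In positive degree each monomial X^i Y^(3l+3-i) is
    divisible by a cubic one, namely by that with X-exponent min(i, 3). *)
Lemma supported_Frobenius l (a : {poly k}) : (size a <= (3 * l.+1).+1)%N ->
  supported (cube_exponents q (3 * (l.+1 * q)).+1) (a ^+ q).
Proof.
have pp : prime p by case/andP: hp.
have q0 : (0 < q)%N by rewrite expn_gt0 prime_gt0.
move=> sa; rewrite -{1}[a]coefK poly_def sumr_Frobenius ?pchar_poly //.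
apply: (big_ind (supported _)); [exact: supported0|exact: supportedD|].
move=> i _ j; rewrite exprZn -exprM coefZ coefXn.
case: (j =P (i * q)%N) => [-> _|_]; last by rewrite mulr0 eqxx.
have i3 : (i <= 3 * l.+1)%N by rewrite -ltnS (leq_trans (ltn_ord i)).
apply/cube_exponentsP; exists (minn i 3); first by lia.
apply/andP; split; first by rewrite leq_mul2r geq_minl orbT.
have le : (i + 3 <= minn i 3 + 3 * l.+1)%N by lia.
by move: le; rewrite -(leq_pmul2r q0) !mulnDl; lia.
Qed.

Lemma Frobenius_graded_ideal n f : q = (2 * n).+1 -> maximal_ideal f ->
  graded_ideal n (f ^+ q).
Proof.
move=> qn f0; have [J0 JD JM] := graded_ideal_ideal n.
have [N fE] := coord_decomposition cd f; rewrite fE sumr_Frobenius //.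
apply: (big_ind (graded_ideal n)) => // i _.
have v := coord_bounded cd f i; have va := bounded_l v; have vb := bounded_r v.
have -> : homog i (ca f i) (cb f i) = homog i (ca f i) 0 + homog i 0 (cb f i).
  by rewrite -(homogD cd) // addr0 add0r.
have := @sumr_Frobenius A _ [:: homog i (ca f i) 0; homog i 0 (cb f i)] predT id hA.
rewrite !big_cons !big_nil !addr0 => ->.
have [wa ea] := homogX_l cd (2 * n)%N va; have [wb eb] := homogX_r cd n vb.
rewrite {1}qn ea {1}qn eb -qn in wa wb *.
apply: (JD); apply: homog_in_graded_ideal => //; try exact: in_cube_sextic0.
  case: (nat_of_ord i) v => [|l] v; last first.
    exists (ca f l.+1 ^+ q), 0; rewrite mulr0 addr0 size_poly0; split=> //.
    by apply: supported_Frobenius; case/andP: v.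
  rewrite f0 expr0n [in q == 0%N]qn /=; exact: in_cube_sextic0.
exists 0, (cb f i ^+ q); rewrite add0r mulrC; split=> //; first exact: supported0.
by case/andP: wb => _; rewrite mulrC.
Qed.

End FrobeniusPower.

Section FrobeniusPower.
Variables (k : fieldType) (A : comNzRingType) (ca cb : A -> nat -> {poly k}).
Hypothesis cd : sextic_coordinates ca cb.
Variables (p e n : nat).
Hypotheses (hp : p \in [pchar k]) (hA : p \in [pchar A]).
Hypothesis qn : (p ^ e = (2 * n).+1)%N.
Local Notation F := (sextic k).
Local Notation q := (p ^ e)%N.
Local Notation homog := (homog ca cb).
Local Notation I := (frobenius_power p (maximal_ideal ca) e).

Lemma frobenius_power_ideal : is_ideal I.
Proof.
apply: smallest_closed => G GC; split.
- by move=> M /GC[].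
- by move=> a b Fa Fb M FM; case: (GC _ FM) => _ + _; apply; [exact: Fa|exact: Fb].
- by move=> r a Fa M FM; case: (GC _ FM) => _ _; apply; exact: Fa.
Qed.

Lemma frobenius_power_gen f : ca f 0 = 0 -> I (f ^+ q).
Proof. by move=> f0; apply: sub_gen_smallest; exists f. Qed.

Lemma size_scaleX (c : k) i m : (i < m)%N -> (size (c *: 'X^i : {poly k}) <= m)%N.
Proof. by move=> im; rewrite (leq_trans (size_scale_leq _ _)) // size_polyXn. Qed.

Lemma boundedX1 j : (j < 4)%N -> bounded 1 ('X^j : {poly k}) 0.
Proof. by move=> j4; rewrite /bounded size_polyXn size_poly0 andbT. Qed.

Lemma bounded_Z : bounded 1 (0 : {poly k}) 1.
Proof. by rewrite /bounded size_poly0 size_poly1. Qed.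

Lemma frobenius_power_X j : (j < 4)%N ->
  bounded q ('X^(j * q) : {poly k}) 0 /\ I (homog q 'X^(j * q) 0).
Proof.
move=> j4; have [v e1] := homogX_l cd (2 * n)%N (boundedX1 j4).
move: v e1; rewrite -qn mul1n -exprM => v <-; split=> //.
by apply: frobenius_power_gen; rewrite (ca_homog cd) ?boundedX1.
Qed.

Lemma frobenius_power_Z : bounded q 0 (F ^+ n) /\ I (homog q 0 (F ^+ n)).
Proof.
have [v e1] := homogX_r cd n bounded_Z.
move: v e1; rewrite -qn mul1n expr1n mul1r => v <-; split=> //.
by apply: frobenius_power_gen; rewrite (ca_homog cd) ?bounded_Z.
Qed.

Lemma frobenius_power_cube_l l f : supported (cube_exponents q (3 * l).+1) f ->
  I (homog l f 0).
Proof.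
move=> Sf; have [I0 ID IM] := frobenius_power_ideal.
suff [] : bounded l f 0 /\ I (homog l f 0) by [].
rewrite -[f]coefK poly_def.
apply: (big_ind (fun g => bounded l g 0 /\ I (homog l g 0))).
- by rewrite homog0 //; split; rewrite ?bounded0.
- move=> g h [vg Ig] [vh Ih]; have := boundedD vg vh; rewrite addr0 => v; split=> //.
  by rewrite -[X in homog l _ X]addr0 (homogD cd) //; exact: ID.
move=> i _; have [->|fi] := eqVneq f`_i 0.
  by rewrite scale0r homog0 //; split; rewrite ?bounded0.
have vi : bounded l (f`_i *: 'X^i) 0.
  by rewrite /bounded size_poly0 andbT; apply: size_scaleX; exact: cube_exponents_lt (Sf _ fi).
split=> //; have /cube_exponentsP[j j4 /andP[ji il]] := Sf _ fi.
have [vX IX] := frobenius_power_X j4.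
have vc : bounded (l - q) (f`_i *: 'X^(i - j * q)) 0.
  by rewrite /bounded size_poly0 andbT; apply: size_scaleX; lia.
have -> : homog l (f`_i *: 'X^i) 0 = homog (l - q)%N (f`_i *: 'X^(i - j * q)) 0 * homog q 'X^(j * q) 0.
  rewrite (homogM cd) // !(mulr0, mul0r, addr0) -scalerAl -exprD !subnK //; lia.
exact: IM.
Qed.

Lemma frobenius_power_cube_r l f : supported (cube_exponents q (3 * l - 2)) f ->
  I (homog l 0 f).
Proof.
move=> Sf; have [I0 ID IM] := frobenius_power_ideal.
suff [] : bounded l 0 f /\ I (homog l 0 f) by [].
rewrite -[f]coefK poly_def.
apply: (big_ind (fun g => bounded l 0 g /\ I (homog l 0 g))).
- by rewrite homog0 //; split; rewrite ?bounded0.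
- move=> g h [vg Ig] [vh Ih]; have := boundedD vg vh; rewrite addr0 => v; split=> //.
  by rewrite -[X in homog l X _]addr0 (homogD cd) //; exact: ID.
move=> i _; have [->|fi] := eqVneq f`_i 0.
  by rewrite scale0r homog0 //; split; rewrite ?bounded0.
have vi : bounded l 0 (f`_i *: 'X^i).
  by rewrite /bounded size_poly0 /=; apply: size_scaleX; exact: cube_exponents_lt (Sf _ fi).
split=> //; have /cube_exponentsP[j j4 /andP[ji il]] := Sf _ fi.
have [vX IX] := frobenius_power_X j4.
have vc : bounded (l - q) 0 (f`_i *: 'X^(i - j * q)).
  by rewrite /bounded size_poly0 /=; apply: size_scaleX; move: ji il; clear; move: (j * q)%N (nat_of_ord i) q => t s u; lia.
have -> : homog l 0 (f`_i *: 'X^i) = homog (l - q)%N 0 (f`_i *: 'X^(i - j * q)) * homog q 'X^(j * q) 0.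
  rewrite (homogM cd) // !(mulr0, mul0r, addr0, add0r) -scalerAl -exprD !subnK //; lia.
exact: IM.
Qed.

Lemma size_sextic_mul m (g : {poly k}) : g != 0 ->
  size (F ^+ m * g)%R = (6 * m + size g)%N.
Proof.
move=> g0; rewrite size_mul ?expf_neq0 ?sextic_neq0 // size_sextic_exp.
by rewrite addSn.
Qed.

Lemma graded_ideal_sub : graded_ideal ca cb p e n `<=` I.
Proof.
move=> f Jf; have [I0 ID IM] := frobenius_power_ideal.
have [N ->] := coord_decomposition cd f; apply: (big_ind I) => // l _.
have v := coord_bounded cd f l.
have -> : homog l (ca f l) (cb f l) = homog l (ca f l) 0 + homog l 0 (cb f l).
  by rewrite -(homogD cd) ?(bounded_l v) ?(bounded_r v) // addr0 add0r.
have [vZ IZ] := frobenius_power_Z.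
have [[f1 [g1 [aE S1 s1]]] [f2 [g2 [bE S2 s2]]]] := Jf l.
apply: (ID).
  have va1 : bounded l f1 0.
    rewrite /bounded size_poly0 andbT; apply/leq_sizeP => i mi; apply/eqP.
    by apply: contraTT mi => /S1 /cube_exponents_lt; rewrite ltnNge.
  have vb1 : bounded l (F ^+ n.+1 * g1) 0 by rewrite /bounded size_poly0 andbT.
  rewrite aE -[X in homog l _ X]addr0 (homogD cd) //; apply: (ID).
    exact: frobenius_power_cube_l.
  have [->|g0] := eqVneq g1 0; first by rewrite mulr0 homog0.
  rewrite size_sextic_mul // in s1; have g1s : (0 < size g1)%N by rewrite size_poly_gt0.
  have vg : bounded (l - q) 0 g1.
    by rewrite /bounded size_poly0 /=; move: s1 g1s; rewrite qn; move: (size g1) => s; lia.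
  (* F^(n+1) = Z (F^n Z): a multiple of Z^q reaches the a coordinate only through a further factor
     Z, whence n + 1 there and n in the b coordinate. *)
  have -> : homog l (F ^+ n.+1 * g1) 0 = homog (l - q)%N 0 g1 * homog q 0 (F ^+ n).
    rewrite (homogM cd) // !(mulr0, mul0r, addr0, add0r) subnK; last by rewrite qn; lia.
    by congr (homog _ _ _); rewrite exprS; ring.
  exact: IM.
have va2 : bounded l 0 f2.
  rewrite /bounded size_poly0 /=; apply/leq_sizeP => i mi; apply/eqP.
  by apply: contraTT mi => /S2 /cube_exponents_lt; rewrite ltnNge.
have vb2 : bounded l 0 (F ^+ n * g2) by rewrite /bounded size_poly0.
rewrite bE -[X in homog l X _]addr0 (homogD cd) //; apply: (ID).
  exact: frobenius_power_cube_r.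
have [->|g0] := eqVneq g2 0; first by rewrite mulr0 homog0.
rewrite size_sextic_mul // in s2; have g2s : (0 < size g2)%N by rewrite size_poly_gt0.
have vg : bounded (l - q) g2 0.
  by rewrite /bounded size_poly0 andbT; move: s2 g2s; rewrite qn; move: (size g2) => s; lia.
have -> : homog l 0 (F ^+ n * g2) = homog (l - q)%N g2 0 * homog q 0 (F ^+ n).
  rewrite (homogM cd) // !(mulr0, mul0r, addr0, add0r) subnK; last by rewrite qn; lia.
  by congr (homog _ _ _); rewrite mulrC.
exact: IM.
Qed.

Lemma frobenius_powerE : I = graded_ideal ca cb p e n.
Proof.
rewrite eqEsubset; split; last exact: graded_ideal_sub.
apply: smallest_sub; first exact: (graded_ideal_ideal cd).
by move=> _ [f f0 <-]; exact: (Frobenius_graded_ideal cd hp hA qn f0).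
Qed.

End FrobeniusPower.

(** * The colength of the graded ideal *)

Section Colength.
Variables (k : fieldType) (A : comNzRingType) (ca cb : A -> nat -> {poly k}).
Hypothesis cd : sextic_coordinates ca cb.
Variables (p e n : nat).
Local Notation F := (sextic k).
Local Notation q := (p ^ e)%N.
Local Notation homog := (homog ca cb).
Local Notation below := (graded_ideal_below ca cb p e n).

Definition component m c : {vspace {poly_m k}} :=
  (coordspace k m (cube_exponents q m) + mulspace m (F ^+ c))%VS.

Lemma npolypD m (a b : {poly k}) : npolyp m (a + b) = npolyp m a + npolyp m b.
Proof.
apply/npolyP => i; rewrite coef_npolyp /= coefD coefD !coef_npolyp.
by case: ltnP; rewrite ?addr0.
Qed.

Lemma npolypZ m c (a : {poly k}) : npolyp m (c%:P * a) = c *: npolyp m a.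
Proof.
apply/npolyP => i; rewrite coef_npolyp mul_polyC coefZ /= coefZ coef_npolyp.
by case: ltnP; rewrite ?mulr0.
Qed.

Lemma npolyp0 m : npolyp m (0 : {poly k}) = 0.
Proof. by rewrite -[X in npolyp _ X](mul0r 0) -polyC0 npolypZ scale0r. Qed.

Lemma componentP m c (a : {poly k}) : (size a <= m)%N ->
  reflect (in_cube_sextic q m c a) (npolyp m a \in component m c).
Proof. by move=> sa; rewrite -{1}(npolypK sa); exact: in_cube_sexticP. Qed.

(** Interpolates between [below l.+1] and [below l] by subspaces of forms in degree l. *)
Definition layer l (W1 : {vspace {poly_((3 * l).+1) k}}) (W2 : {vspace {poly_(3 * l - 2) k}}) :
  set A := [set f | [/\ below l f, npolyp _ (ca f l) \in W1 & npolyp _ (cb f l) \in W2]].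

Lemma ca_scale c f i : ca (homog 0 c%:P 0 * f) i = c%:P * ca f i.
Proof.
have v : bounded 0 c%:P (0 : {poly k}) by rewrite /bounded size_poly0 andbT size_polyC; case: eqP.
rewrite (coord_aM cd) big_ord_recl /= big1 => [|j _]; last first.
  by rewrite !(ca_homog cd, cb_homog cd) //= !mul0r addr0.
by rewrite !(ca_homog cd, cb_homog cd) //= !mul0r !addr0 subn0.
Qed.

Lemma cb_scale c f i : cb (homog 0 c%:P 0 * f) i = c%:P * cb f i.
Proof.
have v : bounded 0 c%:P (0 : {poly k}) by rewrite /bounded size_poly0 andbT size_polyC; case: eqP.
rewrite (coord_bM cd) big_ord_recl /= big1 => [|j _]; last first.
  by rewrite !(ca_homog cd, cb_homog cd) //= !mul0r addr0.
by rewrite !(ca_homog cd, cb_homog cd) //= !mul0r !addr0 subn0.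
Qed.

Lemma ca_mul_homog r l a b i : bounded l a b -> (i <= l)%N ->
  ca (r * homog l a b) i = if i == l then ca r 0 * a else 0.
Proof.
move=> v il; rewrite (coord_aM cd) big_ord_recl /= big1 => [|j _]; last first.
  rewrite !(ca_homog cd, cb_homog cd) //.
  by rewrite (_ : (i - bump 0 j == l)%N = false) ?mulr0 ?mul0r ?addr0 //; rewrite /bump; have := ltn_ord j; lia.
rewrite subn0 !(ca_homog cd, cb_homog cd) // (cb_at0 cd) !mul0r !addr0.
by case: eqP; rewrite ?mulr0.
Qed.

Lemma cb_mul_homog r l a b i : bounded l a b -> (i <= l)%N ->
  cb (r * homog l a b) i = if i == l then ca r 0 * b else 0.
Proof.
move=> v il; rewrite (coord_bM cd) big_ord_recl /= big1 => [|j _]; last first.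
  rewrite !(ca_homog cd, cb_homog cd) //.
  by rewrite (_ : (i - bump 0 j == l)%N = false) ?mulr0 ?addr0 //; rewrite /bump; have := ltn_ord j; lia.
rewrite subn0 !(ca_homog cd, cb_homog cd) // (cb_at0 cd) !mul0r !addr0.
by case: eqP; rewrite ?mulr0.
Qed.

Lemma ca0_const r : exists c, ca r 0 = c%:P.
Proof.
by exists (ca r 0)`_0; apply: size1_polyC; have := ca_size cd r 0; rewrite muln0.
Qed.

(** Modulo [below l.+1], an element r acts on the degree l part of [below l] through its constant
    term, so subspaces are stable. *)
Lemma layer_ideal l W1 W2 : (component _ n.+1 <= W1)%VS -> (component _ n <= W2)%VS ->
  is_ideal (@layer l W1 W2).
Proof.
move=> V1 V2; have [B0 BD BM] := graded_ideal_below_ideal cd p e n l; split.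
- by split=> //; rewrite ?(ca0 cd) ?(cb0 cd) npolyp0 mem0v.
- move=> f g [Bf f1 f2] [Bg g1 g2]; split; first exact: BD.
    by rewrite (coord_aD cd) npolypD memvD.
  by rewrite (coord_bD cd) npolypD memvD.
move=> r f [Bf f1 f2]; set h := homog l (ca f l) (cb f l).
have v := coord_bounded cd f l.
have Bf' : below l.+1 (f - h).
  move=> i il; rewrite (coord_aD cd) (coord_bD cd) (caN cd) (cbN cd).
  rewrite (ca_homog cd _ v) (cb_homog cd _ v).
  have [->|ne] := eqVneq i l; first by rewrite !subrr; split; exact: in_cube_sextic0.
  by rewrite !subr0; apply: Bf; rewrite ltn_neqAle ne -ltnS.
have [_ _ /(_ r _ Bf') Brf] := graded_ideal_below_ideal cd p e n l.+1.
have [Ua Ub] := Brf l (ltnSn l); have [c rc] := ca0_const r.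
have fE : r * f = r * (f - h) + r * h by rewrite mulrBr subrK.
split; first exact: BM.
- rewrite fE (coord_aD cd) npolypD memvD //.
    by apply: (subvP V1); apply/componentP => //; exact: (ca_size cd).
  by rewrite ca_mul_homog // eqxx rc npolypZ memvZ.
- rewrite fE (coord_bD cd) npolypD memvD //.
    by apply: (subvP V2); apply/componentP => //; exact: (cb_size cd).
  by rewrite cb_mul_homog // eqxx rc npolypZ memvZ.
Qed.

Lemma npolypB m (a b : {poly k}) : npolyp m (a - b) = npolyp m a - npolyp m b.
Proof.
rewrite npolypD (_ : - b = (-1)%:P * b); last by rewrite polyCN polyC1 mulN1r.
by rewrite npolypZ scaleN1r.
Qed.

Section Extension.
Variables (m : nat) (phi : A -> {poly_m k}) (J : {vspace {poly_m k}} -> set A).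
Variable V : {vspace {poly_m k}}.
Hypothesis J_ideal : forall W, (V <= W)%VS -> is_ideal (J W).
Hypothesis phiB : forall f g, phi (f - g) = phi f - phi g.
Hypothesis phiZ : forall c f, phi (homog 0 c%:P 0 * f) = c *: phi f.
Hypothesis JE : forall W f, J W f <-> J fullv f /\ phi f \in W.
Hypothesis phi_onto : forall v, exists2 g, J fullv g & phi g = v.

(** The quotient is a line over k, and the scalars, which lie in A, already act transitively on its
    nonzero vectors. *)
Lemma simple_step_line W v : (V <= W)%VS -> v \notin W ->
  simple_step (J W) (J (W + <[v]>)%VS).
Proof.
move=> VW vW; have iJ' := J_ideal (subv_trans VW (addvSl W <[v]>)).
have [g Jg gv] := phi_onto v; split.
- by move=> f /JE[Jf fW]; apply/JE; split=> //; exact: (subvP (addvSl _ _)).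
- exists g; last by rewrite JE gv => -[_]; apply/negP.
  by apply/JE; split=> //; rewrite gv (subvP (addvSr _ _)) ?memv_line.
move=> f y J'f J'y nJy.
have /JE[Jf /memv_addP[wf wfW [_ /vlineP[cf ->] fE]]] := J'f.
have /JE[Jy /memv_addP[wy wyW [_ /vlineP[cy ->] yE]]] := J'y.
have cy0 : cy != 0.
  by apply: contra_notN nJy => /eqP c0; rewrite JE yE c0 scale0r addr0.
exists (homog 0 (cf / cy)%:P 0); rewrite JE; split.
  have Jcy : J (W + <[v]>)%VS (homog 0 (cf / cy)%:P 0 * y) by case: iJ' => _ _; apply.
  by have /JE[] := idealB iJ' J'f Jcy.
rewrite phiB phiZ fE yE scalerDr scalerA divfK // opprD addrACA subrr addr0.
by rewrite memvB // memvZ.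
Qed.

(** One vector is added at a time. The map [phi] will be the a coordinate, then the b coordinate, in
    degree l. *)
Lemma has_flag_extend I N W : (V <= W)%VS -> has_flag I (J W) N ->
  has_flag I (J fullv) (N + (m - \dim W)).
Proof.
move d : (m - \dim W)%N => c; elim: c N W d => [|c IHc] N W d VW fl.
  suff -> : fullv = W by rewrite addn0.
  by apply/esym/eqP; rewrite eqEdim subvf dimvf /dim /= -subn_eq0 d.
have [v vW] : exists v, v \notin W.
  apply: contrapT => nv; have : (fullv <= W)%VS.
    by apply/subvP => v _; apply: contrapT => /negP nvW; apply: nv; exists v.
  by move/dimvS; rewrite dimvf /dim /=; lia.
have VWv : (V <= W + <[v]>)%VS by apply: subv_trans VW (addvSl _ _).
rewrite addnS -addSn; apply: (IHc _ (W + <[v]>)%VS) => //; last first.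
  by apply: has_flag_rcons fl (J_ideal VWv) _; exact: simple_step_line.
have v0 : v != 0 by apply: contraNneq vW => ->; rewrite mem0v.
have := dimv_sum_cap W <[v]>; rewrite dim_vline v0.
have -> : (W :&: <[v]> = 0)%VS.
  apply/eqP; rewrite -subv0; apply/subvP => u /memv_capP[uW /vlineP[a uE]].
  rewrite memv0; have [a0|a0] := eqVneq a 0; first by rewrite uE a0 scale0r.
  by case/negP: vW; rewrite -[v](scalerK a0) -uE memvZ.
by rewrite dimv0; lia.
Qed.

End Extension.

Lemma layer_full_homog l a b : bounded l a b -> @layer l fullv fullv (homog l a b).
Proof.
move=> v; split; rewrite ?memvf // => i il.
by rewrite (ca_homog cd) // (cb_homog cd) // (ltn_eqF il); split; exact: in_cube_sextic0.
Qed.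

Lemma layer_flag I N l : has_flag I (@layer l (component _ n.+1) (component _ n)) N ->
  has_flag I (@layer l fullv fullv)
    (N + codimension k (3 * l).+1 (cube_exponents q (3 * l).+1) n.+1 +
         codimension k (3 * l - 2) (cube_exponents q (3 * l - 2)) n).
Proof.
move=> fl.
apply: (@has_flag_extend _ (fun f => npolyp _ (cb f l)) (layer fullv) (component _ n)) => //.
- by move=> W VW; apply: layer_ideal => //; exact: subvf.
- by move=> f g; rewrite (coord_bD cd) (cbN cd) npolypB.
- by move=> c f; rewrite cb_scale npolypZ.
- by move=> W f; split=> [[? ? ?]|[[? ? _] ?]]; split; rewrite ?memvf //; split; rewrite ?memvf.
- move=> v; have b : bounded l 0 v by rewrite /bounded size_poly0 size_npoly.
  exists (homog l 0 v); first exact: layer_full_homog.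
  by rewrite (cb_homog cd) // eqxx; apply/npolyP => i; rewrite npolypK.
apply: (@has_flag_extend _ (fun f => npolyp _ (ca f l)) (fun W => layer W (component _ n))
          (component _ n.+1)) => //.
- by move=> W VW; apply: layer_ideal.
- by move=> f g; rewrite (coord_aD cd) (caN cd) npolypB.
- by move=> c f; rewrite ca_scale npolypZ.
- by move=> W f; split=> [[? ? ?]|[[? _ ?] ?]]; split; rewrite ?memvf //; split; rewrite ?memvf.
- move=> v; have b : bounded l v 0 by rewrite /bounded size_poly0 andbT size_npoly.
  exists (homog l v 0).
    split; rewrite ?memvf //; first by case: (layer_full_homog b).
    by rewrite (cb_homog cd) // eqxx npolyp0 mem0v.
  by rewrite (ca_homog cd) // eqxx; apply/npolyP => i; rewrite npolypK.
Qed.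

Lemma layer_component l : @layer l (component _ n.+1) (component _ n) = below l.+1.
Proof.
rewrite eqEsubset; split=> f.
  move=> [B f1 f2] i; rewrite ltnS leq_eqVlt => /orP[/eqP ->|/B //].
  by split; [apply/(componentP _ (ca_size cd f l))|apply/(componentP _ (cb_size cd f l))].
move=> B; have [fa fb] := B l (ltnSn l); split.
- by move=> i il; apply: B; exact: ltnW.
- by apply/componentP => //; exact: (ca_size cd).
- by apply/componentP => //; exact: (cb_size cd).
Qed.

Lemma layer_full l : @layer l fullv fullv = below l.
Proof. by rewrite eqEsubset; split=> f => [[]//|B]; split; rewrite ?memvf. Qed.

Definition graded_colength K := (\sum_(l < K)
  (codimension k (3 * l).+1 (cube_exponents q (3 * l).+1) n.+1 +
   codimension k (3 * l - 2) (cube_exponents q (3 * l - 2)) n))%N.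

Lemma below_flag K : has_flag (below K) [set: A] (graded_colength K).
Proof.
have -> : [set: A] = below 0 by apply/seteqP; split.
suff fl l : (l <= K)%N -> has_flag (below K) (below (K - l)) (\sum_(K - l <= i < K)
    (codimension k (3 * i).+1 (cube_exponents q (3 * i).+1) n.+1 +
     codimension k (3 * i - 2) (cube_exponents q (3 * i - 2)) n))%N.
  by have := fl K (leqnn K); rewrite subnn big_mkord.
elim: l => [_|l IHl lK].
  by rewrite subn0 big_geq //; apply: has_flag_refl; exact: graded_ideal_below_ideal.
rewrite -(layer_full (K - l.+1)) (big_ltn (_ : K - l.+1 < K)%N); last by lia.
rewrite (_ : (K - l.+1).+1 = K - l)%N; last by lia.
rewrite [X in has_flag _ _ X]addnC addnA; apply: layer_flag.
rewrite layer_component (_ : (K - l.+1).+1 = K - l)%N; last by lia.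
by apply: IHl; exact: ltnW.
Qed.

(** From degree K on the spaces of forms have dimension at least 4q, where the conditions are
    void. *)
Lemma graded_ideal_colength K : (0 < q)%N -> (4 * q <= 3 * K - 2)%N ->
  has_colength (graded_ideal ca cb p e n) (graded_colength K).
Proof.
move=> q0 qK; suff -> : graded_ideal ca cb p e n = below K.
  exact/has_flag_colength/below_flag.
rewrite eqEsubset; split=> f Jf l; first by move=> _; exact: Jf.
have [/Jf //|Kl] := ltnP l K.
have full m c (a : {poly k}) : (4 * q <= m)%N -> (size a <= m)%N -> in_cube_sextic q m c a.
  move=> qm sa; apply/componentP => //.
  have c0 : (m - \dim (component m c))%N = 0%N by exact: codimension_large.
  have /eqP -> : component m c == fullv by rewrite eqEdim subvf dimvf /dim /= -subn_eq0 c0.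
  exact: memvf.
split; apply: full; rewrite ?(ca_size cd) ?(cb_size cd) //; lia.
Qed.

End Colength.

(** * Krull dimension *)

Section LowestTerm.
Variable A : comNzRingType.

(** Since I is prime and does not contain x, the factor x^i can be removed. This leaves S_i + x R in
    I, hence in I', which contains x. *)
Lemma lowest_term (I I' : set A) x (S : nat -> A) i N :
  is_prime_ideal I -> is_ideal I' -> I `<=` I' -> I' x -> ~ I x ->
  (i < N)%N -> (forall j, (j < i)%N -> S j = 0) ->
  I (\sum_(j < N) x ^+ j * S j) -> I' (S i).
Proof.
move=> [iI _ pI] iI' II' I'x nIx iN S0.
have IX n a : I (x ^+ n * a) -> I a.
  elim: n a => [|n IHn] a; first by rewrite mul1r.
  by rewrite exprS -mulrA => /pI[/nIx//|/IHn].
have -> : \sum_(j < N) x ^+ j * S j =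
    x ^+ i * (S i + x * \sum_(j < N | (i < j)%N) x ^+ (j - i).-1 * S j).
  rewrite (bigID (fun j : 'I_N => (j < i)%N)) /= big1 => [|j ji]; last first.
    by rewrite S0 ?mulr0.
  rewrite add0r (bigD1 (Ordinal iN)) /= ?ltnn // mulrDr; congr (_ + _).
  rewrite mulrA -exprSr mulr_sumr; apply: eq_big => j.
    by rewrite -val_eqE /= -leqNgt ltn_neqAle eq_sym andbC.
  move=> /andP[]; rewrite -leqNgt => ij; rewrite -val_eqE /= => ne.
  rewrite mulrA -exprD; congr (x ^+ _ * _); lia.
move=> /IX/II' h; set R := \sum_(_ < N | _) _ in h.
rewrite -[S i](addrK (x * R)); apply: idealB => //.
by rewrite mulrC; case: iI' => _ _; apply.
Qed.

End LowestTerm.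

Section KrullDimension.
Variables (k : fieldType) (A : comNzRingType) (ca cb : A -> nat -> {poly k}).
Hypothesis cd : sextic_coordinates ca cb.
Hypothesis A_domain : forall f g : A, f * g = 0 -> f = 0 \/ g = 0.
Local Notation homog := (homog ca cb).

Definition scalar (c : k) : A := homog 0 c%:P 0.

Lemma scalar1 : scalar 1 = 1.
Proof.
rewrite -[LHS]mulr1; apply: (coord_inj cd) => l.
by rewrite (ca_scale cd) (cb_scale cd) polyC1 !mul1r.
Qed.

Lemma scalarM c d f : scalar c * (scalar d * f) = scalar (c * d) * f.
Proof.
apply: (coord_inj cd) => l.
by rewrite !(ca_scale cd) !(cb_scale cd) polyCM -!mulrA.
Qed.

Lemma ca1 l : ca 1 l = if l == 0%N then 1 else 0.
Proof. by rewrite -scalar1 (ca_homog cd) // /bounded polyC1 size_poly1 size_poly0. Qed.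

Lemma cb1 l : cb 1 l = 0.
Proof.
by rewrite -scalar1 (cb_homog cd) ?if_same // /bounded polyC1 size_poly1 size_poly0.
Qed.

Definition degree_lt (f : A) d := forall l, (d <= l)%N -> ca f l = 0 /\ cb f l = 0.

Lemma degree_ltM f g d d' :
  degree_lt f d.+1 -> degree_lt g d'.+1 -> degree_lt (f * g) (d + d').+1.
Proof.
move=> df dg l dl; rewrite (coord_aM cd) (coord_bM cd).
have z (i : 'I_l.+1) : (ca f i = 0 /\ cb f i = 0) \/ (ca g (l - i)%N = 0 /\ cb g (l - i)%N = 0).
  by have [di|id] := ltnP d i; [left; exact: df|right; apply: dg; lia].
by rewrite !big1 // => i _; case: (z i) => -[-> ->]; rewrite !(mul0r, mulr0, addr0).
Qed.

Lemma degree_ltX f d n : degree_lt f d.+1 -> degree_lt (f ^+ n) (n * d).+1.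
Proof.
move=> df; elim: n => [|n IHn]; last by rewrite exprS mulSn; exact: degree_ltM.
by move=> l l1; rewrite ca1 cb1 gtn_eqF.
Qed.

Lemma degree_lt_ex f : exists d, degree_lt f d.+1.
Proof.
by have [d fd] := coord_fin cd f; exists d => l dl; apply: fd; exact: ltnW.
Qed.

Lemma degree_lt_le f d d' : (d <= d')%N -> degree_lt f d.+1 -> degree_lt f d'.+1.
Proof. by move=> dd df l dl; apply: df; exact: leq_trans dl. Qed.

(* There are M^3 monomials in x, y, w with exponents < M, but the elements of
   degree <= 3 d M have only O(M^2) coordinates. *)
Lemma algebraic_dependence (x y w : A) : exists M (c : nat -> nat -> nat -> k),
  (exists i j l, [/\ (i < M)%N, (j < M)%N, (l < M)%N & c i j l != 0]) /\
  \sum_(i < M) x ^+ i * (\sum_(j < M) y ^+ j * (\sum_(l < M) w ^+ l * scalar (c i j l))) = 0.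
Proof.
have [d [dx dy dw]] : exists d, [/\ degree_lt x d.+1, degree_lt y d.+1 & degree_lt w d.+1].
  have [d1 h1] := degree_lt_ex x; have [d2 h2] := degree_lt_ex y.
  have [d3 h3] := degree_lt_ex w; exists (d1 + d2 + d3)%N.
  by split; [apply: degree_lt_le h1|apply: degree_lt_le h2|apply: degree_lt_le h3]; lia.
(* There are M^3 monomials against 2 L (3L) = 54 (d+1)^2 M^2 coefficients, fewer since 54 < 60. *)
pose M := (60 * d.+1 ^ 2)%N; pose L := (3 * (M * d.+1))%N.
pose T : finType := ('I_M * 'I_M * 'I_M)%type.
pose U : finType := ('I_L * 'I_(3 * L) * bool)%type.
pose mono (t : T) := x ^+ t.1.1 * (y ^+ t.1.2 * w ^+ t.2).
pose Mx : 'M[k]_(#|T|, #|U|) := \matrix_(s, u)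
  let t : T := enum_val s in let v : U := enum_val u in
  (if v.2 then ca (mono t) v.1.1 else cb (mono t) v.1.1)`_v.1.2.
have M0 : (0 < M)%N by rewrite /M; have := expn_gt0 d.+1 2; lia.
have dmono t : degree_lt (mono t) L.
  have h := degree_ltM (@degree_ltX _ _ t.1.1 dx)
    (degree_ltM (@degree_ltX _ _ t.1.2 dy) (@degree_ltX _ _ t.2 dw)).
  move=> l Ll; apply: h; apply: leq_trans Ll; rewrite /L.
  have t1 : (t.1.1 * d <= M * d)%N by rewrite leq_mul2r ltnW ?orbT.
  have t2 : (t.1.2 * d <= M * d)%N by rewrite leq_mul2r ltnW ?orbT.
  have t3 : (t.2 * d <= M * d)%N by rewrite leq_mul2r ltnW ?orbT.
  by move: t1 t2 t3; rewrite mulnS; lia.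
have UT : (#|U| < #|T|)%N.
  rewrite !card_prod !card_ord card_bool /L.
  have -> : (3 * (M * d.+1) * (3 * (3 * (M * d.+1))) * 2 = 54 * (d.+1 ^ 2) * (M * M))%N by ring.
  by rewrite -[X in (_ < X)%N]mulnA ltn_pmul2r ?muln_gt0 ?M0 // /M ltn_pmul2r // expn_gt0.
have [v v0 vM] : exists2 v : 'rV[k]_#|T|, v != 0 & v *m Mx = 0.
  exists (nz_row (kermx Mx)); last by apply/sub_kermxP; exact: nz_row_sub.
  rewrite nz_row_eq0 kermx_eq0 /row_free; apply: contraTN UT => /eqP <-.
  by rewrite -leqNgt rank_leq_col.
pose c (i j l : nat) : k := if insub i is Some i' then if insub j is Some j' then
  if insub l is Some l' then v 0 (enum_rank ((i', j', l') : T)) else 0 else 0 else 0.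
have cE (t : T) : c t.1.1 t.1.2 t.2 = v 0 (enum_rank t).
  by case: t => [[i j] l]; rewrite /c /= !valK.
exists M, c; split.
  have [s vs] : exists s, v 0 s != 0 by apply/rV0Pn.
  exists (enum_val s).1.1, (enum_val s).1.2, (enum_val s).2; split=> //.
  by rewrite cE enum_valK.
have -> : \sum_(i < M) x ^+ i * (\sum_(j < M) y ^+ j * (\sum_(l < M) w ^+ l * scalar (c i j l)))
    = \sum_(t : T) scalar (v 0 (enum_rank t)) * mono t.
  pose f (i j l : 'I_M) := scalar (c i j l) * (x ^+ i * (y ^+ j * w ^+ l)).
  transitivity (\sum_(t : 'I_M * 'I_M * 'I_M) f t.1.1 t.1.2 t.2); last first.
    by apply: eq_bigr => t _; rewrite -cE.
  rewrite -(pair_bigA _ (fun u l => f u.1 u.2 l)) /=.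
  rewrite -(pair_bigA _ (fun i j => \sum_(l < M) f i j l)) /=.
  apply: eq_bigr => i _; rewrite mulr_sumr; apply: eq_bigr => j _.
  by rewrite !mulr_sumr; apply: eq_bigr => l _; rewrite /f; ring.
rewrite /scalar; apply: (coord_inj cd) => l; rewrite (ca0 cd) (cb0 cd) (ca_sum cd) (cb_sum cd).
have [lL|Ll] := ltnP l L; last first.
  rewrite !big1 // => t _; have [ha hb] := dmono t l Ll.
    by rewrite ?(ca_scale cd) ?(cb_scale cd) ?ha ?hb mulr0.
  by rewrite ?(ca_scale cd) ?(cb_scale cd) ?ha ?hb mulr0.
have Mu (u : U) : \sum_(t : T) v 0 (enum_rank t) *
    (if u.2 then ca (mono t) u.1.1 else cb (mono t) u.1.1)`_u.1.2 = 0.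
  have := congr1 (fun Z : 'rV_#|U| => Z 0 (enum_rank u)) vM; rewrite !mxE.
  rewrite (reindex_onto (@enum_rank T) (@enum_val T predT)) /=; last by move=> s _; rewrite enum_valK.
  move=> h; rewrite -[RHS]h; apply: eq_big => [t|t _]; first by rewrite enum_rankK eqxx.
  by rewrite mxE !enum_rankK.
split; apply/polyP => i; rewrite coef0 coef_sum.
  have [iL|Li] := ltnP i (3 * L); last first.
    rewrite big1 // => t _; rewrite (ca_scale cd) coefCM nth_default ?mulr0 //.
    by apply: leq_trans (ca_size cd _ _) _; lia.
  have := Mu (Ordinal lL, Ordinal iL, true); rewrite /= => h; rewrite -[RHS]h.
  by apply: eq_bigr => t _; rewrite (ca_scale cd) coefCM.
have [iL|Li] := ltnP i (3 * L); last first.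
  rewrite big1 // => t _; rewrite (cb_scale cd) coefCM nth_default ?mulr0 //.
  by apply: leq_trans (cb_size cd _ _) _; lia.
have := Mu (Ordinal lL, Ordinal iL, false); rewrite /= => h; rewrite -[RHS]h.
by apply: eq_bigr => t _; rewrite (cb_scale cd) coefCM.
Qed.

(** Take x, y, w, one new element at each of three steps, and an algebraic relation between them.
    Applying [lowest_term] at the lexicographically smallest exponents with nonzero coefficient,
    once per step, puts this coefficient, a unit, into J_3. *)
Lemma prime_chain_le2 m : prime_chain A m -> (m <= 2)%N.
Proof.
move=> [J [pJ sJ]]; rewrite leqNgt; apply/negP => m3.
have pick i : (i < m)%N -> exists2 x, J i.+1 x & ~ J i x.
  by move=> im; have [_ /existsPNP[x]] := sJ i im; exists x.
have [x J1x nJ0x] := pick 0%N (ltn_trans (ltn0Sn _) m3).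
have [y J2y nJ1y] := pick 1%N (ltn_trans (isT : 1 < 2)%N m3).
have [w J3w nJ2w] := pick 2%N m3.
have sub i : (i < m)%N -> J i `<=` J i.+1 by move=> im; case: (sJ i im).
have idl i : (i <= m)%N -> is_ideal (J i) by move=> /pJ[].
have [M [c [cnz rel]]] := algebraic_dependence x y w.
have exI : exists i, (i < M)%N && `[< exists j l, [/\ (j < M)%N, (l < M)%N & c i j l != 0] >].
  case: cnz => i [j [l [iM jM lM cn]]]; exists i; rewrite iM /=; apply/asboolP.
  by exists j, l.
case: (ex_minnP exI) => i /andP[iM /asboolP exj] imin.
have exJ : exists j, (j < M)%N && `[< exists2 l, (l < M)%N & c i j l != 0 >].
  case: exj => j [l [jM lM cn]]; exists j; rewrite jM /=; apply/asboolP.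
  by exists l.
case: (ex_minnP exJ) => j /andP[jM /asboolP exl] jmin.
have exL : exists l, (l < M)%N && (c i j l != 0).
  by case: exl => l lM cn; exists l; rewrite lM.
case: (ex_minnP exL) => l /andP[lM cijl] lmin.
have sc0 : scalar 0 = 0 by rewrite /scalar polyC0 homog0.
have S1 : J 1%N (\sum_(j < M) y ^+ j * (\sum_(l < M) w ^+ l * scalar (c i j l))).
  apply: (lowest_term (pJ 0%N _) (idl 1%N _) (sub 0%N _) J1x nJ0x iM
    (S := fun i => \sum_(j < M) y ^+ j * (\sum_(l < M) w ^+ l * scalar (c i j l)))) => //; try lia.
    move=> i' i'i; rewrite big1 // => j' _; rewrite big1 ?mulr0 // => l' _.
    have [->|cn] := eqVneq (c i' j' l') 0; first by rewrite sc0 mulr0.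
    have /imin : (i' < M)%N && `[< exists j l, [/\ (j < M)%N, (l < M)%N & c i' j l != 0] >].
      rewrite (ltn_trans i'i iM) /=; apply/asboolP; exists j', l'; split=> //.
    by rewrite leqNgt i'i.
  by rewrite rel; case: (idl 0%N (leq0n _)).
have S2 : J 2%N (\sum_(l < M) w ^+ l * scalar (c i j l)).
  apply: (lowest_term (pJ 1%N _) (idl 2%N _) (sub 1%N _) J2y nJ1y jM
    (S := fun j => \sum_(l < M) w ^+ l * scalar (c i j l))) => //; try lia.
  move=> j' j'j; rewrite big1 // => l' _.
  have [->|cn] := eqVneq (c i j' l') 0; first by rewrite sc0 mulr0.
  have /jmin : (j' < M)%N && `[< exists2 l, (l < M)%N & c i j' l != 0 >].
    by rewrite (ltn_trans j'j jM) /=; apply/asboolP; exists l'.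
  by rewrite leqNgt j'j.
have S3 : J 3%N (scalar (c i j l)).
  apply: (lowest_term (pJ 2%N _) (idl 3%N _) (sub 2%N _) J3w nJ2w lM
    (S := fun l => scalar (c i j l))) => //; try lia.
  move=> l' l'l; have [->//|cn] := eqVneq (c i j l') 0.
  have /lmin : (l' < M)%N && (c i j l' != 0) by rewrite (ltn_trans l'l lM).
  by rewrite leqNgt l'l.
have [[_ _ J3M] nJ1 _] := pJ 3%N m3; apply: nJ1.
have := J3M (scalar (c i j l)^-1) _ S3.
by rewrite -[X in _ * X]mulr1 scalarM mulVf // mulr1 scalar1.
Qed.

(* Restriction to the point x = 0, z = 1 of the curve. *)
Definition value (f : A) l := (ca f l).[0] + (cb f l).[0].

Lemma valueD f g l : value (f + g) l = value f l + value g l.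
Proof. by rewrite /value (coord_aD cd) (coord_bD cd) !hornerD addrACA. Qed.

Lemma valueM f g l : value (f * g) l = \sum_(i < l.+1) value f i * value g (l - i)%N.
Proof.
rewrite /value (coord_aM cd) (coord_bM cd) !horner_sum -big_split /=.
apply: eq_bigr => i _; rewrite !hornerE expr0n /=; ring.
Qed.

Lemma convolution_lowest (u v : nat -> k) i j :
  (forall l, (l < i)%N -> u l = 0) -> (forall l, (l < j)%N -> v l = 0) ->
  \sum_(l < (i + j).+1) u l * v (i + j - l)%N = u i * v j.
Proof.
move=> ui vj; have ij : (i < (i + j).+1)%N by rewrite ltnS leq_addr.
rewrite (bigD1 (Ordinal ij)) //= addKn big1 ?addr0 // => l.
rewrite -val_eqE /= neq_ltn => /orP[/ui->|il]; first by rewrite mul0r.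
by rewrite vj ?mulr0 //; have := ltn_ord l; lia.
Qed.

(** [value] gives the coefficients of a ring morphism to k[t], so the lowest nonzero coefficients
    multiply. *)
Lemma value_prime : is_prime_ideal [set f | forall l, value f l = 0].
Proof.
split.
- split=> [l|f g hf hg l|r f hf l] /=.
  + by rewrite /value (ca0 cd) (cb0 cd) horner0 addr0.
  + by rewrite valueD hf hg addr0.
  + by rewrite valueM big1 // => i _; rewrite hf mulr0.
- by move=> /(_ 0%N) /eqP; rewrite /value ca1 cb1 !hornerE oner_eq0.
move=> f g fg; have [|nf] := pselect (forall l, value f l = 0); first by left.
right=> l; apply/eqP; apply: contrapT => /negP gl.
have exf : exists l, value f l != 0.
  by apply: contrapT => nex; apply: nf => i; apply/eqP; apply: contrapT => /negP ?; apply: nex; exists i.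
have exg : exists l, value g l != 0 by exists l.
case: (ex_minnP exf) => i fi mini; case: (ex_minnP exg) => j gj minj.
have := fg (i + j)%N; rewrite valueM convolution_lowest => [/eqP||].
- by rewrite mulf_eq0 (negPf fi) (negPf gj).
- by move=> l' l'i; apply/eqP; apply: contraTT l'i => /mini; rewrite leqNgt.
- by move=> l' l'i; apply/eqP; apply: contraTT l'i => /minj; rewrite leqNgt.
Qed.

Lemma maximal_ideal_prime : is_prime_ideal (maximal_ideal ca).
Proof.
split.
- split=> [|f g|r f] /=; rewrite /maximal_ideal /=; first exact: (ca0 cd).
    by move=> f0 g0; rewrite (coord_aD cd) f0 g0 addr0.
  by move=> f0; rewrite (coord_aM cd) big_ord1 f0 (cb_at0 cd) !(mulr0, mul0r, addr0).
- by rewrite /maximal_ideal /= ca1 => /eqP; rewrite oner_eq0.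
move=> f g; rewrite /maximal_ideal /= (coord_aM cd) big_ord1 (cb_at0 cd) !mul0r addr0 subnn.
by move/eqP; rewrite mulf_eq0 => /orP[]/eqP; [left|right].
Qed.

(** On the cone over the curve the chain is: the whole cone, the line over a point, the vertex. The
    form X Y^2 separates the first two ideals and Y^3 the last two. *)
Lemma krull_dim2 : has_krull_dim A 2.
Proof.
split; last exact: prime_chain_le2.
have b1 : bounded 1 ('X : {poly k}) 0 by rewrite /bounded size_polyX size_poly0.
have b2 : bounded 1 (1 : {poly k}) 0 by rewrite /bounded size_poly1 size_poly0.
exists (fun i => if i is i'.+1 then if i' is 0%N then [set f | forall l, value f l = 0]
  else maximal_ideal ca else [set 0]); split.
- case=> [|[|i]] _; [|exact: value_prime|exact: maximal_ideal_prime].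
  split=> [||f g /A_domain //].
    by split=> [//|f g -> ->|r f ->] /=; rewrite ?addr0 ?mulr0.
  by move/eqP; rewrite oner_eq0.
case=> [|[|//]] _; split.
- by move=> _ -> l; rewrite /value (ca0 cd) (cb0 cd) horner0 addr0.
- move=> /(_ (homog 1 'X 0)) h; have /h /= : [set f | forall l, value f l = 0] (homog 1 'X 0).
    by move=> l; rewrite /value (ca_homog cd) // (cb_homog cd) //; case: eqP; rewrite !hornerE.
  move=> /(congr1 (fun f => ca f 1)); rewrite (ca_homog cd) // (ca0 cd) => /eqP.
  by rewrite polyX_eq0.
- move=> f /(_ 0%N); rewrite /value (cb_at0 cd) horner0 addr0 /maximal_ideal /=.
  by have [c ->] := ca0_const cd f; rewrite hornerC => ->; rewrite polyC0.
move=> /(_ (homog 1 1 0)) h; have /h /(_ 1%N) /= : maximal_ideal ca (homog 1 1 0).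
  by rewrite /maximal_ideal /= (ca_homog cd).
rewrite /value (ca_homog cd) // (cb_homog cd) //= !hornerE => /eqP.
by rewrite oner_eq0.
Qed.

End KrullDimension.

(** * The section ring in coordinates *)

Section SectionRingCoordinates.
Variables (k : closedFieldType) (p : nat).
Hypotheses (hp : p \in [pchar k]) (p2 : p <> 2%N) (p3 : p <> 3%N).
Variables (K : fieldType) (iota : {rmorphism k -> K}) (x z : K).
Hypothesis hC : is_sextic_function_field iota x z.
Variable D : K -> K.
Hypothesis hD : is_derivation_wrt iota x D.
Local Notation ev := (ev iota x).
Local Notation C := (sextic_charts x z).
Local Notation omega3 := (tensor_power iota C (canonical_bundle iota C D) 3).
Local Notation A := (section_ring iota C omega3).

Local Notation coef f l := ((val (f : A) : {poly K})`_l).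

Let zx : z ^+ 2 = x ^+ 6 + 1. Proof. by case: hC. Qed.

Lemma coordinates_ex (f : A) l : exists ab : {poly k} * {poly k},
  bounded l ab.1 ab.2 /\ coef f l * z ^+ (3 * l) = ev ab.1 + ev ab.2 * z.
Proof.
have /asboolP/(_ l) := valP f.
move=> /(global_sections_omega3 hp p2 p3 hC hD)[a [b [sa sb e]]].
by exists (a, b); rewrite /bounded sa sb.
Qed.

Definition coordinates (f : A) l := projT1 (cid (coordinates_ex f l)).
Definition coord_a (f : A) l : {poly k} := (coordinates f l).1.
Definition coord_b (f : A) l : {poly k} := (coordinates f l).2.

Lemma coordinates_bounded f l : bounded l (coord_a f l) (coord_b f l).
Proof. by rewrite /coord_a /coord_b /coordinates; case: cid => ? []. Qed.

Lemma coordinatesE f l :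
  coef f l * z ^+ (3 * l) = ev (coord_a f l) + ev (coord_b f l) * z.
Proof. by rewrite /coord_a /coord_b /coordinates; case: cid => ? []. Qed.

(** By independence of 1 and z the coordinates picked by [cid] are the only possible ones, so
    exhibiting any such expression computes them. *)
Lemma coordinates_uniq f l a b :
  coef f l * z ^+ (3 * l) = ev a + ev b * z -> coord_a f l = a /\ coord_b f l = b.
Proof.
rewrite coordinatesE => e.
have [] := @ev_independent _ _ hp p2 p3 _ _ _ _ hC (coord_a f l - a) (coord_b f l - b).
  apply/eqP; rewrite !(evD, evN) mulrBl addrACA -opprD subr_eq0; exact/eqP.
by move=> /eqP; rewrite subr_eq0 => /eqP -> /eqP; rewrite subr_eq0 => /eqP ->.
Qed.

Let z0 n : z ^+ n != 0.
Proof. by rewrite expf_neq0 // (z_neq0 hC). Qed.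

Lemma coordinatesM f g l : coord_a (f * g) l = \sum_(i < l.+1) (coord_a f i * coord_a g (l - i)%N +
    coord_b f i * coord_b g (l - i)%N * sextic k) /\
  coord_b (f * g) l = \sum_(i < l.+1) (coord_a f i * coord_b g (l - i)%N + coord_b f i * coord_a g (l - i)%N).
Proof.
apply: coordinates_uniq; rewrite coefM mulr_suml.
rewrite !(big_morph ev (evD _ _) (ev0 _ _)) mulr_suml -big_split /=.
apply: eq_bigr => i _.
have -> : (3 * l = 3 * i + 3 * (l - i))%N by rewrite -mulnDr subnKC // -ltnS.
by rewrite exprD mulrACA !coordinatesE !(ev_sextic, evD, evM) -zx; ring.
Qed.

Lemma section_ex l a b : bounded l a b -> exists f : A, forall i,
  coord_a f i = (if i == l then a else 0) /\ coord_b f i = (if i == l then b else 0).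
Proof.
move=> /andP[sa sb]; pose c := (ev a + ev b * z) / z ^+ (3 * l).
have cl : global_sections (tensor_power iota C omega3 l) c.
  apply/(global_sections_omega3 hp p2 p3 hC hD); exists a, b; split=> //.
  by rewrite divfK.
have cp : section_ring_pred iota C omega3 (c *: 'X^l).
  apply/asboolP => i; rewrite coefZ coefXn; case: eqP => [->|_]; first by rewrite mulr1.
  rewrite mulr0 => t; by case: (tensor_power_subgroup iota C omega3 i t).
exists (exist (fun f => section_ring_pred iota C omega3 f) _ cp : A) => i; apply: coordinates_uniq; rewrite /= coefZ coefXn.
case: eqP => [->|_]; first by rewrite mulr1 divfK.
by rewrite !ev0 !(mulr0, mul0r) addr0.
Qed.

Lemma section_coordinates : sextic_coordinates coord_a coord_b.
Proof.
split.
- exact: coordinates_bounded.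
- move=> f g l; apply: (proj1 (@coordinates_uniq _ _ _ (coord_b f l + coord_b g l) _)).
  by rewrite raddfD coefD mulrDl !coordinatesE !evD; ring.
- move=> f g l; apply: (proj2 (@coordinates_uniq _ _ (coord_a f l + coord_a g l) _ _)).
  by rewrite raddfD coefD mulrDl !coordinatesE !evD; ring.
- by move=> f g l; case: (coordinatesM f g l).
- by move=> f g l; case: (coordinatesM f g l).
- exact: section_ex.
- move=> f g fg; apply/val_inj/polyP => l; apply: (mulIf (z0 (3 * l))).
  by rewrite !coordinatesE; have [-> ->] := fg l.
move=> f; exists (size (val f : {poly K})) => l fl; apply: coordinates_uniq.
by rewrite nth_default // !ev0 !mul0r addr0.
Qed.

Lemma irrelevant_idealE : @irrelevant_ideal k K iota bool C omega3 = maximal_ideal coord_a.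
Proof.
apply/seteqP; split=> f; rewrite /irrelevant_ideal /maximal_ideal /= => h.
  by apply: (proj1 (@coordinates_uniq f 0 0 0 _)); rewrite h !ev0 !mul0r addr0.
have := coordinatesE f 0; rewrite h (cb_at0 section_coordinates) !ev0 mul0r addr0 => /eqP.
by rewrite mulf_eq0 (negPf (z0 _)) orbF => /eqP.
Qed.

Lemma section_ring_domain (f g : A) : f * g = 0 -> f = 0 \/ g = 0.
Proof.
move=> /(congr1 val); rewrite rmorphM rmorph0 => /eqP; rewrite mulf_eq0.
by case/orP => /eqP h; [left|right]; apply: val_inj; rewrite rmorph0.
Qed.

Lemma section_ring_pchar : p \in [pchar A].
Proof.
apply/andP; split; first by case/andP: hp.
apply/eqP/val_inj; rewrite rmorph0 rmorph_nat -polyC_natr -(rmorph_nat iota).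
by rewrite (pcharf0 hp) rmorph0 polyC0.
Qed.

End SectionRingCoordinates.

(** * Asymptotics of the colengths *)

Import Order.TTheory Num.Theory numFieldNormedType.Exports.

Section Asymptotics.
Variables (k : fieldType) (p e n : nat).
Local Open Scope nat_scope.
Local Notation q := (p ^ e).
Hypothesis qn : q = (2 * n).+1.

(** Once 3K >= A, a step adds 6 (3K - A) + 9 to the square and 6 (3K - A) to the sum. *)
Lemma sum_sub3 A K : 6 * (\sum_(l < K) (3 * l - A)) <= (3 * K - A) ^ 2 <=
  6 * (\sum_(l < K) (3 * l - A)) + 9 * K.
Proof.
elim: K => [|K IHK]; first by rewrite big_ord0; lia.
by rewrite big_ord_recr /=; move: IHK; move: (\sum_(_ < _) _) => S; rewrite !expnS !expn0; nia.
Qed.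

Lemma square_near t s m : t <= s <= t + 4 -> t <= 4 * m -> 0 < m ->
  t ^ 2 <= s ^ 2 <= t ^ 2 + 48 * m.
Proof. by rewrite !expnS !expn0; nia. Qed.

(** Summing m - 5L + E(L) over m = 3l up to 4q, for a and for b, gives one third of (4q)^2 - 5 q^2
    plus the squares (q - a_i)^2; hence 11 = 16 - 5. *)
Lemma graded_colength_estimate (E : nat -> nat) a b c d :
  codimension_estimate k q E 24 ->
  (forall L, E L = (L - a) + (L - b) + (L - c) + (L - d)) ->
  a <= q -> b <= q -> c <= q -> d <= q ->
  3 * q <= a + b + c + d + 24 -> a + b + c + d <= 3 * q + 24 ->
  let len := graded_colength k p e n ((4 * q + 4) %/ 3) in
  let sq := 11 * q ^ 2 + ((q - a) ^ 2 + (q - b) ^ 2 + (q - c) ^ 2 + (q - d) ^ 2) in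
  3 * len <= sq + 2000 * q /\ sq <= 3 * len + 2000 * q.
Proof.
move=> est EE aq bq cq dq s1 s2 len sq.
have q0 : 0 < q by rewrite qn.
set K := (4 * q + 4) %/ 3 in len *.
have K1 : 4 * q + 2 <= 3 * K <= 4 * q + 4 by rewrite /K; clear; lia.
(* Rounding K up lets m slightly exceed 4q. The codimension is 0 there, and the estimate persists
   because the thresholds add up to 3q within 24. *)
have h1 n' m : q./2 <= n' <= q./2.+1 -> m <= 4 * q + 2 ->
    let h := codimension k m (cube_exponents q m) n' in let L := m - 3 * q in
    h + 5 * L <= m + E L + 60 /\ m + E L <= h + 5 * L + 60.
  move=> nn mq h L; have [mq'|qm] := leqP m (4 * q).
    by have [] := est n' m nn mq'; rewrite -/h -/L; lia.
  have -> : h = 0 by apply: codimension_large => //; exact: ltnW.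
  by rewrite EE /L; move: aq bq cq dq s1 s2 mq qm; clear; lia.
pose G A := \sum_(l < K) (3 * l - A).
have len1 : len + 10 * G (3 * q) <= 2 * G 0 + 2 * (G (3 * q + a) + G (3 * q + b)
     + G (3 * q + c) + G (3 * q + d)) + 150 * K /\
   2 * G 0 + 2 * (G (3 * q + a) + G (3 * q + b) + G (3 * q + c) + G (3 * q + d)) <=
   len + 10 * G (3 * q) + 150 * K.
  rewrite /len /graded_colength /G -[K in 150 * K]card_ord -sum1_card.
  rewrite !big_distrr /= -!big_split /= !big_distrr /= -!big_split /=.
  suff pt (l : 'I_K) :
      codimension k (3 * l).+1 (cube_exponents q (3 * l).+1) n.+1 +
      codimension k (3 * l - 2) (cube_exponents q (3 * l - 2)) n + 10 * (3 * l - 3 * q) <=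
      2 * (3 * l - 0) + 2 * (3 * l - (3 * q + a) + (3 * l - (3 * q + b)) +
        (3 * l - (3 * q + c)) + (3 * l - (3 * q + d))) + 150 * 1 /\
      2 * (3 * l - 0) + 2 * (3 * l - (3 * q + a) + (3 * l - (3 * q + b)) +
        (3 * l - (3 * q + c)) + (3 * l - (3 * q + d))) <=
      codimension k (3 * l).+1 (cube_exponents q (3 * l).+1) n.+1 +
      codimension k (3 * l - 2) (cube_exponents q (3 * l - 2)) n + 10 * (3 * l - 3 * q) + 150 * 1.
    by split; apply: leq_sum => l _; have [] := pt l.
  have lK := ltn_ord l.
  have q2 : q./2 = n by rewrite qn /= mul2n uphalf_double.
  have [] := h1 n.+1 (3 * l).+1 ltac:(by rewrite q2; clear; lia) ltac:(by move: lK K1; clear; lia).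
  have [] := h1 n (3 * l - 2) ltac:(by rewrite q2; clear; lia) ltac:(by move: lK K1; clear; lia).
  move: (codimension _ _ _ _) (codimension _ _ _ _) => x y; rewrite !EE.
  move: (nat_of_ord l) => i.
  have r1 t : 3 * i - (3 * q + t) <= (3 * i).+1 - 3 * q - t <= 3 * i - (3 * q + t) + 1.
    by clear; lia.
  have r2 t : 3 * i - 2 - 3 * q - t <= 3 * i - (3 * q + t) <= 3 * i - 2 - 3 * q - t + 2.
    by clear; lia.
  move: (r1 a) (r1 b) (r1 c) (r1 d) (r2 a) (r2 b) (r2 c) (r2 d).
  have r3 : 3 * i - 3 * q <= (3 * i).+1 - 3 * q <= 3 * i - 3 * q + 1 by clear; lia.
  have r4 : 3 * i - 2 - 3 * q <= 3 * i - 3 * q <= 3 * i - 2 - 3 * q + 2 by clear; lia.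
  have r5 : 3 * i - 2 <= 3 * i <= 3 * i - 2 + 2 by clear; lia.
  move: r3 r4 r5; rewrite subn0; clear.
  move: ((3 * i).+1 - 3 * q - a) ((3 * i).+1 - 3 * q - b) ((3 * i).+1 - 3 * q - c)
    ((3 * i).+1 - 3 * q - d) (3 * i - 2 - 3 * q - a) (3 * i - 2 - 3 * q - b)
    (3 * i - 2 - 3 * q - c) (3 * i - 2 - 3 * q - d) => t1 t2 t3 t4 t5 t6 t7 t8.
  move: ((3 * i).+1 - 3 * q) (3 * i - 2 - 3 * q) (3 * i - 3 * q) (3 * i - 2) => t9 t10 t11 t12.
  move: (3 * i - (3 * q + a)) (3 * i - (3 * q + b)) (3 * i - (3 * q + c))
    (3 * i - (3 * q + d)) => t13 t14 t15 t16.
  by lia.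
have SG A B : B <= 4 * q -> A + B = 4 * q -> B ^ 2 <= 6 * G A + 9 * K /\ 6 * G A <= B ^ 2 + 48 * q.
  move=> Bq AB; have := sum_sub3 A K; rewrite -/(G A).
  have BK : B <= 3 * K - A <= B + 4 by move: K1 AB; clear; lia.
  have := square_near BK Bq q0; move: (G A) (_ ^ 2) (_ ^ 2); clear; lia.
have [a1 a2] := SG 0 (4 * q) ltac:(done) ltac:(done).
have [b1 b2] := SG (3 * q) q ltac:(clear; lia) ltac:(clear; lia).
have T t : t <= q -> (q - t) ^ 2 <= 6 * G (3 * q + t) + 9 * K /\ 6 * G (3 * q + t) <= (q - t) ^ 2 + 48 * q.
  by move=> tq; apply: SG; move: tq; clear; lia.
move: a1 a2 b1 b2 (T a aq) (T b bq) (T c cq) (T d dq) len1 K1 q0.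
rewrite expnMn /sq; clear.
move: (G _) (G _) (G _) (G _) (G _) (G _) => g0 g1 g2 g3 g4 g5.
move: q len => r len.
move: (r ^ 2) ((r - a) ^ 2) ((r - b) ^ 2) ((r - c) ^ 2) ((r - d) ^ 2); clear; lia.
Qed.

(** All four q - a_i are about q/4, and (4/3) (11 + 1/4) = 15. *)
Lemma colength_limit17 : p \in [pchar k] -> p <> 2 -> p <> 3 ->
  p = 1 %[mod 8] \/ p = 7 %[mod 8] ->
  let len := graded_colength k p e n ((4 * q + 4) %/ 3) in
  4 * len <= 15 * q ^ 2 + 3000 * q /\ 15 * q ^ 2 <= 4 * len + 3000 * q.
Proof.
move=> hp p2 p3 p8 len; have q0 : 0 < q by rewrite qn.
have [l [lq est]] := estimate17 hp p2 p3 e p8.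
have EE L : 4 * (L - l) = (L - l) + (L - l) + (L - l) + (L - l) by clear; lia.
have h := graded_colength_estimate est EE.
have [] := h ltac:(clear -lq; lia) ltac:(clear -lq; lia) ltac:(clear -lq; lia)
  ltac:(clear -lq; lia) ltac:(clear -lq; lia) ltac:(clear -lq; lia).
rewrite -/len; have : (q - l) ^ 2 * 16 <= q ^ 2 + 200 * q /\ q ^ 2 <= (q - l) ^ 2 * 16 + 200 * q.
  have : q - l <= q /\ q <= 4 * (q - l) + 18 /\ 4 * (q - l) <= q + 39 by move: lq; clear; lia.
  by move: (q - l) q0 => s; rewrite !expnS !expn0; clear; nia.
move: q (len) => r m; move: (r ^ 2) ((r - l) ^ 2); clear; lia.
Qed.

(** With Q = q/p the numbers q - a_i are q/4 + Q/4 three times and q/4 - 3Q/4 once, up to constants.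
    The linear terms cancel, the squares add 12 Q^2/16, and the factor 4/3 makes this Q^2. *)
Lemma colength_limit3 : p \in [pchar k] -> p <> 2 -> p <> 3 -> 1 < e ->
  p = 3 %[mod 8] ->
  let len := graded_colength k p e n ((4 * q + 4) %/ 3) in
  4 * len <= 15 * q ^ 2 + (p ^ e.-1) ^ 2 + 3000 * q /\
  15 * q ^ 2 + (p ^ e.-1) ^ 2 <= 4 * len + 3000 * q.
Proof.
move=> hp p2 p3 e1 p8 len; have q0 : 0 < q by rewrite qn.
have e0 : 0 < e.-1 by move: e1; clear; lia.
have est := estimate3 hp p2 p3 p8 e0; set Q := p ^ e.-1 in est *.
have qE : q = p * Q by rewrite -expnS prednK // ltnW.
have qQ : q = 8 * (Q * (p %/ 8)) + 3 * Q.
  have pE : p = 8 * (p %/ 8) + 3 by move: p8; clear; lia.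
  by rewrite qE {1}pE; ring.
have Q2 : 2 < Q.
  by have := @leq_pexp2l p 1 e.-1 ltac:(move: p8; clear; lia) e0; rewrite expn1 -/Q; move: p8; clear; lia.
rewrite /= -qE in est.
set a := 6 * (Q * (p %/ 8)) + (2 * Q - 3) in est; set b := 6 * (Q * (p %/ 8)) + 3 * Q in est.
have EE L : 3 * (L - a) + (L - b) = (L - a) + (L - a) + (L - a) + (L - b) by clear; lia.
have sQ : q - a = 2 * (Q * (p %/ 8)) + Q + 3 by rewrite qQ /a; move: Q2; clear; lia.
have tQ : q - b = 2 * (Q * (p %/ 8)) by rewrite qQ /b; clear; lia.
have := graded_colength_estimate est EE; rewrite -/len.
rewrite sQ tQ qQ /a /b; move: (Q * _) => v h.
have [] := h ltac:(clear -Q2; lia) ltac:(clear -Q2; lia) ltac:(clear -Q2; lia)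
  ltac:(clear -Q2; lia) ltac:(clear -Q2; lia) ltac:(clear -Q2; lia).
by rewrite !expnS !expn0; move: (len) => m; clear -Q2; lia.
Qed.

(** The shifts of the preceding case with opposite signs: - Q/4 three times and + 3Q/4 once, with
    the same squares. *)
Lemma colength_limit5 : p \in [pchar k] -> p <> 2 -> p <> 3 -> 1 < e ->
  p = 5 %[mod 8] ->
  let len := graded_colength k p e n ((4 * q + 4) %/ 3) in
  4 * len <= 15 * q ^ 2 + (p ^ e.-1) ^ 2 + 3000 * q /\
  15 * q ^ 2 + (p ^ e.-1) ^ 2 <= 4 * len + 3000 * q.
Proof.
move=> hp p2 p3 e1 p8 len; have q0 : 0 < q by rewrite qn.
have e0 : 0 < e.-1 by move: e1; clear; lia.
have est := estimate5 hp p2 p3 p8 e0; set Q := p ^ e.-1 in est *.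
have qE : q = p * Q by rewrite -expnS prednK // ltnW.
have qQ : q = 8 * (Q * (p %/ 8)) + 5 * Q.
  have pE : p = 8 * (p %/ 8) + 5 by move: p8; clear; lia.
  by rewrite qE {1}pE; ring.
have Q2 : 2 < Q.
  by have := @leq_pexp2l p 1 e.-1 ltac:(move: p8; clear; lia) e0; rewrite expn1 -/Q; move: p8; clear; lia.
rewrite /= -qE in est.
set a := 6 * (Q * (p %/ 8)) + 3 * Q in est; set b := 6 * (Q * (p %/ 8)) + (4 * Q - 3) in est.
have EE L : (L - a) + 3 * (L - b) = (L - b) + (L - b) + (L - b) + (L - a) by clear; lia.
have sQ : q - a = 2 * (Q * (p %/ 8)) + 2 * Q by rewrite qQ /a; clear; lia.
have tQ : q - b = 2 * (Q * (p %/ 8)) + Q + 3 by rewrite qQ /b; move: Q2; clear; lia.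
have := graded_colength_estimate est EE; rewrite -/len.
rewrite sQ tQ qQ /a /b; move: (Q * _) => v h.
have [] := h ltac:(clear -Q2; lia) ltac:(clear -Q2; lia) ltac:(clear -Q2; lia)
  ltac:(clear -Q2; lia) ltac:(clear -Q2; lia) ltac:(clear -Q2; lia).
by rewrite !expnS !expn0; move: (len) => m; clear -Q2; lia.
Qed.

End Asymptotics.

Lemma quadratic_limit (R : realType) p (p1 : (1 < p)%N) (len : nat -> nat) (v c : R) N :
  (forall e, (N <= e)%N -> `|(len e)%:R - v * (p ^ e)%:R ^+ 2| <= c * (p ^ e)%:R) ->
  (fun e => (len e)%:R / (p ^ (2 * e))%:R : R) @ \oo --> v.
Proof.
move=> le; have p0 : (0 : R) < p%:R by rewrite ltr0n ltnW.
have lim : (fun e => c * (p%:R^-1) ^+ e : R) @ \oo --> (0 : R).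
  rewrite -[X in _ --> X](mulr0 c); apply: cvgMr; apply: cvg_expr.
  by rewrite ger0_norm ?invr_ge0 ?ltW // invf_lt1 // ltr1n.
apply: (@squeeze_cvgr _ _ _ _ (fun e => v - c * p%:R^-1 ^+ e) (fun e => v + c * p%:R^-1 ^+ e)).
- near=> e.
  have qe : (0 : R) < (p ^ e)%:R by rewrite ltr0n expn_gt0 ltnW.
  have : `|(len e)%:R - v * (p ^ e)%:R ^+ 2| <= c * (p ^ e)%:R.
    by apply: le; near: e; exact: nbhs_infty_ge.
  rewrite ler_norml => /andP[lo up].
  rewrite exprVn -natrX mulnC expnM [X in _ / X]natrX.
  rewrite ler_pdivrMr ?exprn_gt0 // ler_pdivlMr ?exprn_gt0 //.
  have cE : c * (p ^ e)%:R^-1 * (p ^ e)%:R ^+ 2 = c * (p ^ e)%:R :> R by field; rewrite gt_eqF.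
  by rewrite mulrBl mulrDl cE; apply/andP; split; lra.
- by rewrite -[X in _ --> X]subr0; apply: cvgB => //; exact: cvg_cst.
- by rewrite -[X in _ --> X]addr0; apply: cvgD => //; exact: cvg_cst.
Unshelve. all: by end_near. Qed.

(** * The Hilbert-Kunz limits *)

Section HilbertKunzLimit.
Variables (k : closedFieldType) (p : nat).
Hypotheses (hp : p \in [pchar k]) (p2 : p <> 2%N) (p3 : p <> 3%N).
Local Notation len e := (graded_colength k p e (p ^ e)./2 ((4 * p ^ e + 4) %/ 3)).

Lemma half_power e : (p ^ e = (2 * (p ^ e)./2).+1)%N.
Proof.
by rewrite -[LHS]odd_double_half (odd_char_exp hp p2) mul2n.
Qed.

Lemma char_gt1 : (1 < p)%N.
Proof. by apply: prime_gt1; case/andP: hp. Qed.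

Lemma colength_cvg17 (R : realType) : p = 1 %[mod 8] \/ p = 7 %[mod 8] ->
  (fun e => (len e)%:R / (p ^ (2 * e))%:R : R) @ \oo --> (15%:R / 4%:R : R).
Proof.
move=> p8; apply: (@quadratic_limit _ _ char_gt1 _ _ 750%:R 0) => e _.
have [] := colength_limit17 (half_power e) hp p2 p3 p8.
rewrite -!(ler_nat R) !(natrD, natrM, natrX) => up lo.
by rewrite ler_norml; apply/andP; split; lra.
Qed.

Lemma colength_cvg35 (R : realType) : p = 3 %[mod 8] \/ p = 5 %[mod 8] ->
  (fun e => (len e)%:R / (p ^ (2 * e))%:R : R) @ \oo -->
    (15%:R / 4%:R + 1 / (4%:R * p%:R ^+ 2) : R).
Proof.
move=> p8; apply: (@quadratic_limit _ _ char_gt1 _ _ 750%:R 2) => e e1.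
have p0 : (p%:R : R) != 0 by rewrite pnatr_eq0 -lt0n ltnW // char_gt1.
have : (4 * len e <= 15 * (p ^ e) ^ 2 + (p ^ e.-1) ^ 2 + 3000 * p ^ e)%N /\
    (15 * (p ^ e) ^ 2 + (p ^ e.-1) ^ 2 <= 4 * len e + 3000 * p ^ e)%N.
  by case: p8; [apply: colength_limit3|apply: colength_limit5]; rewrite -?half_power.
have qE : (p ^ e)%:R = p%:R * (p ^ e.-1)%:R :> R by rewrite -natrM -expnS prednK // ltnW.
case; rewrite -!(ler_nat R) !(natrD, natrM) => up lo.
have -> : (15%:R / 4%:R + 1 / (4%:R * p%:R ^+ 2)) * (p ^ e)%:R ^+ 2 =
    15%:R / 4%:R * (p ^ e)%:R ^+ 2 + (p ^ e.-1)%:R ^+ 2 / 4%:R :> R by rewrite qE; field.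
by rewrite ler_norml; apply/andP; split; lra.
Qed.

Variables (K : fieldType) (iota : {rmorphism k -> K}) (x z : K).
Hypothesis hC : is_sextic_function_field iota x z.
Variable D : K -> K.
Hypothesis hD : is_derivation_wrt iota x D.
Local Notation C := (sextic_charts x z).
Local Notation omega3 := (tensor_power iota C (canonical_bundle iota C D) 3).

Lemma eHK_of_cvg (R : realType) (v : R) :
  (fun e => (len e)%:R / (p ^ (2 * e))%:R : R) @ \oo --> v ->
  curve_has_eHK iota C p omega3 v.
Proof.
have cd := section_coordinates hp p2 p3 hC hD.
move=> lim; exists 2; split.
  exact: (krull_dim2 cd (@section_ring_domain _ _ _ _ _ _)).
exists (fun e => len e); split=> // e.
rewrite (irrelevant_idealE hp p2 p3 hC hD).
rewrite (frobenius_powerE cd hp (section_ring_pchar hp iota x z D) (half_power e)).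
have q0 : (0 < p ^ e)%N by rewrite half_power.
by apply: (graded_ideal_colength cd) => //; lia.
Qed.

End HilbertKunzLimit.

Theorem theorem2p17 (R : realType) (k : closedFieldType) (p : nat)
    (hp : p \in [pchar k]) (hp2 : p <> 2%N) (hp3 : p <> 3%N)
    (K : fieldType) (iota : {rmorphism k -> K}) (x z : K)
    (hC : is_sextic_function_field iota x z)
    (D : K -> K) (hD : is_derivation_wrt iota x D) :
  let C := sextic_charts x z in
  let omega := canonical_bundle iota C D in
  let omega3 := tensor_power iota C omega 3 in
  ((p = 1 %[mod 8] \/ p = 7 %[mod 8]) ->
     curve_has_eHK iota C p omega3 (15%:R / 4%:R : R)) /\
  ((p = 3 %[mod 8] \/ p = 5 %[mod 8]) ->
     curve_has_eHK iota C p omega3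
       (15%:R / 4%:R + 1 / (4%:R * p%:R ^+ 2) : R)).
Proof.
split=> p8; apply: (eHK_of_cvg hp hp2 hp3 hC hD).
  exact: (colength_cvg17 hp hp2 hp3).
exact: (colength_cvg35 hp hp2 hp3).
Qed.
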